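(* Let $M$ be a first order structure, with $\mathrm{Aut}(M)$ equipped with the pointwise convergence topology. If the ambit $(\mathrm{Aut}(M),\Sigma^{\mathcal{M}},\mathrm{tp}^{\mathrm{full}}(\bar m))$ has sep. fin. EDRdeg, then the Ellis group of this ambit is profinite and every distal minimal $\mathrm{Aut}(M)$-flow is a profinite flow (i.e. an inverse limit of finite flows). In particular, if $M$ has sep. fin. ERdeg (which for countable $M$ is equivalent to metrizability of the universal minimal $\mathrm{Aut}(M)$-flow), then every distal minimal $\mathrm{Aut}(M)$-flow is a profinite flow.
   Context: Flows are continuous actions of a topological group on compact Hausdorff spaces; an ambit is a flow with a distinguished point with dense orbit; it is $0$-dimensional if the space has a basis of clopen sets. A flow is minimal if every orbit is dense. A flow $(G,X)$ is distal if for any points $x\ne y$ there is no net $(g_i)$ in $G$ with $\lim_i g_ix=\lim_i g_iy$. The universal minimal $G$-flow is the minimal $G$-flow (unique up to isomorphism) which maps onto every minimal $G$-flow by a continuous $G$-equivariant map. The ambit. Let $G=\mathrm{Aut}(M)$ and let $\mathcal{M}$ be the two-sorted structure with disjoint sorts $G$ and $M$ and predicates for all subsets of all finite Cartesian products of sorts (the full language); types in this language are denoted $\mathrm{tp}^{\mathrm{full}}$. Let $\mathcal{M}^*=(G^*,M^*,\dots)\succ\mathcal{M}$ be a monster model; $G^*$ acts definably on $M^*$. Let $\bar m$ be an enumeration of $M$. Put $\Sigma^{\mathcal{M}}=\{\mathrm{tp}^{\mathrm{full}}(\sigma(\bar m)):\sigma\in G^*\}$ with the type space topology and the left $G$-action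 $g\cdot\mathrm{tp}^{\mathrm{full}}(\sigma(\bar m))=\mathrm{tp}^{\mathrm{full}}(\sigma(g^{-1}(\bar m)))$. Then $(G,\Sigma^{\mathcal{M}},\mathrm{tp}^{\mathrm{full}}(\bar m))$ is the universal $G$-ambit of the topological group $G$, and it is $0$-dimensional. Sep. fin. EDRdeg (separately finite externally definable Ramsey degree). For a $0$-dimensional ambit $(G,X,x_0)$ and a set $\Sigma$ of clopen subsets of $X$, an externally definable $\Sigma$-coloring is a function $c\colon G\to 2^n$ ($n\ge1$) such that for some $U_0,\dots,U_{n-1}\in\Sigma$ and $y_0,\dots,y_{n-1}\in X$, for all $g\in G$, $i<n$: $c(g)(i)=1$ if $y_i\in gU_i$ and $c(g)(i)=0$ otherwise. The ambit has sep. fin. EDRdeg if for every finite set $\Sigma$ of clopen subsets of $X$ there is $l\ge1$ such that for every externally definable $\Sigma$-coloring $c\colon G\to 2^n$ (any $n\geq 1$), every $k\ge 1$ and every $k$-element $A\subseteq G$ there is $h\in G$ with $|c[hA]|\le l$. Ellis group. The Ellis semigroup $E(X)$ is the closure in $X^X$ (product topology) of the set of maps $x\mapsto gx$, $g \in G$, with composition. For a minimal left ideal $\mathcal{L}$ of $E(X)$ and an idempotent $u\in\mathcal{L}$, the group $u\mathcal{L}$ (unique up to isomorphism) is the Ellis group of $X$; it carries the $\tau$-topology with closure operator $\mathrm{cl}_\tau(B)=u\mathcal{L}\cap(u\circ B)$, where $u\circ B$ is the set of all limits of nets $(g_ib_i)_i$ with $g_i\in G$, $b_i\in B$, $\lim_ig_i=u$.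 It is profinite if it is a profinite topological group in the $\tau$-topology. Sep. fin. ERdeg. For a tuple $\bar a$ in $M$ and $B\subseteq M$, $\binom{B}{\bar a}$ is the set of images of $\bar a$ under $\mathrm{Aut}(M)$ contained in $B$; similarly for a set in place of $\bar a$. $M$ has separately finite embedding Ramsey degree (sep. fin. ERdeg) if for every finite tuple $\bar a$ in $M$ there is $k_{\bar a}\in\omega$ such that for every finite $B\subseteq M$ containing $\bar a$ and every $r\in\omega$ there is a finite $C\subseteq M$ containing $B$ such that for every coloring $c\colon\binom{C}{\bar a}\to r$ there is $B'\in\binom{C}{B}$ with $|c[\binom{B'}{\bar a}]|\le k_{\bar a}$. *)

(* Defs.v *)
From HB Require Import structures.
From mathcomp Require Import all_boot all_order all_algebra all_fingroup.
From mathcomp Require Import all_classical all_reals all_analysis.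

Set Implicit Arguments.
Unset Strict Implicit.
Unset Printing Implicit Defensive.

Local Open Scope classical_set_scope.
Local Open Scope card_scope.
Local Open Scope group_scope.

(** * Topological groups and flows *)

HB.mixin Record isTopologicalGroup G of monoid.Group G & Topological G := {
  mulg_continuous : continuous (fun p : G * G => p.1 * p.2 : G);
  invg_continuous : continuous (fun g : G => g^-1 : G)
}.

#[short(type="topologicalGroupType")]
HB.structure Definition TopologicalGroup :=
  {G of isTopologicalGroup G & monoid.Group G & Topological G}.

Record flow (G : topologicalGroupType) := Flow {
  flow_sort :> topologicalType;
  flow_act : G -> flow_sort -> flow_sort;
  flow_act1 : forall x, flow_act 1 x = x;
  flow_actM : forall g h x, flow_act (g * h) x = flow_act g (flow_act h x);
  flow_continuous :
    continuous (fun p : G * flow_sort => flow_act p.1 p.2);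
  flow_compact : compact [set: flow_sort];
  flow_hausdorff : hausdorff_space flow_sort
}.

Definition flow_morphism (G : topologicalGroupType) (X Y : flow G)
    (f : X -> Y) : Prop :=
  continuous f /\ forall g x, f (flow_act g x) = flow_act g (f x).

(* The nonemptiness requirement is needed for a universal minimal flow, which
   maps onto every minimal flow, to exist. *)
Definition minimal_flow (G : topologicalGroupType) (X : flow G) : Prop :=
  [set: X] !=set0 /\ forall x : X, dense (range (fun g : G => flow_act g x)).

(* Nets (g_i) in G are represented by proper filters on G. *)
Definition distal_flow (G : topologicalGroupType) (X : flow G) : Prop :=
  forall x y : X, x <> y ->
    ~ exists (F : set_system G) (z : X),
        [/\ ProperFilter F,
            (fun g => flow_act g x) @ F --> z &
            (fun g => flow_act g y) @ F --> z].

Definition universal_minimal_flow (G : topologicalGroupType) (X : flow G) :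
    Prop :=
  minimal_flow X /\
  forall Y : flow G, minimal_flow Y ->
    exists f : X -> Y, flow_morphism f /\ set_surj setT setT f.

Definition metrizable (R : realType) (X : topologicalType) : Prop :=
  exists (Y : metricType R) (f : X -> Y) (g : Y -> X),
    [/\ cancel f g, cancel g f, continuous f & continuous g].

(** * Inverse limits *)

Definition directed_order (I : Type) (le : I -> I -> Prop) : Prop :=
  [/\ inhabited I,
      forall i, le i i,
      forall i j k, le i j -> le j k -> le i k &
      forall i j, exists k, le i k /\ le j k].

(* The maps [t i j : T j -> T i] are only relevant for [le i j]. *)
Definition inverse_system (I : Type) (le : I -> I -> Prop) (T : I -> Type)
    (t : forall i j, T j -> T i) : Prop :=
  [/\ directed_order le,
      forall i x, t i i x = x &
      forall i j k, le i j -> le j k -> forall x, t i j (t j k x) = t i k x].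

Definition inverse_limit (I : Type) (le : I -> I -> Prop) (T : I -> Type)
    (t : forall i j, T j -> T i) : set (forall i, T i) :=
  [set x | forall i j, le i j -> t i j (x j) = x i].

(* Finite flows are discrete, being Hausdorff. *)
Definition profinite_flow (G : topologicalGroupType) (X : flow G) : Prop :=
  exists (I : Type) (le : I -> I -> Prop) (F : I -> flow G)
      (t : forall i j, F j -> F i) (f : X -> forall i, F i),
    [/\ forall i, finite_set [set: F i],
        inverse_system le t,
        forall i j, le i j -> flow_morphism (t i j) &
        [/\ set_bij setT (inverse_limit le t) f,
            forall g x i, f (flow_act g x) i = flow_act g (f x i) &
            forall U : set X, open U <->
              exists2 V : set (prod_topology F), open V & U = f @^-1` V]].

(* [H] is a set with a binary operation [mul] and a topology given by the
   family [cl] of its closed subsets. *)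
Definition profinite_group (T : Type) (H : set T) (mul : T -> T -> T)
    (cl : set (set T)) : Prop :=
  exists (I : Type) (le : I -> I -> Prop) (F : I -> finGroupType)
      (t : forall i j, F j -> F i) (f : T -> forall i, F i),
    [/\ inverse_system le t,
        forall i j, le i j -> {morph t i j : x y / x * y} &
        [/\ set_bij H (inverse_limit le t) f,
            forall a b i, H a -> H b -> f (mul a b) i = f a i * f b i &
            forall C : set T, cl C <->
              exists2 D : set (prod_topology (fun i => discrete_topology (F i))),
                closed D & C = H `&` f @^-1` D]].

(** * The Ellis group of an action *)

Section Ellis.
Context (G : Type) (X : topologicalType) (act : G -> X -> X).

Definition ellis_semigroup : set {ptws X -> X} :=
  closure (range act : set {ptws X -> X}).

Definition left_ideal (L : set {ptws X -> X}) : Prop :=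
  [/\ L !=set0, L `<=` ellis_semigroup &
      forall e f, ellis_semigroup e -> L f -> L (e \o f)].

Definition minimal_left_ideal (L : set {ptws X -> X}) : Prop :=
  left_ideal L /\ forall L', left_ideal L' -> L' `<=` L -> L' = L.

Definition ellis_group (L : set {ptws X -> X}) (u : {ptws X -> X}) :
    set {ptws X -> X} :=
  [set u \o f | f in L].

(* Nets of pairs (g_i, b_i) are represented by proper filters on the set of
   pairs. *)
Definition tau_circ (u : {ptws X -> X}) (B : set {ptws X -> X}) :
    set {ptws X -> X} :=
  [set f | exists F : set_system (G * {ptws X -> X}),
    [/\ ProperFilter F,
        F [set p | B p.2],
        (fun p => act p.1 : {ptws X -> X}) @ F --> u &
        (fun p => act p.1 \o p.2 : {ptws X -> X}) @ F --> f]].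

Definition tau_closure (L : set {ptws X -> X}) (u : {ptws X -> X})
    (B : set {ptws X -> X}) : set {ptws X -> X} :=
  ellis_group L u `&` tau_circ u B.

Definition tau_closed (L : set {ptws X -> X}) (u : {ptws X -> X}) :
    set (set {ptws X -> X}) :=
  [set B | B `<=` ellis_group L u /\ tau_closure L u B = B].

End Ellis.

(* The Ellis group does not depend, up to isomorphism, on the choice of the
   minimal left ideal and of the idempotent. *)
Definition profinite_ellis_group (G : Type) (X : topologicalType)
    (act : G -> X -> X) : Prop :=
  forall (L : set {ptws X -> X}) (u : {ptws X -> X}),
    minimal_left_ideal act L -> L u -> u \o u = u ->
    profinite_group (ellis_group L u) (fun f g => f \o g) (tau_closed act L u).

(** * Externally definable Ramsey degrees *)

Definition ext_definable_coloring (G X : Type) (act : G -> X -> X)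
    (S : set (set X)) (n : nat) (c : G -> {ffun 'I_n -> bool}) : Prop :=
  exists (U : 'I_n -> set X) (y : 'I_n -> X),
    (forall i, S (U i)) /\
    forall g i, c g i = true <-> (act g @` U i) (y i).

Definition sep_fin_EDRdeg (G : groupType) (X : topologicalType)
    (act : G -> X -> X) : Prop :=
  forall S : set (set X), finite_set S -> S `<=` clopen ->
    exists2 l : nat, (0 < l)%N &
      forall (n : nat) (c : G -> {ffun 'I_n -> bool}),
        (0 < n)%N -> ext_definable_coloring act S c ->
        forall (k : nat) (A : set G), (0 < k)%N -> A #= `I_k ->
          exists h : G, c @` [set h * a | a in A] #<= `I_l.

(** * First-order structures and their automorphism groups *)

Record language := Language {
  fsym : Type;
  farity : fsym -> nat;
  rsym : Type;
  rarity : rsym -> nat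
}.

Record structure (L : language) := Structure {
  dom :> choiceType;
  fint : forall s : fsym L, ('I_(farity s) -> dom) -> dom;
  rint : forall r : rsym L, set ('I_(rarity r) -> dom)
}.
Arguments fint {L} _ _ _.
Arguments rint {L} _ _.

Record aut (L : language) (M : structure L) := Aut {
  aut_fun :> M -> M;
  aut_inv : M -> M;
  aut_funK : cancel aut_fun aut_inv;
  aut_invK : cancel aut_inv aut_fun;
  aut_fint : forall s x, aut_fun (fint M s x) = fint M s (aut_fun \o x);
  aut_rint : forall r x, rint M r x <-> rint M r (aut_fun \o x)
}.

Section AutGroup.
Context (L : language) (M : structure L).
Implicit Types f g h : aut M.

Lemma aut_ext f g : f =1 g -> f = g.
Proof.
case: f g => [f f' fK f'K fF fR] [g g' gK g'K gF gR] /= fg.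
have E : f = g by apply/funext.
have E' : f' = g' by apply/funext => x; rewrite -[x in LHS]g'K -fg fK.
by move: fK f'K fF fR gK g'K gF gR; rewrite E E' => *; congr Aut;
  exact: Prop_irrelevance.
Qed.

HB.instance Definition _ := gen_eqMixin (aut M).
HB.instance Definition _ := gen_choiceMixin (aut M).

Definition aut_one : aut M.
Proof. exact: (@Aut L M id id). Defined.

Definition aut_mul f g : aut M.
Proof.
apply: (@Aut L M (f \o g) (aut_inv g \o aut_inv f)).
- by apply: can_comp; exact: aut_funK.
- by apply: can_comp; exact: aut_invK.
- by move=> s x /=; rewrite !aut_fint.
- by move=> r x; rewrite (aut_rint g) (aut_rint f).
Defined.

Definition aut_Inv f : aut M.
Proof.
apply: (@Aut L M (aut_inv f) f (@aut_invK _ _ f) (@aut_funK _ _ f)).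
- move=> s x; rewrite -[RHS](aut_funK f) aut_fint.
  by congr (aut_inv _ (fint _ _ _)); apply/funext => i /=; rewrite aut_invK.
- move=> r x; rewrite (aut_rint f (aut_inv f \o x)).
  suff -> : f \o (aut_inv f \o x) = x by [].
  by apply/funext => i /=; rewrite aut_invK.
Defined.

Fact aut_mulA : associative aut_mul.
Proof. by move=> f g h; exact: aut_ext. Qed.
Fact aut_mul1g : left_id aut_one aut_mul.
Proof. by move=> f; exact: aut_ext. Qed.
Fact aut_mulg1 : right_id aut_one aut_mul.
Proof. by move=> f; exact: aut_ext. Qed.
Fact aut_mulVg : left_inverse aut_one aut_Inv aut_mul.
Proof. by move=> f; apply: aut_ext => x /=; rewrite aut_funK. Qed.
Fact aut_mulgV : right_inverse aut_one aut_Inv aut_mul.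
Proof. by move=> f; apply: aut_ext => x /=; rewrite aut_invK. Qed.

HB.instance Definition _ := isGroup.Build (aut M)
  aut_mulA aut_mul1g aut_mulg1 aut_mulVg aut_mulgV.

Definition aut_ptws (f : aut M) : {ptws M -> discrete_topology M} := f.

HB.instance Definition _ :=
  Topological.copy (aut M) (initial_topology aut_ptws).

Lemma aut_cvgP (F : set_system (aut M)) f : Filter F ->
  F --> f <-> forall a : M, F [set g : aut M | g a = f a].
Proof.
move=> FF; split=> [Ff a|Ff].
  apply: Ff; exists [set g : aut M | g a = f a]; split => //.
  exists ((fun x : {ptws M -> discrete_topology M} => x a) @^-1` [set f a]) => //.
  apply: (@open_comp _ (discrete_topology M)); last exact: discrete_open.
  move=> x _.
  exact: (@proj_continuous M (fun=> discrete_topology M) a x).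
have cF : aut_ptws @ F --> aut_ptws f.
  apply/cvg_sup => a A [B [[C oC <-] Ca sBA]].
  apply: (@filterS _ F _ _ _ _ (Ff a)) => g ga; apply: sBA.
  by rewrite /= /aut_ptws ga.
move=> A [_ [[C oC <-] Cf sCA]]; apply: (@filterS _ F _ _ _ sCA).
by apply: cF; exact: open_nbhs_nbhs.
Qed.

Lemma aut_nbhs f a : nbhs f [set g : aut M | g a = f a].
Proof. by move: a; apply/(@aut_cvgP (nbhs f)). Qed.

Fact aut_mul_continuous : continuous (fun p : aut M * aut M => p.1 * p.2 : aut M).
Proof.
move=> [f g]; apply/aut_cvgP => a /=.
exists ([set f' : aut M | f' (g a) = f (g a)], [set g' : aut M | g' a = g a]).
  by split; exact: aut_nbhs.
by move=> [f' g'] /= [fga ga]; rewrite /mul /= ga.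
Qed.

Fact aut_inv_continuous : continuous (fun f : aut M => f^-1 : aut M).
Proof.
move=> f; have FF := fmap_filter (fun g : aut M => g^-1 : aut M) (nbhs_filter f).
apply/aut_cvgP => a /=; have : nbhs f [set f' : aut M | f' (aut_inv f a) = f (aut_inv f a)].
  exact: aut_nbhs.
apply: filterS => f' /= E.
by rewrite -[X in _ X = _](aut_invK f) -E aut_funK.
Qed.

HB.instance Definition _ := isTopologicalGroup.Build (aut M)
  aut_mul_continuous aut_inv_continuous.

End AutGroup.

(** * Embedding Ramsey degrees *)

Section ERdeg.
Context (L : language) (M : structure L).

Definition tuple_copies (B : set M) (n : nat) (a : 'I_n -> M) :
    set ('I_n -> M) :=
  [set x | range x `<=` B /\ exists f : aut M, x = f \o a].

Definition set_copies (C B : set M) : set (set M) :=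
  [set B' | B' `<=` C /\ exists f : aut M, B' = f @` B].

Definition sep_fin_ERdeg : Prop :=
  forall (n : nat) (a : 'I_n -> M), exists k : nat,
    forall (B : set M) (r : nat), finite_set B -> range a `<=` B ->
      exists C : set M, [/\ finite_set C, B `<=` C &
        forall c : ('I_n -> M) -> nat,
          (forall x, tuple_copies C a x -> (c x < r)%N) ->
          exists2 B', set_copies C B B' & c @` tuple_copies B' a #<= `I_k].

End ERdeg.

(** * Two-sorted logic in the full language *)

Inductive sort := SG | SM.

Fixpoint hprod (C : sort -> Type) (ss : seq sort) : Type :=
  if ss is s :: ss' then (C s * hprod C ss')%type else unit.

Fixpoint hmap (C D : sort -> Type) (f : forall s, C s -> D s) (ss : seq sort) :
    hprod C ss -> hprod D ss :=
  if ss is s :: ss' return hprod C ss -> hprod D ss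
  then fun x => (f s x.1, hmap f x.2) else id.

Section FullLanguage.
Context (C : sort -> Type).

Definition extv (V : sort -> Type) (s0 s : sort) : Type := (V s + (s0 = s))%type.

(* Formulas with free variables in the sorted family [V], over the language
   having a predicate symbol for each subset of each finite product of the
   sorts [C SG] and [C SM].  A quantifier binds one additional variable. *)
Inductive form (V : sort -> Type) : Type :=
| Pred ss (R : set (hprod C ss)) (x : hprod V ss)
| Equal s (x y : V s)
| Bot
| Imp (p q : form V)
| All s (p : form (extv V s)).

Record fullstr := Fullstr {
  car :> sort -> Type;
  pint : forall ss, set (hprod C ss) -> set (hprod car ss)
}.
Arguments pint _ {ss} _.

Definition base : fullstr := @Fullstr C (fun _ R => R).

Definition extval (N : sort -> Type) (V : sort -> Type) (v : forall s, V s -> N s)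
    s0 (b : N s0) s (x : extv V s0 s) : N s :=
  match x with
  | inl y => v s y
  | inr e => match e in _ = s return N s with erefl => b end
  end.

Fixpoint sat (N : fullstr) V (p : form V) : (forall s, V s -> N s) -> Prop :=
  match p with
  | Pred ss R x => fun v => pint N R (hmap v x)
  | Equal s x y => fun v => v s x = v s y
  | Bot => fun _ => False
  | Imp p q => fun v => sat p v -> sat q v
  | All s p => fun v => forall b : N s, sat p (extval v b)
  end.

Definition tp (N : fullstr) V (a : forall s, V s -> N s) : set (form V) :=
  [set p | sat p a].

Definition elementary (N N' : fullstr) (j : forall s, N s -> N' s) : Prop :=
  forall V (p : form V) (v : forall s, V s -> N s),
    sat p v <-> sat p (fun s x => j s (v s x)).

Definition automorphism (N : fullstr) (F : forall s, N s -> N s) : Prop :=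
  (forall s, bijective (F s)) /\
  forall ss (R : set (hprod C ss)) x, pint N R (hmap F x) <-> pint N R x.

(* |V| < |K|; cardinals are represented by types. *)
Definition smaller (V : sort -> Type) (K : Type) : Prop :=
  forall s, ~ ([set: K] #<= [set: V s]).

(* Sets of parameters of size < |K| are given as families indexed by [V]. *)
Definition saturated (N : fullstr) (K : Type) : Prop :=
  forall V (a : forall s, V s -> N s) s (P : set (form (extv V s))),
    smaller V K ->
    (forall Q, finite_set Q -> Q `<=` P ->
       exists b : N s, Q `<=` tp (extval a b)) ->
    exists b : N s, P `<=` tp (extval a b).

Definition strongly_homogeneous (N : fullstr) (K : Type) : Prop :=
  forall V (a b : forall s, V s -> N s),
    smaller V K -> tp a = tp b ->
    exists F, automorphism F /\ forall s x, F s (a s x) = b s x.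

Record monster_model := MonsterModel {
  monster :> fullstr;
  emb : forall s, C s -> monster s;
  emb_elementary : @elementary base monster emb;
  (* [form C] has the cardinality of the language. *)
  monster_big : exists K : Type,
    [/\ ~ ([set: K] #<= [set: form C]),
        saturated monster K &
        strongly_homogeneous monster K]
}.

Fixpoint rename V W (f : forall s, V s -> W s) (p : form V) : form W :=
  match p with
  | Pred ss R x => Pred R (hmap f x)
  | Equal s x y => Equal (f s x) (f s y)
  | Bot => Bot W
  | Imp p q => Imp (rename f p) (rename f q)
  | All s p => All (rename (fun s' x => match x return extv W s s' with
                                        | inl y => inl (f s' y)
                                        | inr e => inr e end) p)
  end.

Lemma hmap_comp (A B D : sort -> Type) (f : forall s, A s -> B s)
    (g : forall s, B s -> D s) ss (x : hprod A ss) :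
  hmap g (hmap f x) = hmap (fun s y => g s (f s y)) x.
Proof. by elim: ss x => //= s ss IH [x y] /=; rewrite IH. Qed.

Lemma sat_rename (N : fullstr) V W (f : forall s, V s -> W s) (p : form V)
    (v : forall s, W s -> N s) :
  sat (rename f p) v <-> sat p (fun s x => v s (f s x)).
Proof.
elim: p W f v => {V} [V ss R x|V s x y|V|V p IHp q IHq|V s p IHp] W f v //=.
- by rewrite hmap_comp.
- by split=> h /IHp /h /IHq.
- suff E b : (fun s' x => extval v b (match x return extv W s s' with
      | inl y => inl (f s' y) | inr e => inr e end))
      = extval (fun s x => v s (f s x)) b.
    by split=> h b; have := h b; rewrite IHp E.
  by apply: functional_extensionality_dep => s'; apply/funext => -[].
Qed.

End FullLanguage.
Arguments pint {C} _ {ss} _.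

(** * The ambit *)

Section Ambit.
Context (L : language) (M : structure L).

Definition sorts (s : sort) : Type := if s is SG then aut M else M.

Definition eval_graph : set (hprod sorts [:: SG; SM; SM]) :=
  [set x | let: (g, (a, (b, _))) := x in (g : aut M) a = b].

(* Variables of the types of enumerations of M: one of sort SM for each m : M. *)
Definition mvar (s : sort) : Type := if s is SG then void else M.

Definition mval (N : sort -> Type) (f : M -> N SM) (s : sort) : mvar s -> N s :=
  match s with SG => fun x => match x with end | SM => f end.

Context (N : monster_model sorts).

(* [f] enumerates the tuple sigma(m), sigma in G^*. *)
Definition star_image (sigma : N SG) (f : M -> N SM) : Prop :=
  forall m : M, pint N eval_graph (sigma, (emb N (s := SM) m, (f m, tt))).

Definition Sigma_set : set (set (form sorts mvar)) :=
  [set p | exists sigma f, star_image sigma f /\ p = tp (mval f)].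

Record Sigma := MkSigma { sigma_tp : set (form sorts mvar);
                          sigma_tpP : Sigma_set sigma_tp }.

HB.instance Definition _ := gen_eqMixin Sigma.
HB.instance Definition _ := gen_choiceMixin Sigma.
(* Since types are complete, the sets [phi] form a basis of clopen sets. *)
HB.instance Definition _ := isSubBaseTopological.Build Sigma
  (range (fun (phi : form sorts mvar) => [set p : Sigma | sigma_tp p phi])) id.

Definition mperm (g : aut M) (s : sort) : mvar s -> mvar s :=
  match s with SG => id | SM => g end.

Lemma star_image_comp (g : aut M) sigma f : star_image sigma f ->
  exists tau, star_image tau (f \o g).
Proof.
pose B : set (hprod sorts [:: SG; SG]) :=
  [set x | let: (s, (t, _)) := x in (t : aut M) = (s : aut M) * g].
have elem (p : form sorts sorts) :
    sat (N := base sorts) p (fun _ x => x) -> sat p (emb N).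
  by move/(emb_elementary N).
pose var0 (V : sort -> Type) s : extv V s s := inr erefl.
pose var1 (V : sort -> Type) s t : extv (extv V s) t s := inl (inr erefl).
pose var2 (V : sort -> Type) s t r : extv (extv (extv V s) t) r s :=
  inl (inl (inr erefl)).
move=> sf; have [tau Btau] : exists tau, pint N B (sigma, (tau, tt)).
  pose p : form sorts sorts := @All _ _ SG
    (Imp (@All _ _ SG
       (Imp (Pred B (var1 _ SG SG, (var0 _ SG, tt))) (Bot _ _))) (Bot _ _)).
  have /elem /= : sat (N := base sorts) p (fun _ x => x).
    by move=> s /= /(_ ((s : aut M) * g)); apply.
  move=> /(_ sigma) h; apply: contrapT => h'; apply: h => tau Bt.
  by apply: h'; exists tau.
exists tau => m.
pose q : form sorts sorts := @All _ _ SG (@All _ _ SG (@All _ _ SM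
  (Imp (Pred B (var2 _ SG SG SM, (var1 _ SG SM, tt)))
  (Imp (Pred eval_graph (var2 _ SG SG SM,
          ((inl (inl (inl (g m : sorts SM)))), (var0 _ SM, tt))))
       (Pred eval_graph (var1 _ SG SM,
          ((inl (inl (inl (m : sorts SM)))), (var0 _ SM, tt)))))))).
have /elem /= : sat (N := base sorts) q (fun _ x => x).
  by move=> s t b /= -> <-.
by move=> /(_ sigma tau (f (g m)) Btau (sf (g m))).
Qed.

Definition sigma_act_tp (g : aut M) (p : Sigma) : set (form sorts mvar) :=
  [set phi | sigma_tp p (rename (mperm g^-1) phi)].

Lemma sigma_act_tpE (g : aut M) (p : Sigma) (f : M -> N SM) :
  sigma_tp p = tp (mval f) ->
  sigma_act_tp g p = tp (mval (f \o (g^-1)%g)).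
Proof.
move=> pE; apply/seteqP; rewrite /sigma_act_tp pE.
have E : (fun s x => mval f (mperm g^-1 x)) = mval (f \o (g^-1)%g).
  by apply: functional_extensionality_dep => -[]; apply/funext.
by split=> phi /=; rewrite /tp /= sat_rename E.
Qed.

Lemma sigma_act_tpP (g : aut M) (p : Sigma) : Sigma_set (sigma_act_tp g p).
Proof.
have [sigma [f [sf pE]]] := sigma_tpP p.
have [tau tf] := star_image_comp g^-1 sf.
by exists tau, (f \o (g^-1)%g); split=> //; exact: sigma_act_tpE.
Qed.

(* By [sigma_act_tpE], g maps tp(sigma(m)) to tp(sigma(g^-1(m))). *)
Definition sigma_act (g : aut M) (p : Sigma) : Sigma :=
  MkSigma (sigma_act_tpP g p).

End Ambit.

(* Main.v *)
From HB Require Import structures.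
From mathcomp Require Import all_boot all_order all_algebra all_fingroup.
From mathcomp Require Import all_classical all_reals all_analysis.
From mathcomp Require Import lra.
From Pilot Require Import Defs.

(** The proof has three ideas, for a group [G] acting on a compact Hausdorff space
    [Y], with Ellis semigroup [E], a minimal left ideal [L] and an idempotent [u]
    of [L].

    Ramsey degrees bound colours on the ideal. A clopen subset [U] of [Y] colours
    an element [p] of [L] by the preimage [p^-1 U]. A Ramsey hypothesis bounds, by
    a number independent of the points [y_i], the colours that the colouring of
    [g] by the set of the [i] with [y_i] in [g U] takes on a translate of any given
    finite set. A compactness argument transfers the bound to [L], because
    [L = E eta rho] for every [eta] in [E] and [rho] in [L] ([few_colors_ideal]).
    So [L] has finitely many colours ([at_most_finite_colors]).

    Finitely many colours make the Ellis group profinite. The group [u L] permutes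
    the colours by taking preimages, with a kernel [K] that is normal of finite
    index. The kernel may fail to be tau-closed, but the elements of its closure
    still have the colour of [u] ([color_kernel_closure]). Hence, if the sets [U]
    separate points, then the closed normal subgroups of finite index of the
    compact group [u L] intersect trivially, and [u L] is the inverse limit of the
    corresponding quotients ([egroup_profinite], [ellis_group_profinite]).

    Distal minimal flows see only this group. If [X] is a distal minimal flow,
    consider [Y = S x X] for a space [S] with a base point. The idempotent [u] acts
    trivially on [X], so [u L] acts transitively on [X] and [G] acts through it.
    The orbits of the closed normal subgroups of finite index are then finite
    closed [G]-invariant partitions of [X]. Two points that none of them separates
    are related by one element of all these subgroups, which has the same colours
    as [u]. If [S] is universal, in the sense that every subset of [G] invariant
    under an open subgroup is the trace of a colouring set on the orbit of the base
    point, then such an element acts trivially on [X] ([universal_determined],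
    [distal_profinite_few_colors]). Working in the product replaces the factor map
    from the universal ambit to [X].

    Two universal spaces are used. One is the type space of the ambit: the truth of
    a formula at [sigma(m)] is a unary predicate of [sigma] in the full language
    ([star_sat]), so the space is compact by saturation ([Sigma_compact]). The other
    is the space of 0-1 functions on the subsets of [G] invariant under an open
    subgroup, where a finite embedding Ramsey degree is directly a bound on
    colourings ([ERdeg_few_colors]); it does not refer to a monster model.

    For the equivalence with metrizability, let [Z] be a minimal subflow of the
    second space, whose points are ultrafilters of stable sets. A finite embedding
    Ramsey degree of a tuple bounds the number of traces of these ultrafilters on
    the sets stable under the stabilizer of the tuple ([traces_finite]), and for a
    countable structure this produces a countable base of any minimal flow
    ([ERdeg_metrizable]). Conversely, infinitely many traces over one tuple would
    give continuum many clopen sets in every flow mapping onto [Z]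
    ([metrizable_finite_traces]), and the number of traces bounds the degree
    ([finite_traces_ERdeg]). *)

Set Implicit Arguments.
Unset Strict Implicit.
Unset Printing Implicit Defensive.

Local Open Scope classical_set_scope.
Local Open Scope card_scope.
Local Open Scope group_scope.

(** * Pointwise convergence *)

Lemma continuous_nbhs (X Z : topologicalType) (f : X -> Z) x (W : set Z) :
  continuous f -> nbhs (f x) W -> nbhs x (f @^-1` W).
Proof. by move=> /(_ x); apply. Qed.

Section Product.
Context {I : Type} {K : I -> topologicalType}.
Local Notation P := (prod_topology K).

Lemma prod_eval_continuous i : continuous (fun g : P => g i).
Proof.
move=> f A; rewrite /= nbhsE => -[C [oC Cf] CA].
have /cvg_sup/(_ i) : f --> (f : P) by exact: cvg_id.
apply; exists ((fun g : P => g i) @^-1` C); split => //; first by exists C.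
by move=> g /CA.
Qed.

Lemma prod_continuous (Z : topologicalType) (h : Z -> P) :
  (forall i, continuous (fun z => h z i)) -> continuous h.
Proof.
move=> hc z; apply/cvg_sup => i A [B [[C oC <-] Cf sBA]].
apply: (@filterS _ (nbhs z) _ _ _ (preimage_subset sBA)).
by apply: (continuous_nbhs (hc i)); exact: open_nbhs_nbhs.
Qed.

Lemma prod_hausdorff : (forall i, hausdorff_space (K i)) -> hausdorff_space P.
Proof.
move=> hK p q pq; apply: functional_extensionality_dep => i; apply: hK => A B.
move=> /(continuous_nbhs (@prod_eval_continuous i)) nA.
move=> /(continuous_nbhs (@prod_eval_continuous i)) nB.
by have [x [Ax Bx]] := pq _ _ nA nB; exists (x i).
Qed.

End Product.

Lemma ptws_compact (U : choiceType) (V : topologicalType) :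
  compact [set: V] -> compact [set: {ptws U -> V}].
Proof.
move=> cV; have := @tychonoff U (fun=> V) (fun=> setT) (fun=> cV).
by rewrite (_ : [set f | _] = setT)//; apply/seteqP; split.
Qed.

Lemma nbhs_closure (X : topologicalType) (A : set X) x (W : set X) :
  closure A x -> nbhs x W -> exists2 y, A y & nbhs y W.
Proof. by move=> Ax /nbhs_interior/Ax[y [Ay Wy]]; exists y. Qed.

Lemma closureP (X : topologicalType) (A : set X) x :
  (forall W, nbhs x W -> exists2 y, A y & W y) -> closure A x.
Proof. by move=> h W /h[y Ay Wy]; exists y. Qed.

Lemma clopen_nbhs_eval (U : choiceType) (V : topologicalType) (A : set V)
    (p : {ptws U -> V}) y :
  clopen A -> nbhs p [set q : {ptws U -> V} | A (q y) <-> A (p y)].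
Proof.
move=> [Ao Ac]; have [Apy|nApy] := pselect (A (p y)).
  apply: (@filterS _ (nbhs p) _ ((fun q : {ptws U -> V} => q y) @^-1` A)).
    by move=> q /= Aqy.
  apply: (continuous_nbhs (@prod_eval_continuous _ _ y)).
  exact: open_nbhs_nbhs.
apply: (@filterS _ (nbhs p) _ ((fun q : {ptws U -> V} => q y) @^-1` (~` A))).
  by move=> q /= Aqy; split.
apply: (continuous_nbhs (@prod_eval_continuous _ _ y)).
by apply: open_nbhs_nbhs; split=> //; exact: closed_openC.
Qed.

(** * The Ellis semigroup *)

(** Flows, the type space of the ambit and products of such spaces all have
    this form; it is the common ground for their Ellis semigroups. *)
Record gspace (G : groupType) := Gspace {
  gspace_sort :> topologicalType;
  gact : G -> gspace_sort -> gspace_sort;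
  gact1 : forall x, gact 1 x = x;
  gactM : forall g h x, gact (g * h) x = gact g (gact h x);
  gact_continuous : forall g, continuous (gact g);
  gspace_compact : compact [set: gspace_sort];
  gspace_hausdorff : hausdorff_space gspace_sort
}.
Arguments gact {G} _.

Section Semigroup.
Context (G : groupType) (Y : gspace G).

Local Notation act := (gact Y).
Local Notation T := {ptws Y -> Y}.
Local Notation E := (ellis_semigroup act).
Implicit Types (p q f : T) (B : set T).

Lemma comp_continuousr q : continuous (fun p => p \o q : T).
Proof.
by apply: prod_continuous => x; exact: prod_eval_continuous.
Qed.

Lemma comp_continuousl (h : Y -> Y) : continuous h ->
  continuous (fun p => h \o p : T).
Proof.
move=> hc; apply: prod_continuous => x p.
apply: (cvg_comp (fun p : T => p x) h); first exact: prod_eval_continuous.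
exact: hc.
Qed.

Lemma act_comp g h : act g \o act h = act (g * h).
Proof. by apply/funext => x /=; rewrite gactM. Qed.

Lemma ellis_act g : E (act g).
Proof. by apply: subset_closure; exists g. Qed.

Lemma ellis_closed : closed E.
Proof. exact: closed_closure. Qed.

Lemma ellis_compact : compact E.
Proof.
apply: (subclosed_compact ellis_closed); last exact: subsetT.
exact/ptws_compact/gspace_compact.
Qed.

(** [tau_circ] with neighbourhoods instead of nets, so that iterated limits
    become successive choices of neighbourhoods. *)
Definition circ p B : set T :=
  [set f | forall W' W : set T, nbhs p W' -> nbhs f W ->
     exists g b, [/\ B b, W' (act g) & W (act g \o b)]].

Lemma tau_circE p B : tau_circ act p B = circ p B.
Proof.
apply/seteqP; split=> f.
  move=> [F [PF FB Fp Ff]] W' W W'p Wf.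
  have /filter_ex[[g b] [[/= Bb W'g] Wgb]] : F ([set pb | B pb.2] `&`
      [set pb | W' (act pb.1)] `&` [set pb | W (act pb.1 \o pb.2)]).
    by apply: filterI; [apply: filterI => //; exact: Fp|exact: Ff].
  by exists g, b.
move=> cf.
pose D := [set WW : set T * set T | nbhs p WW.1 /\ nbhs f WW.2].
pose S (WW : set T * set T) := [set pb : G * T |
  [/\ B pb.2, WW.1 (act pb.1) & WW.2 (act pb.1 \o pb.2)]].
exists (filter_from D S); split.
- apply: filter_from_proper; first apply: filter_from_filter.
  + by exists (setT, setT); split; exact: filterT.
  + move=> [W1 W2] [W3 W4] [/= h1 h2] [/= h3 h4].
    exists (W1 `&` W3, W2 `&` W4); first by split; exact: filterI.
    by move=> [g b] [/= Bb [? ?] [? ?]].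
  + by move=> [W' W] [/= /cf/[apply]] [g [b h]]; exists (g, b).
- exists (setT, setT); first by split; exact: filterT.
  by move=> ? [].
- move=> W' W'p; exists (W', setT); first by split => //; exact: filterT.
  by move=> ? [].
- move=> W Wf; exists (setT, W); first by split => //; exact: filterT.
  by move=> ? [].
Qed.

Lemma circS p B B' : B `<=` B' -> circ p B `<=` circ p B'.
Proof.
move=> BB f cf W' W W'p Wf; have [g [b [Bb ? ?]]] := cf _ _ W'p Wf.
by exists g, b; split => //; exact: BB.
Qed.

Lemma circ_nbhs p B f (W' W : set T) : circ p B f -> nbhs p W' -> nbhs f W ->
  exists g b, [/\ B b, nbhs (act g : T) W' & nbhs (act g \o b : T) W].
Proof. by move=> cf /nbhs_interior W'p /nbhs_interior/(cf _ _ W'p). Qed.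

(** Choose [g] close to [p] first, then approximate [b] through the continuous
    map [act g]. *)
Lemma circ_closure p B b : E p -> closure B b -> circ p B (p \o b).
Proof.
move=> Ep Bb W' W W'p Wpb.
have Np : nbhs p (W'° `&` (fun p => p \o b : T) @^-1` W°).
  apply: filterI; first exact: nbhs_interior.
  exact: (continuous_nbhs (@comp_continuousr b) (nbhs_interior Wpb)).
have [_ [g _ <-] /nbhs_singleton[W'g Wgb]] := nbhs_closure Ep Np.
have Nb : nbhs b ((fun q => act g \o q : T) @^-1` W).
  exact: (continuous_nbhs (comp_continuousl (@gact_continuous _ Y g)) Wgb).
have [b' Bb' /nbhs_singleton Wb'] := nbhs_closure Bb Nb.
by exists g, b'; split => //; exact: (nbhs_singleton W'g).
Qed.

(** For [p = q = u] idempotent this makes the tau-closure idempotent; for [p]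
    and [q] inverse to each other it makes left translations tau-continuous. *)
Lemma circ_circ p q B : circ p (circ q B) `<=` circ (p \o q) B.
Proof.
move=> f cf W' W W'pq Wf.
have Np : nbhs p ((fun p => p \o q : T) @^-1` W'°).
  exact: (continuous_nbhs (@comp_continuousr q) (nbhs_interior W'pq)).
have [g [b [cb /nbhs_singleton W'gq Wgb]]] := circ_nbhs cf Np Wf.
have Nq : nbhs q ((fun q => act g \o q : T) @^-1` W').
  exact: (continuous_nbhs (comp_continuousl (@gact_continuous _ Y g)) W'gq).
have Nb : nbhs b ((fun q => act g \o q : T) @^-1` W).
  exact: (continuous_nbhs (comp_continuousl (@gact_continuous _ Y g)) Wgb).
have [h [c [Bc W'gh Wghc]]] := cb _ _ Nq Nb.
exists (g * h), c; split => //; rewrite -act_comp.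
  exact: W'gh.
exact: Wghc.
Qed.

Lemma circ_compr p B a f : circ p B f ->
  circ p ((fun b => b \o a : T) @` B) (f \o a).
Proof.
move=> cf W' W W'p Wfa.
have Nf : nbhs f ((fun p => p \o a : T) @^-1` W).
  exact: (continuous_nbhs (@comp_continuousr a) Wfa).
have [g [b [Bb W'g Wgb]]] := cf _ _ W'p Nf.
by exists g, (b \o a); split => //; exists b.
Qed.

Lemma circU p B B' : circ p (B `|` B') `<=` circ p B `|` circ p B'.
Proof.
move=> f cf; apply: contrapT => /not_orP[nB nB'].
have h (C : set T) : ~ circ p C f -> exists W' W : set T, [/\ nbhs p W', nbhs f W &
    forall g b, C b -> W' (act g) -> ~ W (act g \o b)].
  move=> /existsNP[W' /existsNP[W /not_implyP[W'p /not_implyP[Wf nC]]]].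
  exists W', W; split => // g b Cb W'g Wgb; apply: nC.
  by exists g, b.
have [W1 [W2 [pW1 fW2 hB]]] := h _ nB.
have [W3 [W4 [pW3 fW4 hB']]] := h _ nB'.
have [g [b [BBb [W1g W3g] [W2g W4g]]]] :=
  cf _ _ (filterI pW1 pW3) (filterI fW2 fW4).
by case: BBb => [/hB/(_ W1g W2g)|/hB'/(_ W3g W4g)].
Qed.

Lemma ellis_comp p q : E p -> E q -> E (p \o q).
Proof.
move=> Ep Eq; apply: closureP => W Wpq.
have Np := continuous_nbhs (@comp_continuousr q) (nbhs_interior Wpq).
have [_ [g _ <-] /nbhs_singleton Wg] := nbhs_closure Ep Np.
have [_ [h _ <-] /nbhs_singleton Wgh] := nbhs_closure Eq (continuous_nbhs (comp_continuousl (@gact_continuous _ Y g)) Wg).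
by exists (act (g * h)); [exists (g * h)|rewrite -act_comp].
Qed.

Lemma left_ideal_comp L p q : left_ideal act L -> E p -> L q -> L (p \o q).
Proof. by move=> [_ _]; apply. Qed.

Lemma left_ideal_sub L : left_ideal act L -> L `<=` E.
Proof. by case. Qed.

Lemma principal_left_ideal q : E q -> left_ideal act ((fun p => p \o q : T) @` E).
Proof.
move=> Eq; split.
- by exists (act 1 \o q), (act 1) => //; exact: ellis_act.
- by move=> _ [p Ep <-]; exact: ellis_comp.
- by move=> e _ Ee [p Ep <-]; exists (e \o p) => //; exact: ellis_comp.
Qed.

Lemma principal_closed q : closed ((fun p => p \o q : T) @` E).
Proof.
apply: compact_closed; first by apply: prod_hausdorff => _; exact: gspace_hausdorff.
apply: (@continuous_compact _ _ (fun p : T => p \o q : T)).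
  by apply: continuous_subspaceT; exact: comp_continuousr.
exact: ellis_compact.
Qed.

(** [E q] is a left ideal inside [L]. *)
Lemma minimal_left_idealE L q : minimal_left_ideal act L -> L q ->
  L = ((fun p => p \o q : T) @` E).
Proof.
move=> [Lid Lmin] Lq; have Eq := left_ideal_sub Lid Lq.
apply/esym/Lmin; first exact: principal_left_ideal.
by move=> _ [p Ep <-]; exact: left_ideal_comp.
Qed.

Lemma minimal_left_ideal_closed L : minimal_left_ideal act L -> closed L.
Proof.
move=> Lmin; have [[[q Lq] _ _] _] := Lmin.
by rewrite (minimal_left_idealE Lmin Lq); exact: principal_closed.
Qed.

Lemma minimal_left_ideal_compact L : minimal_left_ideal act L -> compact L.
Proof.
move=> Lmin; apply: (subclosed_compact (minimal_left_ideal_closed Lmin)).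
  exact: ellis_compact.
by case: Lmin => -[].
Qed.

End Semigroup.

Lemma compact_directed (X : topologicalType) (K : set X) (I : Type)
    (D : set I) (C : I -> set X) :
  compact K -> D !=set0 -> (forall i, D i -> closed (C i)) ->
  (forall i, D i -> (K `&` C i) !=set0) ->
  (forall i j, D i -> D j -> exists2 k, D k & C k `<=` C i `&` C j) ->
  exists2 x, K x & forall i, D i -> C i x.
Proof.
move=> Kc [i0 Di0] Ccl C0 Cdir.
have PF : ProperFilter (filter_from D (fun i => K `&` C i)).
  apply: filter_from_proper; first apply: filter_from_filter.
  - by exists i0.
  - move=> i j Di Dj; have [k Dk Ck] := Cdir i j Di Dj.
    by exists k => // x [Kx /Ck[? ?]].
  - by move=> i /C0.
have FK : filter_from D (fun i => K `&` C i) K by exists i0 => // x [].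
have [x [Kx clx]] := Kc _ PF FK.
exists x => // i Di; apply: Ccl => // W Wx.
have [|y [[_ Cy] Wy]] := clx (K `&` C i) W _ Wx; first by exists i.
by exists y.
Qed.

(** Zorn's lemma, applied to the complements in [K]: a chain of closed nonempty
    sets has a nonempty intersection by compactness. *)
Lemma minimal_closed (X : topologicalType) (K : set X) (P : set (set X)) :
  compact K -> closed K -> K !=set0 -> P K ->
  (forall F : set (set X), F !=set0 -> F `<=` P -> P (\bigcap_(A in F) A)) ->
  exists A, [/\ closed A, A !=set0, A `<=` K & P A] /\
    forall B, closed B -> B !=set0 -> B `<=` A -> P B -> B = A.
Proof.
move=> Kc Kcl K0 PK Pcap.
pose Q A := [/\ closed A, A !=set0, A `<=` K & P A].
have [|A [QA Amax]] := @Zorn_bigcup X (fun A => Q (K `\` A)).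
  move=> F FQ Ftot.
  have [->|/set0P[A0 FA0]] := eqVneq F set0.
    by rewrite bigcup_set0 setD0; split.
  pose FF := [set K `\` A | A in F].
  have FFE : K `\` \bigcup_(A in F) A = \bigcap_(A in FF) A.
    apply/seteqP; split=> x.
      by move=> [Kx nFx] _ [A FA <-]; split => // Ax; apply: nFx; exists A.
    move=> h; have [Kx _] : (K `\` A0) x by apply: h; exists A0.
    split=> // -[A FA Ax].
    have [_] : (K `\` A) x by apply: h; exists A.
    exact.
  have [cA0 A00 A0K PA0] := FQ _ FA0.
  rewrite FFE; split.
  - by apply: closed_bigI => _ [A FA <-]; case: (FQ _ FA).
  - have [||A /FQ[_ [x xA] _ _]|A B FA FB|x Kx h] :=
        @compact_directed X K _ F (fun A => K `\` A) Kc.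
    + by exists A0.
    + by move=> A /FQ[].
    + by exists x; split => //; case: xA.
    + have [AB|BA] := Ftot A B FA FB.
        by exists B => // x [Kx nB]; split; split => // /AB.
      by exists A => // x [Kx nB]; split; split => // /BA.
    + by exists x => _ [A FA <-]; exact: h.
  - by move=> x h; have [] : (K `\` A0) x by apply: h; exists A0.
  - by apply: Pcap; [exists (K `\` A0), A0|move=> _ [A FA <-]; case: (FQ _ FA)].
exists (K `\` A); split => // B Bcl B0 BA PB.
have BK : B `<=` K by move=> x /BA[].
apply/seteqP; split => // x KAx; apply: contrapT => nBx.
have BE : K `\` (A `|` (K `\` B)) = B.
  apply/seteqP; split=> [y [Ky nAKB]|y By].
    by apply: contrapT => nBy; apply: nAKB; right.
  split; first exact: BK.
  by move=> [Ay|[_]] //; have [] := BA y By.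
apply: (Amax (A `|` (K `\` B))); last by rewrite BE; split.
split; first by move=> y; left.
by move=> /(_ x) h; have [Kx nAx] := KAx; apply/nAx/h; right.
Qed.

Section MinimalIdeals.
Context (G : groupType) (Y : gspace G).

Local Notation act := (gact Y).
Local Notation T := {ptws Y -> Y}.
Local Notation E := (ellis_semigroup act).

(** A left ideal minimal among the closed ones is minimal, since every left
    ideal contains a closed one, namely [E q] for any of its elements [q]. *)
Lemma minimal_left_ideal_exists :
  exists L : set T, minimal_left_ideal act L.
Proof.
pose P (A : set T) := forall e f : T, E e -> A f -> A (e \o f : T).
have [|||L [[Lcl L0 LE PL] Lmin]] := @minimal_closed T E P (@ellis_compact G Y)
    (@ellis_closed G Y).
- by exists (act 1); exact: ellis_act.
- by move=> e f; exact: ellis_comp.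
- by move=> F _ FP e f Ee h A FA; apply: (FP _ FA) => //; exact: h.
have Lid : left_ideal act L by split.
exists L; split=> // L' L'id L'L; have [[q L'q] _ _] := L'id.
have Eq : E q by apply: LE; exact: L'L.
apply/seteqP; split => //.
have <- : (fun p : T => p \o q : T) @` E = L.
  apply: Lmin.
  - exact: principal_closed.
  - by case: (principal_left_ideal Eq).
  - by move=> _ [p Ep <-]; apply: PL => //; exact: L'L.
  - by case: (principal_left_ideal Eq).
by move=> _ [p Ep <-]; exact: left_ideal_comp L'q.
Qed.

(** The lemma of Ellis and Numakura: if [S] is a minimal closed subsemigroup
    and [u] is in [S], then [S u = S], so the closed subsemigroup of those [p]
    in [S] with [p u = u] is nonempty and equals [S]. *)
Lemma idempotent_exists (L : set T) : minimal_left_ideal act L ->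
  exists2 u : T, L u & u \o u = u.
Proof.
move=> Lmin; have Lid : left_ideal act L by case: Lmin.
pose P (A : set T) := forall p q : T, A p -> A q -> A (p \o q : T).
have [|||S [[Scl [u Su] SL PS] Smin]] := @minimal_closed T L P
    (minimal_left_ideal_compact Lmin) (minimal_left_ideal_closed Lmin).
- by case: Lid.
- move=> p q Lp Lq; apply: (left_ideal_comp Lid) => //.
  exact: (left_ideal_sub Lid).
- move=> F _ FP p q Fp Fq A FA; apply: (FP _ FA); [exact: Fp|exact: Fq].
have Thaus : hausdorff_space T.
  by apply: prod_hausdorff => _; exact: gspace_hausdorff.
have Su_cl : closed ((fun p : T => p \o u : T) @` S).
  apply: compact_closed => //.
  apply: (@continuous_compact _ _ (fun p : T => p \o u : T)).
    by apply: continuous_subspaceT; exact: comp_continuousr.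
  exact: (subclosed_compact Scl (minimal_left_ideal_compact Lmin)).
have SuE : (fun p : T => p \o u : T) @` S = S.
  apply: Smin => //.
  - by exists (u \o u), u.
  - by move=> _ [p Sp <-]; exact: PS.
  - by move=> _ _ [p Sp <-] [q Sq <-]; exists (p \o u \o q) => //;
      apply: (PS) => //; exact: PS.
exists u; first exact: SL.
have FixE : S `&` (fun p : T => p \o u : T) @^-1` [set u] = S.
  apply: Smin.
  - apply: closedI => //; apply: closed_comp.
      by move=> ? _; exact: comp_continuousr.
    apply: accessible_closed_set1; exact: hausdorff_accessible.
  - by move: Su; rewrite -{1}SuE => -[p Sp pu]; exists p.
  - by move=> p [].
  - move=> p q [Sp pu] [Sq qu]; split; first exact: PS.
    by rewrite /= -{2}pu -[in RHS]qu.
by move: Su; rewrite -FixE => -[].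
Qed.

End MinimalIdeals.

(** * The Ellis group as a compact semitopological group *)

(** The choices on which the Ellis group depends, bundled so that the group
    becomes a type that determines them. *)
Record ellis_idempotent (G : groupType) (Y : gspace G) := EllisIdempotent {
  ei_ideal : set {ptws Y -> Y};
  ei_fun : {ptws Y -> Y};
  ei_min : minimal_left_ideal (gact Y) ei_ideal;
  ei_mem : ei_ideal ei_fun;
  ei_idem : ei_fun \o ei_fun = ei_fun
}.

Lemma ellis_idempotent_exists (G : groupType) (Y : gspace G) :
  inhabited (ellis_idempotent Y).
Proof.
have [L Lmin] := minimal_left_ideal_exists Y.
by have [u Lu uu] := idempotent_exists Lmin; split; exists L u.
Qed.

Section EllisGroup.
Context (G : groupType) (Y : gspace G) (d : ellis_idempotent Y).

Local Notation act := (gact Y).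
Local Notation T := {ptws Y -> Y}.
Local Notation E := (ellis_semigroup act).
Local Notation L := (ei_ideal d).
Local Notation u := (ei_fun d).
Implicit Types (p q f : T).

Lemma ei_idealE q : L q -> L = (fun p : T => p \o q : T) @` E.
Proof. exact/minimal_left_idealE/ei_min. Qed.

Lemma ei_left_ideal : left_ideal act L.
Proof. by case: (ei_min d). Qed.

Lemma ei_ideal_sub : L `<=` E.
Proof. exact/left_ideal_sub/ei_left_ideal. Qed.

Lemma ei_ideal_comp p q : E p -> L q -> L (p \o q).
Proof. exact: (left_ideal_comp ei_left_ideal). Qed.

Lemma ei_ideal_comp2 p q : L p -> L q -> L (p \o q).
Proof. by move=> /ei_ideal_sub; exact: ei_ideal_comp. Qed.

Lemma ei_ideal_u f : L f -> f \o u = f.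
Proof.
rewrite (ei_idealE (ei_mem d)) => -[q Eq <-].
by rewrite -compA ei_idem.
Qed.

Lemma ellis_groupP f : ellis_group L u f <-> L f /\ u \o f = f.
Proof.
split=> [[g Lg <-]|[Lf uf]]; last by exists f.
by rewrite compA ei_idem; split => //; apply: ei_ideal_comp2 => //; exact: ei_mem.
Qed.

Lemma ellis_group_u f : L f -> ellis_group L u (u \o f).
Proof. by exists f. Qed.

Record egroup := EGroup { egfun : T; egfunP : ellis_group L u egfun }.

Implicit Types a b c : egroup.

Lemma egroup_ext a b : egfun a = egfun b -> a = b.
Proof.
case: a b => [f fP] [g gP] /= fg; move: fP gP; rewrite fg => fP gP.
by congr EGroup; exact: Prop_irrelevance.
Qed.

Lemma egfun_ideal a : L (egfun a).
Proof. by have /ellis_groupP[] := egfunP a. Qed.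

Lemma egfun_ellis a : E (egfun a).
Proof. exact/ei_ideal_sub/egfun_ideal. Qed.

Lemma egfun_ul a : u \o egfun a = egfun a.
Proof. by have /ellis_groupP[] := egfunP a. Qed.

Lemma egfun_ur a : egfun a \o u = egfun a.
Proof. exact/ei_ideal_u/egfun_ideal. Qed.

HB.instance Definition _ := gen_eqMixin egroup.
HB.instance Definition _ := gen_choiceMixin egroup.

Definition egone : egroup.
Proof. exists u; apply/ellis_groupP; split; [exact: ei_mem|exact: ei_idem]. Defined.

Definition egmul a b : egroup.
Proof.
exists (egfun a \o egfun b); apply/ellis_groupP; split.
  by apply: ei_ideal_comp2; exact: egfun_ideal.
by rewrite compA egfun_ul.
Defined.

(** By minimality [L = E a], so [u = q a] for some [q], and [u q u] is an
    inverse of [a] in the group. *)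
Lemma egroup_left_inverse a : exists b, egfun b \o egfun a = u.
Proof.
have := ei_mem d; rewrite {1}(ei_idealE (egfun_ideal a)) => -[q Eq qa].
have Lqu : L (q \o u) by apply: ei_ideal_comp => //; exact: ei_mem.
exists (EGroup (ellis_group_u Lqu)) => /=.
have -> : u \o (q \o u) \o egfun a = u \o (q \o (u \o egfun a)) by [].
by rewrite egfun_ul qa ei_idem.
Qed.

Definition eginv a : egroup := projT1 (cid (egroup_left_inverse a)).

Fact egmulA : associative egmul.
Proof. by move=> a b c; exact: egroup_ext. Qed.
Fact egmul1g : left_id egone egmul.
Proof. by move=> a; apply: egroup_ext; exact: egfun_ul. Qed.
Fact egmulg1 : right_id egone egmul.
Proof. by move=> a; apply: egroup_ext; exact: egfun_ur. Qed.
Fact egmulVg : left_inverse egone eginv egmul.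
Proof.
by move=> a; apply: egroup_ext; rewrite /= /eginv; case: cid => b /=.
Qed.
Fact egmulgV : right_inverse egone eginv egmul.
Proof.
move=> a; rewrite -[LHS]egmul1g -(egmulVg (eginv a)) -egmulA.
by rewrite [X in egmul _ X]egmulA egmulVg egmul1g egmulVg.
Qed.

HB.instance Definition _ := isGroup.Build egroup
  egmulA egmul1g egmulg1 egmulVg egmulgV.

Lemma egfunM a b : egfun (a * b) = egfun a \o egfun b. Proof. by []. Qed.
Lemma egfun1 : egfun 1 = u. Proof. by []. Qed.

Definition tau_open (U : set egroup) : Prop :=
  forall a, circ u (egfun @` ~` U) (egfun a) -> ~ U a.

Fact tau_openT : tau_open setT.
Proof.
move=> a /(_ setT setT filterT filterT)[g [_ [[b nb _] _ _]]] _.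
by apply: nb.
Qed.

Fact tau_openI : setI_closed tau_open.
Proof.
move=> U V oU oV a; rewrite setCI image_setU => /circU[/oU|/oV] n [Ua Va].
  exact: n.
exact: n.
Qed.

Fact tau_open_bigU (I : Type) (U : I -> set egroup) :
  (forall i, tau_open (U i)) -> tau_open (\bigcup_i U i).
Proof.
move=> oU a ca [i _ Uia]; apply: (oU i) Uia.
by apply: circS ca; apply: image_subset => b nb Uib; apply: nb; exists i.
Qed.

HB.instance Definition _ := isOpenTopological.Build egroup
  tau_openT tau_openI tau_open_bigU.

Lemma egroup_closedP (C : set egroup) :
  closed C <-> forall a, circ u (egfun @` C) (egfun a) -> C a.
Proof.
rewrite -openC -[X in _ <-> X]/(forall a, _).
change (tau_open (~` C) <-> forall a, circ u (egfun @` C) (egfun a) -> C a).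
rewrite /tau_open setCK; split=> h a ca; last by move=> nC; apply/nC/h.
by apply: contrapT => nC; apply: (h a ca nC).
Qed.

(** If [B] is the preimage of [C] under the translation by [b], then
    [b (u o B)] lies in [b o B], hence in [b o (b^-1 o C)] and in [u o C]. *)
Lemma tau_closed_preimage_mull b (C : set egroup) : closed C ->
  closed [set a | C (b * a)].
Proof.
move=> /egroup_closedP Ccl; apply/egroup_closedP => a ca; apply: Ccl.
set B := egfun @` _ in ca.
have h1 : circ (egfun b) (circ u B) (egfun (b * a)).
  apply: circ_closure; [exact: egfun_ellis|exact: subset_closure].
have h2 : circ (egfun b) B (egfun (b * a)).
  by rewrite -(egfun_ur b); exact: circ_circ h1.
have h3 : B `<=` circ (egfun (b^-1)) (egfun @` C).
  move=> _ [c Cbc <-]; rewrite -[c](mulKg b).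
  apply: circ_closure; first exact: egfun_ellis.
  by apply: subset_closure; exists (b * c).
have := circ_circ (circS h3 h2).
by rewrite -egfunM mulgV.
Qed.

Lemma egroup_mull b : continuous (fun a => b * a : egroup).
Proof. by apply/continuous_closedP => C; exact: tau_closed_preimage_mull. Qed.

Lemma egroup_mulr b : continuous (fun a => a * b : egroup).
Proof.
apply/continuous_closedP => C /egroup_closedP Ccl.
apply/egroup_closedP => a /(@circ_compr _ _ _ _ (egfun b)) ca; apply: Ccl.
by apply: circS ca => _ [_ [c Cc <-] <-]; exists (c * b).
Qed.

Lemma ei_ideal_closed : closed L.
Proof. exact: (minimal_left_ideal_closed (ei_min d)). Qed.

Lemma ei_ideal_compact : compact L.
Proof. exact: (minimal_left_ideal_compact (ei_min d)). Qed.

(** A pointwise limit [r] of elements of the group need not be in the group,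
    but [u r] is, and it is a tau-limit of the same elements. *)
Lemma closure_egroup (C : set egroup) r : closed C ->
  closure (egfun @` C) r -> exists2 a, C a & egfun a = u \o r.
Proof.
move=> /egroup_closedP Ccl clr.
have Lr : L r.
  apply: ei_ideal_closed; apply: closureP => W Wr.
  have [_ [a Ca <-] /nbhs_singleton Wa] := nbhs_closure clr Wr.
  by exists (egfun a) => //; exact: egfun_ideal.
exists (EGroup (ellis_group_u Lr)) => //; apply: Ccl => /=.
by apply: circ_closure => //; apply: ei_ideal_sub; exact: ei_mem.
Qed.

(** If [r] is a pointwise cluster point of a filter, then [u r] is a cluster
    point for the tau-topology. *)
Lemma egroup_compact : compact [set: egroup].
Proof.
move=> F PF _.
have FL : (egfun @ F) L.
  by apply: (@filterS _ F _ setT) => [a _|]; [exact: egfun_ideal|exact: filterT].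
have [r [Lr clr]] := ei_ideal_compact (fmap_proper_filter egfun PF) FL.
exists (EGroup (ellis_group_u Lr)); split => // A W FA /nbhs_interior Wr.
apply: contrapT => /set0P/negP/negPn/eqP AW0.
have clAr : closure (egfun @` A) r.
  move=> V Vr; have [|x [Ax Vx]] := clr (egfun @` A) V _ Vr; last by exists x.
  by apply: (@filterS _ F _ A) => // a Aa; exists a.
have [||a nWa ra] := @closure_egroup (~` W°) r.
- by apply: open_closedC; exact: open_interior.
- apply: closureS clAr; apply: image_subset => a Aa /interior_subset Wa.
  by have : (A `&` W) a by []; rewrite AW0.
- apply: nWa.
  have -> : a = EGroup (ellis_group_u Lr) by apply: egroup_ext.
  exact: nbhs_singleton Wr.
Qed.

End EllisGroup.

(** * Normal subgroups of finite index *)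

Lemma finite_range_factor (A B : Type) (F : finType) (f : A -> B)
    (code : A -> F) :
  (forall x y, code x = code y -> f x = f y) -> finite_set (range f).
Proof.
move=> fcode.
have [[a0]|nA] := pselect (inhabited A); last first.
  suff -> : range f = set0 by exact: finite_set0.
  by apply/seteqP; split=> // b [a _ _]; case: nA.
pose pick c := xget (a0 : {classic A}) (code @^-1` [set c]).
have pickP a : f (pick (code a)) = f a.
  apply: fcode; apply: (xgetPex (a0 : {classic A}) (P := code @^-1` [set code a])).
  by exists a.
have -> : range f = (f \o pick) @` range code.
  rewrite image_comp; apply/seteqP.
  by split=> _ [a _ <-]; exists a => //=; rewrite pickP.
by apply: finite_image; exact: finite_finset.
Qed.

Section FiniteIndex.
Context (H : groupType).
Implicit Types (N K : set H) (a b x y : H).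

Definition coset N a : set H := [set x | N (x * a^-1)].

Record fin_normal N : Prop := FinNormal {
  fn1 : N 1;
  fnM : forall x y, N x -> N y -> N (x * y);
  fnV : forall x, N x -> N x^-1;
  fnJ : forall a x, N x -> N (a * x * a^-1);
  fn_finite : finite_set (range (coset N))
}.

Lemma coset_eqP N a b : fin_normal N -> coset N a = coset N b <-> N (a * b^-1).
Proof.
move=> [N1 NM NV _ _]; split=> [E|Nab].
  have : coset N a a by rewrite /coset /= mulgV.
  by rewrite E.
apply/seteqP; split=> x; rewrite /coset /= => Nx.
  by have := NM _ _ Nx Nab; rewrite mulgA mulgKV.
by have := NM _ _ Nx (NV _ Nab); rewrite invgM invgK mulgA mulgKV.
Qed.

Lemma fin_normalT : fin_normal [set: H].
Proof.
split => //; apply: (@finite_range_factor _ _ bool _ (fun=> true)) => x y _.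
by apply/seteqP.
Qed.

Lemma fin_normalI N K : fin_normal N -> fin_normal K -> fin_normal (N `&` K).
Proof.
move=> [N1 NM NV NJ Nfin] [K1 KM KV KJ Kfin]; split.
- by [].
- by move=> x y [? ?] [? ?]; split; [exact: NM|exact: KM].
- by move=> x [? ?]; split; [exact: NV|exact: KV].
- by move=> a x [? ?]; split; [exact: NJ|exact: KJ].
- apply: (sub_finite_set _ (finite_image2 (fun A B => A `&` B) Nfin Kfin)).
  by move=> _ [a _ <-]; exists (coset N a) => //; exists (coset K a).
Qed.

Lemma finite_quotient N : fin_normal N ->
  exists (F : finGroupType) (theta : H -> F),
    [/\ {morph theta : x y / x * y}, forall z, exists x, theta x = z &
        forall x y, theta x = theta y <-> N (x * y^-1)].
Proof.
move=> Nfn; have [N1 NM NV NJ] := Nfn.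
move=> /finite_seqP[s sE]; pose n := size s.
have cs x : coset N x \in s.
  by have : [set` s] (coset N x) by rewrite -sE; exists x.
have cn x : (index (coset N x) s < n)%N by rewrite index_mem.
pose C0 := [set i : 'I_n | exists x, i = Ordinal (cn x)].
pose F0 := {i : 'I_n | `[< C0 i >]}.
have F0P x : `[< C0 (Ordinal (cn x)) >] by apply/asboolP; exists x.
pose theta x : F0 := exist (fun i => `[< C0 i >]) _ (F0P x).
have thetaP x y : theta x = theta y <-> N (x * y^-1).
  rewrite -(coset_eqP _ _ Nfn); split=> [/(congr1 val)/(congr1 val)/= E|E].
    by rewrite -(nth_index set0 (cs x)) E nth_index.
  by apply/val_inj/val_inj => /=; rewrite E.
have surj z : exists x, theta x = z.
  by case: z => i iP; have /asboolP[x ix] := iP; exists x; exact/val_inj.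
pose rep z := projT1 (cid (surj z)).
have repK z : theta (rep z) = z by rewrite /rep; case: cid.
have thM x y x' y' : theta x = theta x' -> theta y = theta y' ->
    theta (x * y) = theta (x' * y').
  move=> /thetaP h /thetaP k; apply/thetaP.
  have := NM _ _ (NJ x _ k) h.
  by rewrite invgM !mulgA mulgKV.
pose mulF z w := theta (rep z * rep w).
pose invF z := theta (rep z)^-1.
have mA : associative mulF.
  move=> x y z; rewrite /mulF -[x in RHS]repK.
  rewrite (thM (rep x) _ (rep x) (rep y * rep z)) ?repK// mulgA.
  by apply: thM; rewrite repK.
have m1 : left_id (theta 1) mulF.
  by move=> x; rewrite /mulF -[RHS]repK -[rep x in RHS]mul1g; apply: thM; rewrite repK.
have mV : left_inverse (theta 1) invF mulF.
  move=> x; rewrite /mulF /invF -(mulVg (rep x)); apply: thM; last by [].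
  by rewrite repK.
pose FG := Finite_isGroup.Build F0 mA m1 mV.
pose F : finGroupType := HB.pack_for finGroupType F0 FG.
exists F, theta; split => //.
by move=> x y; rewrite /mul /= /mulF; apply: thM; rewrite repK.
Qed.

End FiniteIndex.

Lemma closure_sub_preimage (X Z : topologicalType) (f : X -> Z) (A : set X)
    (C : set Z) :
  continuous f -> closed C -> (forall x, A x -> C (f x)) ->
  forall x, closure A x -> C (f x).
Proof.
move=> fc Ccl AC x Ax; apply: Ccl; apply: closureP => W /(continuous_nbhs fc).
move=> /(nbhs_closure Ax)[y Ay /nbhs_singleton Wy].
by exists (f y) => //; exact: AC.
Qed.

Section EllisFiniteIndex.
Context (G : groupType) (Y : gspace G) (d : ellis_idempotent Y).

Local Notation act := (gact Y).
Local Notation T := {ptws Y -> Y}.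
Local Notation L := (ei_ideal d).
Local Notation u := (ei_fun d).
Local Notation H := (egroup d).
Local Notation egfun := (@egfun G Y d).
Implicit Types (a b c x y : H) (K : set H).

(** The right-hand side is tau-closed because [u o (u o B)] is contained in
    [u o B]. *)
Lemma egroup_closure K : closure K = [set a | circ u (egfun @` K) (egfun a)].
Proof.
apply/seteqP; split=> a; last first.
  by move=> ca; have /egroup_closedP := @closed_closure _ K; apply;
    apply: circS ca; apply: image_subset; exact: subset_closure.
apply: (@closure_sub_preimage _ _ id); first by move=> ?; exact: cvg_id.
  apply/egroup_closedP => b cb; rewrite /= -[u](ei_idem d).
  apply: circ_circ; apply: circS cb; by move=> _ [c cc <-].
move=> b Kb /=; rewrite -(egfun_ul b); apply: circ_closure.
  exact/ei_ideal_sub/ei_mem.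
by apply: subset_closure; exists b.
Qed.

(** Two powers of [a] lie in the same coset. *)
Lemma fin_normal_expn (F : groupType) (K : set F) (a : F) : fin_normal K ->
  exists n, K (a ^+ n.+1).
Proof.
move=> Kfn; apply: contrapT => /forallNP nK; apply: infinite_nat.
have -> : [set: nat] = (fun n => coset K (a ^+ n)) @^-1` range (coset K).
  by apply/seteqP; split=> // n _; exists (a ^+ n).
apply: finite_preimage; last exact: fn_finite.
have h m n : (m < n)%N -> coset K (a ^+ m) = coset K (a ^+ n) -> False.
  move=> mn /esym /(coset_eqP _ _ Kfn).
  rewrite -(subnK mn) addnS -addSn expgnDr mulgK; exact: nK.
by move=> m n _ _ mn; case: (ltngtP m n) => // /h; case.
Qed.

Lemma closure_mull b K x : (forall y, K y -> closure K (b * y)) ->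
  closure K x -> closure K (b * x).
Proof.
move=> h; apply: (closure_sub_preimage (@egroup_mull _ _ _ b)) => //.
exact: closed_closure.
Qed.

Lemma closure_mulr b K x : (forall y, K y -> closure K (y * b)) ->
  closure K x -> closure K (x * b).
Proof.
move=> h; apply: (closure_sub_preimage (@egroup_mulr _ _ _ b)) => //.
exact: closed_closure.
Qed.

(** Multiplication is only separately continuous, which gives the closure of
    [K] under products; inverses come from the finite index, because
    [x^-1 = x^n (x^(n+1))^-1] and some [x^(n+1)] is in [K]. *)
Lemma closure_fin_normal K : fin_normal K -> fin_normal (closure K).
Proof.
move=> Kfn; have [K1 KM KV KJ Kfin] := Kfn.
have clM x y : closure K x -> closure K y -> closure K (x * y).
  move=> cx; apply: closure_mull => z Kz; apply: closure_mulr cx => w Kw.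
  exact/subset_closure/KM.
have clX x n : closure K x -> closure K (x ^+ n).
  move=> cx; elim: n => [|n IH]; first by rewrite expg0; exact: subset_closure.
  by rewrite expgS; exact: clM.
split.
- exact: subset_closure.
- exact: clM.
- move=> x cx; have [n Kxn] := fin_normal_expn x Kfn.
  have -> : x^-1 = x ^+ n * (x ^+ n.+1)^-1 by rewrite expgS invgM mulKVg.
  by apply: clM; [exact: clX|apply/subset_closure/KV].
- move=> a x.
  apply: (@closure_sub_preimage _ _ (fun x => a * x * a^-1) K (closure K)).
  + move=> z; apply: (@continuous_comp _ _ _ (fun x => a * x) (fun x => x * a^-1)).
      exact: egroup_mull.
    exact: egroup_mulr.
  + exact: closed_closure.
  + by move=> y /(KJ a); exact: subset_closure.
- pose Phi (c : set H) := [set x | exists2 z, c z & closure K (x * z^-1)].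
  have -> : range (coset (closure K)) = Phi @` range (coset K).
    rewrite image_comp.
    have E a : coset (closure K) a = Phi (coset K a).
      apply/seteqP; split=> x; first by exists a => //; rewrite /coset /= mulgV.
      move=> [z Kza cxz]; have := clM _ _ cxz (subset_closure (Kza : K (z * a^-1))).
      by rewrite mulgA mulgKV.
    by apply/seteqP; split=> _ [a _ <-]; exists a => //=; rewrite E.
  exact: finite_image.
Qed.

(** ** Finitely many colours on a minimal left ideal *)

(** The colour of [p] in [L] is the set [p^-1 U]. *)
Definition finite_colors (U : set Y) : Prop :=
  finite_set ((fun p : T => p @^-1` U) @` L).

Section Colors.
Context (U : set Y) (Ucl : clopen U) (fcU : finite_colors U).

Local Notation fam := ((fun p : T => p @^-1` U) @` L).

(** The Ellis group permutes the finitely many colours by taking preimages;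
    this is the kernel of the action. *)
Definition color_kernel : set H := [set a | forall W, fam W -> egfun a @^-1` W = W].

Lemma fam_preimage a W : fam W -> fam (egfun a @^-1` W).
Proof.
move=> [p Lp <-]; exists (p \o egfun a) => //.
by apply: ei_ideal_comp2 => //; exact: egfun_ideal.
Qed.

Lemma fam_u W : fam W -> u @^-1` W = W.
Proof. by move=> [p Lp <-]; rewrite -comp_preimage ei_ideal_u. Qed.

Lemma color_kernelP a b : color_kernel (a * b^-1) <->
  forall W, fam W -> egfun a @^-1` W = egfun b @^-1` W.
Proof.
split=> h W fW.
  rewrite -[a](mulgKV b) egfunM comp_preimage; congr (_ @^-1` _).
  exact: h.
rewrite egfunM comp_preimage h // -comp_preimage -egfunM mulgV.
exact: fam_u.
Qed.

Lemma color_kernel_fin_normal : fin_normal color_kernel.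
Proof.
have kM x y : color_kernel x -> color_kernel y -> color_kernel (x * y).
  by move=> kx ky W fW; rewrite egfunM comp_preimage kx// ky.
have kV x : color_kernel x -> color_kernel x^-1.
  move=> kx; rewrite -[x^-1]mul1g; apply/color_kernelP => W fW.
  by rewrite kx // fam_u.
split => //.
- by move=> W fW; exact: fam_u.
- move=> a x kx; apply/color_kernelP => W fW.
  by rewrite egfunM comp_preimage kx //; exact: fam_preimage.
- have /finite_seqP[s sE] := fcU; pose n := size s.
  have fs W : fam W -> W \in s by move=> fW; have : [set` s] W by rewrite -sE.
  have fn a (i : 'I_n) : (index (egfun a @^-1` (nth set0 s i)) s < n)%N.
    rewrite index_mem; apply/fs/fam_preimage; rewrite sE /=; exact: mem_nth.
  apply: (@finite_range_factor _ _ {ffun 'I_n -> 'I_n} _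
    (fun a => [ffun i => Ordinal (fn a i)])) => x y /ffunP xy.
  have E W : fam W -> egfun x @^-1` W = egfun y @^-1` W.
    move=> fW; have Wn : (index W s < n)%N by rewrite index_mem; exact: fs.
    have := xy (Ordinal Wn); rewrite !ffunE => /(congr1 val) /=.
    rewrite nth_index; last exact: fs.
    move=> I; rewrite -[LHS](nth_index set0 (s := s)); last exact/fs/fam_preimage.
    by rewrite I nth_index //; exact/fs/fam_preimage.
  apply/seteqP; split=> a /color_kernelP h; apply/color_kernelP => W fW.
    by rewrite h// E.
  by rewrite h// E.
Qed.

(** The kernel itself need not be tau-closed. But for [b] in the kernel,
    [g_i \o b = (g_i \o u) \o b] has the colour of [g_i \o u], and if [g_i]
    converges to [u], then so does [g_i \o u]. Hence a tau-limit of kernel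
    elements has the colour of [u]. *)
Lemma color_kernel_closure a : closure color_kernel a ->
  egfun a @^-1` U = u @^-1` U.
Proof.
rewrite egroup_closure /= => ca.
have h (y : Y) : U (egfun a y) <-> U (u y).
  have [g [_ [[b kb <-] /= h1 h2]]] := ca _ _ (clopen_nbhs_eval u (u y) Ucl)
    (clopen_nbhs_eval (egfun a) y Ucl).
  rewrite -h2.
  have -> : u y = (u \o u) y by rewrite ei_idem.
  rewrite -h1.
  have fW : fam ((act g \o u) @^-1` U).
    exists (act g \o u) => //; apply: ei_ideal_comp (ei_mem d).
    exact: ellis_act.
  have := kb _ fW; rewrite -comp_preimage.
  have -> : (act g \o u) \o egfun b = act g \o (u \o egfun b) by [].
  rewrite egfun_ul => /seteqP[h3 h4].
  by split=> [/h3|/h4].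
by apply/seteqP; split=> y /h.
Qed.

End Colors.

End EllisFiniteIndex.

(** * Profinite Ellis groups *)

Section EllisProfinite.
Context (G : groupType) (Y : gspace G) (d : ellis_idempotent Y).

Local Notation act := (gact Y).
Local Notation T := {ptws Y -> Y}.
Local Notation L := (ei_ideal d).
Local Notation u := (ei_fun d).
Local Notation H := (egroup d).
Local Notation egfun := (@egfun G Y d).

Lemma tau_closedP (B : set T) :
  tau_closed act L u B <-> B `<=` ellis_group L u /\ closed (egfun @^-1` B).
Proof.
have BE : B `<=` ellis_group L u -> egfun @` (egfun @^-1` B) = B.
  move=> BL; apply/seteqP; split=> [_ [a Ba <-]//|b Bb].
  by exists (EGroup (BL _ Bb)).
split=> -[BL h]; split => //.
  apply/egroup_closedP => a; rewrite BE// => ca.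
  by rewrite /= -h; split; [exact: egfunP|rewrite tau_circE].
rewrite /tau_closure tau_circE; apply/seteqP; split=> [f [Hf cf]|f Bf].
  move/egroup_closedP : h => /(_ (EGroup Hf)); apply.
  by rewrite BE.
split; first exact: BL.
move/BL : (Bf) => /ellis_groupP[_ uf].
by rewrite -[X in circ _ _ X]uf; apply: circ_closure;
  [exact/ei_ideal_sub/ei_mem|exact: subset_closure].
Qed.

Definition closed_normal := {N : set H | closed N /\ fin_normal N}.

Lemma closed_normalI (N K : closed_normal) :
  exists P : closed_normal, projT1 P = projT1 N `&` projT1 K.
Proof.
case: N K => [N [Ncl Nfn]] [K [Kcl Kfn]].
have h : closed (N `&` K) /\ fin_normal (N `&` K).
  by split; [exact: closedI|exact: fin_normalI].
by exists (exist _ (N `&` K) h).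
Qed.

Lemma coset_closed (N : closed_normal) a : closed [set b : H | projT1 N (b * a)].
Proof.
case: N => [N [Ncl _]] /=.
by apply: (continuous_closedP (fun b : H => b * a)).1 Ncl; exact: egroup_mulr.
Qed.

Hypothesis separated : forall a : H, (forall N : closed_normal, projT1 N a) -> a = 1.

(** The product of the finite quotients by the closed normal subgroups of finite
    index is Hausdorff and the Ellis group is compact, so the diagonal map is
    closed, and it hits every coherent family because cosets are closed. *)
Lemma egroup_profinite :
  profinite_group (ellis_group L u) (fun f g => f \o g) (tau_closed act L u).
Proof.
pose I := closed_normal.
have quo (N : I) : {F : finGroupType & {theta : H -> F |
    [/\ {morph theta : x y / x * y}, forall z, exists x, theta x = z &
        forall x y, theta x = theta y <-> projT1 N (x * y^-1)]}}.
  have [F /cid[theta h]] := cid (finite_quotient (proj2 (projT2 N))).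
  by exists F, theta.
pose F N := projT1 (quo N).
pose theta (N : I) : H -> F N := projT1 (projT2 (quo N)).
have thM (N : I) : {morph theta N : x y / x * y} by
  rewrite /theta; case: (projT2 (quo N)) => ? [].
have thS (N : I) z : exists x, theta N x = z.
  by move: z; rewrite /theta; case: (projT2 (quo N)) => ? [].
have thP (N : I) x y : theta N x = theta N y <-> projT1 N (x * y^-1).
  by move: x y; rewrite /theta; case: (projT2 (quo N)) => ? [].
pose rep (N : I) z := projT1 (cid (thS N z)).
have repK (N : I) z : theta N (rep N z) = z by rewrite /rep; case: cid.
pose le (N K : I) := projT1 K `<=` projT1 N.
pose t (N K : I) (z : F K) : F N := theta N (rep K z).
have tE (N K : I) a : le N K -> t N K (theta K a) = theta N a.
  by move=> NK; apply/thP/NK/thP; rewrite repK.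
pose f (p : T) : forall N, F N :=
  if pselect (ellis_group L u p) is left h then fun N => theta N (EGroup h)
  else fun N => 1.
have fE a : f (egfun a) = theta^~ a.
  rewrite /f; case: pselect => [h|]; last by case; exact: egfunP.
  by apply: functional_extensionality_dep => N; congr theta; exact: egroup_ext.
pose phi (a : H) : prod_topology (fun N => discrete_topology (F N)) := theta^~ a.
have inj a b : (forall N, theta N a = theta N b) -> a = b.
  move=> ab; apply: divg1_eq; apply: separated => N; exact/thP.
have phic : continuous phi.
  apply: prod_continuous => N; apply/continuous_closedP => C _.
  rewrite /phi /=.
  have -> : (fun z => theta N z) @^-1` C =
      \bigcup_(c in C) [set b | projT1 N (b * (rep N c)^-1)].
    apply/seteqP; split=> a.
      by move=> Ca; exists (theta N a) => //; apply/thP; rewrite repK.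
    by move=> [c Cc /thP] /=; rewrite repK => ->.
  apply: closed_bigcup => [|c _]; first exact: finite_finset.
  exact: coset_closed.
have dir : inverse_system le t.
  split.
  - split.
    + by split; exists [set: H]; split; [exact: closedT|exact: fin_normalT].
    + by move=> N.
    + by move=> N K P NK KP x /KP/NK.
    + move=> N K; have [P PE] := closed_normalI N K.
      by exists P; rewrite /le PE; split => x [].
  - by move=> N z; rewrite /t repK.
  - move=> N K P NK KP z; rewrite -{1}[z]repK (tE K P)// (tE N K)//.
exists I, le, F, t, f; split => //.
- move=> N K NK x y.
  have h a b : t N K (theta K a * theta K b) = t N K (theta K a) * t N K (theta K b).
    by rewrite -thM !tE// thM.
  by have := h (rep K x) (rep K y); rewrite !repK.
- have bij : set_bij (ellis_group L u) (inverse_limit le t) f.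
    split.
    + move=> p Hp; rewrite -[p]/(egfun (EGroup Hp)) fE => N K NK.
      exact: tE.
    + move=> p q /set_mem Hp /set_mem Hq.
      rewrite -[p]/(egfun (EGroup Hp)) -[q]/(egfun (EGroup Hq)) !fE => E.
      by congr egfun; apply: inj => N; exact: (congr1 (fun h => h N) E).
    + move=> z zlim.
      have [||N _|N K _ _|a _ za] := @compact_directed H setT I setT
        (fun N => [set b | projT1 N (b * (rep N (z N))^-1)]) (@egroup_compact _ _ d).
      * by have [[[N] _ _ _] _ _] := dir; exists N.
      * by move=> N _; exact: coset_closed.
      * by exists (rep N (z N)); split=> //=; rewrite mulgV; case: (projT2 N) => _ [].
      * have [P PE] := closed_normalI N K; exists P => // b /thP; rewrite repK => bP.
        have [PN PK] : le N P /\ le K P by rewrite /le PE; split=> x [].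
        split; apply/thP; rewrite repK.
          by rewrite -(zlim N P)// -bP tE.
        by rewrite -(zlim K P)// -bP tE.
      * exists (egfun a); first exact: egfunP.
        rewrite fE; apply: functional_extensionality_dep => N.
        by have /thP := za N Logic.I; rewrite repK.
  split => //.
  + move=> p q N Hp Hq.
    rewrite -[p]/(egfun (EGroup Hp)) -[q]/(egfun (EGroup Hq)) -egfunM !fE.
    exact: thM.
  + move=> C; rewrite tau_closedP; split=> [[CH Ccl]|[D Dcl CE]].
      exists (phi @` (egfun @^-1` C)).
        apply: compact_closed.
          by apply: prod_hausdorff => N; exact: discrete_hausdorff.
        apply: continuous_compact; first exact: continuous_subspaceT.
        exact: (subclosed_compact Ccl (@egroup_compact _ _ d)).
      apply/seteqP; split=> p.
        move=> Cp; have Hp := CH _ Cp; split => //.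
        by exists (EGroup Hp) => //; rewrite -[p]/(egfun (EGroup Hp)) fE.
      move=> [Hp [a Ca]]; rewrite -[p]/(egfun (EGroup Hp)) fE => E.
      by rewrite -(inj a (EGroup Hp)) // => N; exact: (congr1 (fun h => h N) E).
    split; first by rewrite CE => p [].
    suff -> : egfun @^-1` C = phi @^-1` D by exact: (continuous_closedP _).1.
    rewrite CE; apply/seteqP; split=> a /=; rewrite fE; first by case.
    by split => //; exact: egfunP.
Qed.

End EllisProfinite.

(** An element of the tau-closures of all colour kernels has the same colours as
    [u], so it is [u] if the colouring sets separate the points of [Y]. *)
Lemma ellis_group_profinite (G : groupType) (Y : gspace G)
    (d : ellis_idempotent Y) (F : set (set Y)) :
  (forall U, F U -> clopen U /\ finite_colors d U) ->
  (forall x y, (forall U, F U -> U x <-> U y) -> x = y) ->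
  profinite_group (ellis_group (ei_ideal d) (ei_fun d)) (fun f g => f \o g)
    (tau_closed (gact Y) (ei_ideal d) (ei_fun d)).
Proof.
move=> FP Fsep; apply: egroup_profinite => a Na; apply: egroup_ext.
rewrite egfun1; apply/funext => y; apply: Fsep => U FU.
have [Ucl Ufc] := FP U FU.
have h : closed (closure (@color_kernel _ _ d U)) /\
    fin_normal (closure (@color_kernel _ _ d U)).
  split; first exact: closed_closure.
  exact/closure_fin_normal/color_kernel_fin_normal.
have /(color_kernel_closure Ucl)/seteqP[h1 h2] := Na (exist _ (closure (@color_kernel _ _ d U)) h).
by split=> [/h1|/h2].
Qed.

(** * Profinite flows *)

Section FlowPartition.
Context (G : topologicalGroupType) (X : flow G).

Lemma flow_orbit_continuous (x : X) : continuous (fun g : G => flow_act g x).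
Proof.
move=> g; apply: (@continuous_comp _ _ _ (fun h => (h, x))
  (fun p : G * X => flow_act p.1 p.2)).
  by apply: cvg_pair; [exact: cvg_id|exact: cvg_cst].
exact: flow_continuous.
Qed.

Lemma flow_act_continuous (g : G) : continuous (fun x : X => flow_act g x).
Proof.
move=> x; apply: (@continuous_comp _ _ _ (fun y => (g, y))
  (fun p : G * X => flow_act p.1 p.2)).
  by apply: cvg_pair; [exact: cvg_cst|exact: cvg_id].
exact: flow_continuous.
Qed.

(** The kernel of a morphism onto a finite flow, as the map sending a point to
    its class. *)
Record finite_partition (R : X -> set X) : Prop := FinitePartition {
  fp_refl : forall x, R x x;
  fp_sym : forall x y, R x y -> R y x;
  fp_trans : forall x y z, R x y -> R y z -> R x z;
  fp_closed : forall x, closed (R x);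
  fp_finite : finite_set (range R);
  fp_act : forall g x y, R x y -> R (flow_act g x) (flow_act g y)
}.

Lemma finite_partitionT : finite_partition (fun=> setT).
Proof.
split => //.
by apply: (@finite_range_factor _ _ bool _ (fun=> true)).
Qed.

Lemma finite_partitionI R R' : finite_partition R -> finite_partition R' ->
  finite_partition (fun x => R x `&` R' x).
Proof.
move=> [r1 r2 r3 r4 r5 r6] [q1 q2 q3 q4 q5 q6]; split.
- by [].
- by move=> x y [/r2 ? /q2 ?].
- by move=> x y z [xy xy'] [yz yz']; split; [exact: r3 yz|exact: q3 yz'].
- by move=> x; exact: closedI.
- apply: (sub_finite_set _ (finite_image2 (fun A B => A `&` B) r5 q5)).
  by move=> _ [a _ <-]; exists (R a) => //; exists (R' a).
- by move=> g x y [/r6 ? /q6 ?].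
Qed.

Section Quotient.
Variables (R : X -> set X) (RP : finite_partition R).

Definition block := set_type (range R).

Definition block_of x : block := exist _ (R x) (mem_set (imageT R x)).

Lemma block_of_eq x y : block_of x = block_of y <-> R x y.
Proof.
have [r1 r2 r3 _ _ _] := RP; split=> [/(congr1 val)/= ->|xy]; first exact: r1.
apply: val_inj; apply/seteqP; split=> z /=; first by apply: r3; exact: r2.
exact: r3.
Qed.

Lemma block_of_surj (b : block) : exists x, block_of x = b.
Proof.
case: b => b bP; have [x _ xb] := set_mem bP.
by exists x; apply: val_inj.
Qed.

Definition block_repr b := projT1 (cid (block_of_surj b)).

Lemma block_reprK b : block_of (block_repr b) = b.
Proof. by rewrite /block_repr; case: cid. Qed.

Definition block_act (g : G) (b : discrete_topology block) :
  discrete_topology block := block_of (flow_act g (block_repr b)).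

Lemma block_actE g x : block_act g (block_of x) = block_of (flow_act g x).
Proof.
by apply/block_of_eq; apply: fp_act => //; apply/block_of_eq; rewrite block_reprK.
Qed.

Lemma block_finite : finite_set [set: block].
Proof.
have -> : [set: block] = val @^-1` range R.
  by apply/seteqP; split=> // -[b bP] _; exact: (set_mem bP).
apply: finite_preimage; last exact: fp_finite.
by move=> a b _ _; exact: val_inj.
Qed.

Lemma block_preimage_closed (C : set block) : closed (block_of @^-1` C).
Proof.
have -> : block_of @^-1` C = \bigcup_(b in C) R (block_repr b).
  apply/seteqP; split=> x; last first.
    by move=> [b Cb /block_of_eq]; rewrite block_reprK /= => <-.
  move=> /= Cx; exists (block_of x) => //.
  by apply/block_of_eq; rewrite block_reprK.
apply: closed_bigcup; first exact: sub_finite_set block_finite.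
by move=> b _; exact: fp_closed.
Qed.

Lemma block_of_continuous :
  continuous (block_of : X -> discrete_topology block).
Proof. by apply/continuous_closedP => C _; exact: block_preimage_closed. Qed.

Fact block_act1 b : block_act 1 b = b.
Proof. by rewrite -(block_reprK b) block_actE flow_act1. Qed.

Fact block_actM g h b : block_act (g * h) b = block_act g (block_act h b).
Proof. by rewrite -(block_reprK b) !block_actE flow_actM. Qed.

Fact block_act_continuous : continuous
  (fun p : G * discrete_topology block => block_act p.1 p.2).
Proof.
move=> [g b]; apply/discrete_cvg.
pose x := block_repr b.
have c : continuous (fun h : G => block_of (flow_act h x) : discrete_topology block).
  move=> h; apply: (@continuous_comp _ _ _ (fun h => flow_act h x)).
    exact: flow_orbit_continuous.
  exact: block_of_continuous.
have ng := continuous_nbhs c (@discrete_set1 (discrete_topology block)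
  (block_of (flow_act g x))).
exists ([set h | block_of (flow_act h x) = block_of (flow_act g x)], [set b]).
  by split=> //; exact: (@discrete_set1 (discrete_topology block)).
by move=> [h c'] /= [hE ->]; rewrite -(block_reprK b) !block_actE.
Qed.

Definition block_flow : flow G :=
  @Flow G (discrete_topology block) block_act block_act1 block_actM
    block_act_continuous (finite_compact (A := [set: discrete_topology block])
      block_finite) discrete_hausdorff.

End Quotient.

(** The flow embeds into the product of its finite quotients; compactness makes
    the image the whole inverse limit and the embedding a homeomorphism. *)
Lemma profinite_flowP :
  (forall x y, x <> y -> exists2 R, finite_partition R & ~ R x y) ->
  profinite_flow X.
Proof.
move=> Xsep; pose I := {R : X -> set X | finite_partition R}.
pose F (i : I) := block_flow (projT2 i).
pose le (i j : I) := forall x y, projT1 j x y -> projT1 i x y.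
pose t (i j : I) (b : F j) : F i := block_of (projT1 i) (@block_repr (projT1 j) b).
pose f (x : X) (i : I) : F i := block_of (projT1 i) x.
have fP i x y : f x i = f y i <-> projT1 i x y by exact/block_of_eq/(projT2 i).
have tE i j x : le i j -> t i j (f x j) = f x i.
  move=> ij; apply/fP/ij/fP; exact: block_reprK.
have fS i (b : F i) : exists x, f x i = b by exact: block_of_surj.
have fA i g x : flow_act g (f x i) = f (flow_act g x) i.
  exact: (block_actE (projT2 i)).
have inj x y : (forall i, f x i = f y i) -> x = y.
  move=> xy; apply: contrapT => /Xsep[R RP]; apply.
  exact/(fP (exist _ R RP)).
have fc : continuous (f : X -> prod_topology F).
  by apply: prod_continuous => i; exact: block_of_continuous (projT2 i).
have meet (i j : I) : exists k : I, le i k /\ le j k.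
  exists (exist _ _ (finite_partitionI (projT2 i) (projT2 j))).
  by split=> x y [].
have dir : inverse_system le t.
  split.
  - split; first by split; exists (fun=> setT); exact: finite_partitionT.
    + by move=> i x y.
    + by move=> i j k ij jk x y /jk/ij.
    + exact: meet.
  - by move=> i b; exact: block_reprK.
  - by move=> i j k ij jk b; have [x <-] := fS k b; rewrite !tE// => x' y /jk/ij.
exists I, le, F, t, f; split => //.
- by move=> i; exact: block_finite (projT2 i).
- move=> i j ij; split.
    move=> b A /nbhs_singleton At; apply: (@filterS _ (nbhs b) _ [set b]).
      by move=> _ ->.
    exact: (@discrete_set1 (discrete_topology (block (projT1 j)))).
  move=> g b; have [x <-] := fS j b.
  by rewrite fA !tE// fA.
split.
- split.
  + by move=> x _ i j ij; exact: tE.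
  + by move=> x y _ _ E; apply: inj => i; rewrite E.
  + move=> z zlim.
    have [||i _|i j _ _|x _ xz] := @compact_directed X setT I setT
        (fun i => [set x | f x i = z i]) (@flow_compact _ X).
    * by have [[[i] _ _ _] _ _] := dir; exists i.
    * move=> i _; refine (@block_preimage_closed (projT1 i) (projT2 i) (fun b => b = z i)).
    * by have [x xi] := fS i (z i); exists x.
    * have [k [ik jk]] := meet i j; exists k => // x /= xk.
      by split; rewrite /= -(tE _ k)// xk zlim.
    * exists x => //; apply: functional_extensionality_dep => i; exact: xz.
- by move=> g x i; rewrite fA.
- move=> U; split=> [oU|[V oV ->]]; last first.
    by move/continuousP : fc; apply.
  exists (~` (f @` (~` U) : set (prod_topology F))).
    apply: closed_openC; apply: compact_closed.
      by apply: prod_hausdorff => i; exact: flow_hausdorff.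
    apply: (@continuous_compact _ _ (f : X -> prod_topology F)).
      exact: continuous_subspaceT.
    by apply: (subclosed_compact _ (@flow_compact _ X)) => //; exact: open_closedC.
  apply/seteqP; split=> x.
    by move=> Ux [y nUy fyx]; apply: nUy; rewrite (inj y x)// => i; rewrite fyx.
  by move=> nf; apply: contrapT => nUx; apply: nf; exists x.
Qed.

End FlowPartition.

(** * Distal minimal flows *)

Lemma fst_continuous (X Z : topologicalType) : continuous (@fst X Z).
Proof. by move=> z; exact: cvg_fst. Qed.

Lemma snd_continuous (X Z : topologicalType) : continuous (@snd X Z).
Proof. by move=> z; exact: cvg_snd. Qed.

Section ProductSpace.
Context (G : groupType) (S X : gspace G).

Definition prod_gact (g : G) (y : S * X) : S * X := (gact S g y.1, gact X g y.2).

Fact prod_gact1 y : prod_gact 1 y = y.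
Proof. by case: y => s x; rewrite /prod_gact !gact1. Qed.

Fact prod_gactM g h y : prod_gact (g * h) y = prod_gact g (prod_gact h y).
Proof. by rewrite /prod_gact !gactM. Qed.

Fact prod_gact_continuous g : continuous (prod_gact g).
Proof.
move=> y; apply: (@cvg_pair _ _ _ (nbhs y) _ _ _ _ _
    (fun z => gact S g z.1) (fun z => gact X g z.2)).
  apply: (@continuous_comp _ _ _ fst (gact S g)); first exact: fst_continuous.
  exact: gact_continuous.
apply: (@continuous_comp _ _ _ snd (gact X g)); first exact: snd_continuous.
exact: gact_continuous.
Qed.

Fact prod_gspace_compact : compact [set: S * X].
Proof.
have := compact_setX (@gspace_compact _ S) (@gspace_compact _ X).
by rewrite setXTT.
Qed.

Fact prod_gspace_hausdorff : hausdorff_space (S * X)%type.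
Proof.
move=> [s x] [s' x'] cl; congr (_, _).
  apply: gspace_hausdorff => A B sA sB.
  have [||z [Az Bz]] := cl (fst @^-1` A) (fst @^-1` B).
  - by apply: (continuous_nbhs (@fst_continuous _ _)).
  - by apply: (continuous_nbhs (@fst_continuous _ _)).
  - by exists z.1.
apply: gspace_hausdorff => A B sA sB.
have [||z [Az Bz]] := cl (snd @^-1` A) (snd @^-1` B).
- by apply: (continuous_nbhs (@snd_continuous _ _)).
- by apply: (continuous_nbhs (@snd_continuous _ _)).
- by exists z.2.
Qed.

Definition prod_gspace : gspace G := @Gspace G (S * X)%type prod_gact
  prod_gact1 prod_gactM prod_gact_continuous prod_gspace_compact
  prod_gspace_hausdorff.

Lemma prod_snd_continuous (y : S * X) :
  continuous (fun p : {ptws prod_gspace -> prod_gspace} => (p y).2).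
Proof.
move=> p; apply: (@continuous_comp _ _ _
  (fun p : {ptws prod_gspace -> prod_gspace} => p y) snd).
  exact: prod_eval_continuous.
exact: snd_continuous.
Qed.

Lemma prod_fst_continuous (y : S * X) :
  continuous (fun p : {ptws prod_gspace -> prod_gspace} => (p y).1).
Proof.
move=> p; apply: (@continuous_comp _ _ _
  (fun p : {ptws prod_gspace -> prod_gspace} => p y) fst).
  exact: prod_eval_continuous.
exact: fst_continuous.
Qed.

(** This holds for the elements of [G] and passes to pointwise limits. *)
Lemma prod_ellis_snd (p : {ptws prod_gspace -> prod_gspace}) s s' x :
  ellis_semigroup (gact prod_gspace) p -> (p (s, x)).2 = (p (s', x)).2.
Proof.
move=> Ep; apply: gspace_hausdorff => A B.
move=> /(continuous_nbhs (@prod_snd_continuous (s, x))) nA.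
move=> /(continuous_nbhs (@prod_snd_continuous (s', x))) nB.
have [_ [g _ <-] /nbhs_singleton[/= Ag Bg]] := nbhs_closure Ep (filterI nA nB).
by exists (gact X g x).
Qed.

End ProductSpace.

Definition flow_gspace (G : topologicalGroupType) (X : flow G) : gspace G :=
  @Gspace G X (@flow_act G X) (@flow_act1 G X) (@flow_actM G X)
    (@flow_act_continuous G X) (@flow_compact G X) (@flow_hausdorff G X).

Section Distal.
Context (G : topologicalGroupType) (X : flow G) (S : gspace G).

Local Notation Y := (prod_gspace S (flow_gspace X)).
Local Notation T := {ptws Y -> Y}.
Local Notation E := (ellis_semigroup (gact Y)).

Context (s0 : S) (F : set (set S)).

(** Well defined for [p] in [E], where the second component of [p (s0, x)] is
    determined by [p] and [x] alone ([prod_ellis_snd]). *)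
Definition snd_act (p : T) (x : X) : X := (p (s0, x)).2.

(** In place of a factor map from the orbit closure of [s0] onto [X]: an element
    of the Ellis semigroup is determined on [X] by its value at [s0], as seen by
    the sets in [F]. *)
Definition determined := forall p q x, E p -> E q ->
  (forall U, F U -> U (p (s0, x)).1 <-> U (q (s0, x)).1) ->
  snd_act p x = snd_act q x.

Lemma snd_actM p q x : E p -> snd_act (p \o q) x = snd_act p (snd_act q x).
Proof.
move=> Ep; rewrite /snd_act /=; case E' : (q (s0, x)) => [s y] /=.
exact: (@prod_ellis_snd _ S (flow_gspace X) p s s0 y Ep).
Qed.

Lemma snd_act_continuous x : continuous (fun p : T => snd_act p x).
Proof. exact: prod_snd_continuous. Qed.

(** The points reached from [x] form a closed set that contains an orbit. *)
Lemma ideal_transitive (d : ellis_idempotent Y) x y : minimal_flow X ->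
  exists2 p, ei_ideal d p & snd_act p x = y.
Proof.
move=> [_ dX]; pose C := (fun p => snd_act p x) @` ei_ideal d.
have Ccl : closed C.
  apply: compact_closed; first exact: flow_hausdorff.
  apply: (@continuous_compact _ _ (fun p : T => snd_act p x)).
    by apply: continuous_subspaceT; exact: snd_act_continuous.
  exact: ei_ideal_compact.
suff [p Lp <-] : C y by exists p.
apply: Ccl => W; rewrite nbhsE => -[Q [Qo Qy]] QW.
have [z [Qz [g _ gz]]] := dX (snd_act (ei_fun d) x) Q (ex_intro _ y Qy) Qo.
exists z; split; last exact: QW.
exists (gact Y g \o ei_fun d).
  by apply: ei_ideal_comp (ei_mem d); exact: ellis_act.
by rewrite snd_actM //; exact: ellis_act.
Qed.

Hypothesis Xdistal : distal_flow X.
Hypothesis Xminimal : minimal_flow X.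

(** A net converging to the idempotent [u] moves [x] and [u x] to the same
    limit [u x], so they are equal by distality. *)
Lemma snd_act_idem u x : E u -> u \o u = u -> snd_act u x = x.
Proof.
move=> Eu uu; apply: contrapT => /nesym xux; apply: (Xdistal xux).
have ux : snd_act u (snd_act u x) = snd_act u x by rewrite -snd_actM// uu.
pose FF : set_system G := filter_from (nbhs u) (fun W => [set g | W (gact Y g)]).
have cvgF y : (fun g => flow_act g y) @ FF --> snd_act u y.
  move=> A /(continuous_nbhs (@snd_act_continuous y)) nA.
  by exists ((fun p : T => snd_act p y) @^-1` A).
exists FF, (snd_act u x); split.
- apply: filter_from_proper; first apply: filter_from_filter.
  + by exists setT; exact: filterT.
  + move=> A B nA nB; exists (A `&` B); first exact: filterI.
    by move=> g [].
  + move=> A /(nbhs_closure Eu)[_ [g _ <-] /nbhs_singleton Ag].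
    by exists g.
- exact: cvgF.
- by rewrite -[X in _ --> X]ux; exact: cvgF.
Qed.

Variable d : ellis_idempotent Y.
Local Notation L := (ei_ideal d).
Local Notation u := (ei_fun d).
Local Notation H := (egroup d).
Local Notation egfun := (@egfun G Y d).

Let u_act x : snd_act u x = x.
Proof. by apply: snd_act_idem; [exact/ei_ideal_sub/ei_mem|exact: ei_idem]. Qed.

Definition egroup_act (a : H) (x : X) : X := snd_act (egfun a) x.

Lemma egroup_act1 x : egroup_act 1 x = x.
Proof. exact: u_act. Qed.

Lemma egroup_actM a b x : egroup_act (a * b) x = egroup_act a (egroup_act b x).
Proof. by apply: snd_actM; exact: egfun_ellis. Qed.

(** Since [u] is the identity on [X], [r] and [u r] act in the same way. *)
Lemma egroup_act_ideal r : L r -> exists a, forall x, egroup_act a x = snd_act r x.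
Proof.
move=> Lr; exists (EGroup (ellis_group_u Lr)) => x.
by rewrite /egroup_act /= snd_actM ?u_act//; exact/ei_ideal_sub/ei_mem.
Qed.

Lemma egroup_act_flow g : exists a, forall x, egroup_act a x = flow_act g x.
Proof.
have Lg : L (gact Y g \o u).
  by apply: ei_ideal_comp (ei_mem d); exact: ellis_act.
have [a ha] := egroup_act_ideal Lg; exists a => x; rewrite ha.
rewrite snd_actM ?u_act//; exact: ellis_act.
Qed.

Lemma egroup_act_transitive x y : exists a, egroup_act a x = y.
Proof.
have [r Lr <-] := ideal_transitive d x y Xminimal.
by have [a ha] := egroup_act_ideal Lr; exists a.
Qed.

Definition egroup_orbit (N : set H) (x : X) : set X := (fun a => egroup_act a x) @` N.

(** Closedness: a pointwise limit [r] of elements of [N] acts on [X] as [u r],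
    which is in the tau-closed set [N]. Finiteness: the group is transitive, so
    every orbit of [N] is the image of a coset of [N]. Invariance: [G] acts
    through the Ellis group, in which [N] is normal. *)
Lemma egroup_orbit_finite_partition (N : closed_normal d) :
  finite_partition (egroup_orbit (projT1 N)).
Proof.
case: N => [N [Ncl Nfn]] /=; have [N1 NM NV NJ Nfin] := Nfn; split.
- by move=> x; exists 1 => //; exact: egroup_act1.
- move=> x _ [a Na <-]; exists a^-1; first exact: NV.
  by rewrite -egroup_actM mulVg egroup_act1.
- by move=> x _ _ [a Na <-] [b Nb <-]; exists (b * a); [exact: NM|exact: egroup_actM].
- move=> x y clNxy.
  have cK : compact (closure (egfun @` N)).
    apply: (subclosed_compact _ (@ei_ideal_compact _ _ d)).
      exact: closed_closure.
    move=> r clr; apply: ei_ideal_closed; move: clr.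
    by apply: closureS => _ [a _ <-]; exact: egfun_ideal.
  have Kcl : closed ((fun r => snd_act r x) @` closure (egfun @` N)).
    apply: compact_closed; first exact: flow_hausdorff.
    apply: (@continuous_compact _ _ (fun r : T => snd_act r x)) => //.
    by apply: continuous_subspaceT; exact: snd_act_continuous.
  have [|r clr <-] := Kcl y.
    move: clNxy; apply: closureS => _ [a Na <-]; exists (egfun a) => //.
    by apply: subset_closure; exists a.
  have [a Na ar] := closure_egroup Ncl clr; exists a => //.
  by rewrite /egroup_act ar snd_actM ?u_act//; exact/ei_ideal_sub/ei_mem.
- have [[x0 _] _] := Xminimal.
  pose Phi (c : set H) := (fun a => egroup_act a x0) @` c.
  apply: (sub_finite_set _ (finite_image Phi Nfin)) => _ [x _ <-].
  have [a <-] := egroup_act_transitive x0 x.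
  exists (coset N a) => //; apply/seteqP; split=> [_ [b Nba <-]|_ [b Nb <-]].
    by exists (b * a^-1) => //; rewrite -egroup_actM mulgKV.
  by exists (b * a); [rewrite /coset /= mulgK|rewrite egroup_actM].
- move=> g x _ [a Na <-]; have [c cg] := egroup_act_flow g.
  exists (c * a * c^-1); first exact: NJ.
  by rewrite -!cg -!egroup_actM mulgKV.
Qed.

Lemma egroup_act_eq_closed x y : closed [set a | egroup_act a x = y].
Proof.
apply/egroup_closedP => a ca; apply: flow_hausdorff => A B nA nB.
have nu : nbhs u ((fun p : T => snd_act p y) @^-1` B).
  by apply: (continuous_nbhs (@snd_act_continuous y)); rewrite u_act.
have [g [_ [[b bxy <-] Bg Ag]]] :=
  ca _ _ nu (continuous_nbhs (@snd_act_continuous x) nA).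
exists (flow_act g y); split=> //.
by rewrite -bxy; move: Ag; rewrite /= snd_actM//; exact: ellis_act.
Qed.

Hypothesis Fclopen : forall U, F U -> clopen (fst @^-1` U : set Y).
Hypothesis Fcolors : forall U, F U -> finite_colors d (fst @^-1` U).
Hypothesis Fdet : determined.

(** If no partition into orbits separates [x] from [y], then by compactness one
    element of all closed normal subgroups of finite index maps [x] to [y]. It
    has the same colours as [u], so it acts on [X] as [u], trivially. *)
Lemma distal_profinite : profinite_flow X.
Proof.
apply: profinite_flowP => x y xy; apply: contrapT => nR.
have [|N _|N _|N K _ _|b _ bN] := @compact_directed H setT (closed_normal d) setT
  (fun N => projT1 N `&` [set a | egroup_act a x = y]) (@egroup_compact _ _ d).
- by exists (exist _ [set: H] (conj closedT (fin_normalT H))).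
- by apply: closedI; [case: (projT2 N)|exact: egroup_act_eq_closed].
- apply: contrapT => nb; apply: nR; exists (egroup_orbit (projT1 N)).
    exact: egroup_orbit_finite_partition.
  by move=> [a Na axy]; apply: nb; exists a.
- have [P PE] := closed_normalI N K; exists P => // a [].
  by rewrite PE => -[].
have /= bcl U : F U -> closure (@color_kernel _ _ d (fst @^-1` U)) b.
  move=> FU; pose K := closure (@color_kernel _ _ d (fst @^-1` U)).
  have h : closed K /\ fin_normal K.
    split; first exact: closed_closure.
    by apply/closure_fin_normal/color_kernel_fin_normal; exact: Fcolors.
  by have [] := bN (exist _ K h) Logic.I.
have [_ bxy] := bN (exist _ [set: H] (conj closedT (fin_normalT H))) Logic.I.
apply: xy; rewrite -bxy -[LHS]u_act.
apply: Fdet => [||U FU]; [exact/ei_ideal_sub/ei_mem|exact: egfun_ellis|].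
have /seteqP[h1 h2] := color_kernel_closure (Fclopen FU) (bcl U FU).
by split=> [/h2|/h1].
Qed.

End Distal.

(** * Colourings *)

(** A bound on the cardinality whose violation involves finitely many elements,
    so that it passes to limits. *)
Definition at_most (X : Type) (l : nat) (A : set X) : Prop :=
  forall f : 'I_l.+1 -> X, (forall i, A (f i)) -> ~ injective f.

Lemma at_mostS (X : Type) l (A B : set X) : A `<=` B -> at_most l B -> at_most l A.
Proof. by move=> AB h f fA; apply: h => i; exact: AB. Qed.

Lemma card_le_at_most (X : Type) l (A : set X) : A #<= `I_l -> at_most l A.
Proof.
move=> /pcard_leP/injfunPex[g gA ginj] f fA finj.
have gl i : (g (f i) < l)%N := gA _ (fA i).
have : (#|'I_l.+1| <= #|'I_l|)%N.
  apply: (@leq_card _ _ (fun i => Ordinal (gl i))) => i j /(congr1 val) /= gij.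
  by apply: finj; apply: ginj => //; exact/mem_set.
by rewrite !card_ord ltnn.
Qed.

Lemma at_most_card_le (X : Type) l (A : set X) : at_most l A -> A #<= `I_l.
Proof.
move=> h.
have mk (B : set nat) : (forall i, (i < l.+1)%N -> B i) -> B #<= A -> False.
  move=> lB /card_leP[g].
  pose f (i : 'I_l.+1) := val (g (exist _ (val i) (mem_set (lB i (ltn_ord i))))).
  apply: (h f) => [i|i j]; first exact: set_valP.
  move=> /val_inj; move/('inj_g (in_setT _) (in_setT _)) => /(congr1 val) /= ij.
  exact: val_inj.
have [/finite_setP[m /card_eqPle[Am mA]]|/infiniteP nA] := pselect (finite_set A).
  have [ml|lm] := leqP m l.
    apply: (card_le_trans Am); apply: subset_card_le => i /= im.
    exact: leq_trans im ml.
  by case: (mk `I_m) => // i /= il; exact: leq_trans il lm.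
by case: (mk [set: nat]).
Qed.

(** Finitely many distinct sets are told apart by finitely many points. *)
Lemma at_most_separate (Z : Type) l (A : set (set Z)) :
  (forall n (z : 'I_n -> Z),
    at_most l ((fun W : set Z => [ffun k => `[< W (z k) >]]) @` A)) ->
  at_most l A.
Proof.
move=> h f fA finj.
pose I := {ij : 'I_l.+1 * 'I_l.+1 | ij.1 != ij.2}.
have sep (ij : I) : exists z, ~ (f (val ij).1 z <-> f (val ij).2 z).
  case: ij => -[i j] /= /eqP ij; apply: contrapT => /forallNP nsep; apply: ij.
  by apply: finj; apply/seteqP; split=> z; have /contrapT[] := nsep z.
pose z (k : 'I_#|{: I}|) := projT1 (cid (sep (enum_val k))).
apply: (h _ z (fun i => [ffun k => `[< f i (z k) >]])) => [i|i j ij].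
  by exists (f i).
apply/eqP/negPn/negP => nij; pose ijI : I := exist _ (i, j) nij.
move/ffunP : ij => /(_ (enum_rank ijI)); rewrite !ffunE /z.
case: cid => y; rewrite enum_rankK /= => ny e; apply: ny.
by split=> /asboolP; [rewrite e|rewrite -e] => /asboolP.
Qed.

Section Colorings.
Context (G : groupType) (Y : gspace G).

Local Notation act := (gact Y).
Local Notation T := {ptws Y -> Y}.
Local Notation E := (ellis_semigroup act).

Definition color n (U : 'I_n -> set Y) (y : 'I_n -> Y) (p : Y -> Y) :
    {ffun 'I_n -> bool} :=
  [ffun i => `[< U i (p (y i)) >]].

Lemma color_nbhs n (U : 'I_n -> set Y) (y : 'I_n -> Y) (p : T) :
  (forall i, clopen (U i)) -> nbhs p [set q : T | color U y q = color U y p].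
Proof.
move=> Ucl.
have : nbhs p [set q : T | forall i, U i (q (y i)) <-> U i (p (y i))].
  apply: (@filter_forall _ _
      (fun i => [set q : T | U i (q (y i)) <-> U i (p (y i))]) (nbhs p)) => i.
  exact: (clopen_nbhs_eval p (y i) (Ucl i)).
apply: filterS => q qp; apply/ffunP => i; rewrite !ffunE.
by apply/asboolP/asboolP => /qp.
Qed.

(** The common form of the Ramsey hypotheses: on some translate [h A], the
    colouring that records at [g] which of the [y i] lie in [g (U i)] takes at
    most [l] values. Here [l] depends neither on the points nor on their
    number. *)
Definition few_colors (D : set (set Y)) (l : nat) : Prop :=
  forall n (U : 'I_n -> set Y) (y : 'I_n -> Y), (forall i, D (U i)) ->
    forall A : seq G, exists h,
      at_most l ((fun a => color U y (act (a^-1 * h^-1))) @` [set` A]).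

(** For [rho] in [L], a limit point [eta] of the elements [h^-1] that are good
    for the points [rho (y i)] and for larger and larger finite sets [A] yields
    at most [l] colours on [G eta rho], hence on its closure [E eta rho], which
    is [L] by minimality. *)
Lemma few_colors_ideal (D : set (set Y)) l (d : ellis_idempotent Y) :
  D `<=` clopen -> few_colors D l ->
  forall n (U : 'I_n -> set Y) (y : 'I_n -> Y), (forall i, D (U i)) ->
    at_most l (color U y @` ei_ideal d).
Proof.
move=> Dcl few n U y DU; have Ucl i := Dcl _ (DU i).
pose u := ei_fun d; pose z i := u (y i).
pose S (A : seq G) := (fun h => act h^-1 : T) @`
  [set h | at_most l ((fun a => color U z (act (a^-1 * h^-1))) @` [set` A])].
have PF : ProperFilter (filter_from setT S).
  apply: filter_from_proper; first apply: filter_from_filter.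
  - by exists [::].
  - move=> A B _ _; exists (A ++ B) => // _ [h hAB <-].
    by split; exists h => //; apply: at_mostS hAB => _ [a aA <-];
      exists a => //=; rewrite mem_cat aA ?orbT.
  - by move=> A _; have [h hA] := few n U z DU A; exists (act h^-1), h.
have [|eta [Eeta cleta]] := @ellis_compact _ Y _ PF _.
  by exists [::] => // _ [h _ <-]; exact: ellis_act.
move=> f fL finj.
have Leu : ei_ideal d (eta \o u).
  by apply: ei_ideal_comp => //; exact: ei_mem.
have fE i : exists a, f i = color U z (act a \o eta).
  have [p Lp <-] := fL i; move: Lp; rewrite (ei_idealE Leu) => -[q Eq <-].
  have := @color_nbhs n U (fun i => eta (z i)) q Ucl.
  move=> /(nbhs_closure Eq)[_ [a _ <-] /nbhs_singleton /= /ffunP ca].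
  by exists a; apply/ffunP => j; have := ca j; rewrite !ffunE => <-.
pose a i := projT1 (cid (fE i)).
have faE i : f i = color U z (act (a i) \o eta) by rewrite /a; case: cid.
have nW : nbhs eta [set q : T | forall i, color U z (act (a i) \o q) = f i].
  apply: (@filter_forall _ _
    (fun i => [set q : T | color U z (act (a i) \o q) = f i]) (nbhs eta)) => i.
  rewrite faE.
  apply: (continuous_nbhs (@comp_continuousl _ Y _ (@gact_continuous _ Y (a i)))
    (@color_nbhs n U z (act (a i) \o eta) Ucl)).
have [|_ [[h hA <-] hW]] := cleta (S [seq (a i)^-1 | i : 'I_l.+1]) _ _ nW.
  by exists [seq (a i)^-1 | i : 'I_l.+1].
apply: (hA f) => // i; exists (a i)^-1.
  by rewrite /=; exact: fintype.image_f.
by rewrite invgK -act_comp; exact: hW.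
Qed.

(** The bound is uniform in the points [y i], and finitely many of them suffice
    to distinguish [l.+1] preimages of [U]. *)
Lemma at_most_finite_colors (U : set Y) l (d : ellis_idempotent Y) :
  (forall n (y : 'I_n -> Y), at_most l (color (fun=> U) y @` ei_ideal d)) ->
  finite_colors d U.
Proof.
move=> h; have : at_most l ((fun p : T => p @^-1` U) @` ei_ideal d).
  apply: at_most_separate => n z; apply: at_mostS (h n z).
  by move=> _ [_ [p Lp <-] <-]; exists p => //; apply/ffunP => i; rewrite !ffunE.
by move/at_most_card_le => /card_le_finite; apply; exact: finite_II.
Qed.

End Colorings.

(** * Flows of automorphism groups *)

Lemma clopen_preimage (X Z : topologicalType) (f : X -> Z) (U : set Z) :
  continuous f -> clopen U -> clopen (f @^-1` U).
Proof.
move=> fc [Uo Uc]; split; first by move/continuousP : fc; exact.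
by move/continuous_closedP : fc; exact.
Qed.

Section FewColorsProduct.
Context (G : groupType) (S X : gspace G).

Lemma few_colors_fst (D : set (set S)) l : few_colors D l ->
  few_colors [set (fst @^-1` U : set (prod_gspace S X)) | U in D] l.
Proof.
move=> few n U y DU A.
pose V i := projT1 (cid2 (DU i)).
have DV i : D (V i) by rewrite /V; case: cid2.
have VU i : fst @^-1` (V i) = U i by rewrite /V; case: cid2.
have [h hA] := few n V (fun i => (y i).1) DV A; exists h.
have cE g : color U y (gact (prod_gspace S X) g) =
    color V (fun i => (y i).1) (gact S g).
  by apply/ffunP => i; rewrite !ffunE -VU.
by apply: at_mostS hA => _ [a aA <-]; exists a.
Qed.

End FewColorsProduct.

Section AutFlows.
Context (L : language) (M : structure L).
Local Notation G := (aut M).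
Implicit Types (g h v : G) (s : seq M).

(** [agree s g h] means that [g] and [h] lie in the same right coset of the
    pointwise stabilizer of [s]. *)
Definition agree s g h : Prop := forall a, a \in s -> aut_inv g a = aut_inv h a.

Definition stable s : set (set G) :=
  [set D | forall g h, agree s g h -> D g -> D h].

Lemma agree_sym s g h : agree s g h -> agree s h g.
Proof. by move=> gh a /gh. Qed.

Lemma aut_nbhs1 (A : set G) : nbhs (1 : G) A ->
  exists s, forall v, (forall a, a \in s -> v a = a) -> A v.
Proof.
pose F : set_system G := filter_from [set: seq M]
  (fun s => [set v : G | forall a, a \in s -> v a = a]).
have FF : Filter F.
  apply: filter_from_filter; first by exists [::].
  move=> s t _ _; exists (s ++ t) => // v vst.
  by split=> a ast; apply: vst; rewrite mem_cat ast ?orbT.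
have /[apply] : F --> (1 : G).
  apply/aut_cvgP => a; exists [:: a] => // v va.
  by apply: va; rewrite inE.
by move=> [s _ sA]; exists s => v /sA.
Qed.

Lemma agree_nbhs s g : nbhs g [set h | agree s h g].
Proof.
elim: s => [|a s IH]; first by apply: (@filterS _ (nbhs g) _ setT) => //; exact: filterT.
have na : nbhs g [set h | aut_inv h a = aut_inv g a].
  exact: (@invg_continuous _ g _ (aut_nbhs (g^-1) a)).
apply: filterS (filterI na IH) => h [/= ha hs] b.
by rewrite inE => /predU1P[->//|/hs].
Qed.

(** The neighbourhood [W] of [y] and the stabilizer [V] of [s] satisfy
    [V W] in [O]. *)
Lemma flow_stab_nbhs (X : flow G) (y : X) (O : set X) : nbhs y O ->
  exists s W, nbhs y W /\ forall x g h, agree s g h ->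
    W (flow_act g x) -> O (flow_act h x).
Proof.
move=> nO; have := @flow_continuous _ X (1, y) O.
rewrite /= flow_act1 => /(_ nO)[[A W] [/= nA nW] AWO].
have [s sA] := aut_nbhs1 nA; exists s, W; split=> // x g h gh Wgx.
have -> : flow_act h x = flow_act (h * g^-1) (flow_act g x).
  by rewrite -flow_actM mulgKV.
apply: (AWO (h * g^-1, flow_act g x)); split => //=.
by apply: sA => a /gh /= ->; rewrite aut_invK.
Qed.

(** The universality of an ambit, without reference to other ambits: every set
    that is invariant under an open subgroup is the trace of a set in [F] on the
    orbit of the base point. *)
Definition universal_base (S : gspace G) (s0 : S) (F : set (set S)) : Prop :=
  forall s D, stable s D -> exists U, F U /\ forall g, U (gact S g s0) <-> D g.

(** If [p x] and [q x] differ, they have disjoint neighbourhoods [A] and [B] and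
    there are a neighbourhood [W] of [p x] and an open subgroup [V] with [V W]
    in [A]. The set [D] of the [g] such that [v g x] is in [W] for some [v] in
    [V] is stable; it contains the [g] close to [p] and none of those close to
    [q], so its trace set tells the values at the base point apart. *)
Lemma universal_determined (X : flow G) (S : gspace G) (s0 : S)
    (F : set (set S)) :
  F `<=` clopen -> universal_base s0 F -> determined X s0 F.
Proof.
move=> Fcl univ p q x Ep Eq pq; apply: contrapT => pqx.
have [A [B [nA nB AB]]] : exists A B : set X,
    [/\ nbhs (snd_act s0 p x) A, nbhs (snd_act s0 q x) B & A `&` B = set0].
  apply: contrapT => h; apply: pqx; apply: flow_hausdorff => A B nA nB.
  by apply/set0P/eqP => AB; apply: h; exists A, B.
have [s [W [nW sW]]] := flow_stab_nbhs nA.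
pose D : set G := [set h | exists2 g, agree s g h & W (flow_act g x)].
have [|U [FU UD]] := univ s D.
  move=> g h gh [k kg Wk]; exists k => // a sa; rewrite kg//; exact: gh.
have Ucl : clopen (fst @^-1` U : set (prod_gspace S (flow_gspace X))).
  by apply: clopen_preimage (Fcl _ FU); exact: fst_continuous.
have Up : U (p (s0, x)).1.
  have n1 := continuous_nbhs (@snd_act_continuous _ _ _ s0 x) nW.
  have n2 := clopen_nbhs_eval p (s0, x) Ucl.
  have [_ [g _ <-] /nbhs_singleton[/= Wg <-]] := nbhs_closure Ep (filterI n1 n2).
  by apply/UD; exists g.
have Uq : U (q (s0, x)).1 by exact/pq.
have n1 := continuous_nbhs (@snd_act_continuous _ _ _ s0 x) nB.
have n2 := clopen_nbhs_eval q (s0, x) Ucl.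
have [_ [g _ <-] /nbhs_singleton[/= Bg Ug]] := nbhs_closure Eq (filterI n1 n2).
have /UD[h hg Wh] := Ug.2 Uq.
have Ag : A (flow_act g x) by exact: sW Wh.
by have : (A `&` B) (flow_act g x) by []; rewrite AB.
Qed.

Theorem distal_profinite_few_colors (S : gspace G) (s0 : S) (F : set (set S)) :
  F `<=` clopen -> universal_base s0 F ->
  (forall U, F U -> exists l, few_colors [set U] l) ->
  forall X : flow G, distal_flow X -> minimal_flow X -> profinite_flow X.
Proof.
move=> Fcl univ Ffew X Xdist Xmin.
have [d] := ellis_idempotent_exists (prod_gspace S (flow_gspace X)).
have Fcl' U : F U -> clopen (fst @^-1` U : set (prod_gspace S (flow_gspace X))).
  by move=> FU; apply: clopen_preimage (Fcl _ FU); exact: fst_continuous.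
apply: (@distal_profinite _ X S s0 F Xdist Xmin d) => // [U FU|]; last first.
  exact: universal_determined.
have [l few] := Ffew U FU.
apply: (@at_most_finite_colors _ _ _ l) => n y.
apply: (few_colors_ideal _ (few_colors_fst few)) => [_ [_ -> <-]|_].
  exact: Fcl'.
by exists U.
Qed.

End AutFlows.

(** * The flow of 0-1 functions on the stable sets *)

Section StableFlow.
Context (L : language) (M : structure L).
Local Notation G := (aut M).
Implicit Types (g h : G) (s : seq M).

Definition stable_sets : set (set G) := [set D | exists s, stable s D].

Definition translate g (D : set G) : set G := [set h | D (g * h)].

Lemma agree_mull g h k s :
  agree (map (aut_inv g) s) h k -> agree s (g * h) (g * k).
Proof. by move=> hk a sa; apply: hk; exact: map_f. Qed.

Lemma agree_mulr g h k s : agree s g h -> agree s (g * k) (h * k).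
Proof. by move=> gh a /gh /= ->. Qed.

Lemma translate_stable g (D : set G) : stable_sets D -> stable_sets (translate g D).
Proof.
move=> [s sD]; exists (map (aut_inv g) s) => h k hk; apply: sD.
exact: agree_mull.
Qed.

Lemma translate_agree s (D : set G) g h : stable s D -> agree s g h ->
  translate g D = translate h D.
Proof.
move=> sD gh; apply/seteqP; split=> k; apply: sD; apply: agree_mulr => //.
exact: agree_sym.
Qed.

Definition stable_set := set_type stable_sets.

Definition mk_stable (D : set G) (DP : stable_sets D) : stable_set := exist _ D (mem_set DP).

Lemma stable_setP (D : stable_set) : stable_sets (val D).
Proof. exact: set_valP. Qed.

Definition stable_translate g (D : stable_set) : stable_set :=
  mk_stable (translate_stable g (stable_setP D)).

Local Notation P := {ptws stable_set -> bool}.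

Definition stable_act g (p : P) : P := fun D => p (stable_translate g D).

Fact stable_act1 p : stable_act 1 p = p.
Proof.
apply/funext => D; congr p; apply: val_inj; apply/seteqP.
by split=> h /=; rewrite /translate /= mul1g.
Qed.

Fact stable_actM g h p : stable_act (g * h) p = stable_act g (stable_act h p).
Proof.
apply/funext => D; congr p; apply: val_inj; apply/seteqP.
by split=> k /=; rewrite /translate /= mulgA.
Qed.

Fact stable_act_continuous :
  continuous (fun p : G * P => stable_act p.1 p.2).
Proof.
apply: (@prod_continuous _ _ _ (fun p : G * P => stable_act p.1 p.2)).
move=> D [g p]; apply/discrete_cvg => /=.
have [s sD] := stable_setP D.
have np : nbhs p [set q : P | q (stable_translate g D) = p (stable_translate g D)].
  apply: (@continuous_nbhs _ _ (fun q : P => q (stable_translate g D)) p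
    [set p (stable_translate g D)]).
    exact: prod_eval_continuous.
  exact: discrete_set1.
exists ([set h | agree s h g],
    [set q : P | q (stable_translate g D) = p (stable_translate g D)]).
  by split; [exact: agree_nbhs|exact: np].
move=> [h q] [/= hg qp]; rewrite /= /stable_act -qp; congr q; apply: val_inj => /=.
exact: translate_agree hg.
Qed.

Fact stable_compact : compact [set: P].
Proof. by apply: ptws_compact; exact: bool_compact. Qed.

Fact stable_hausdorff : hausdorff_space P.
Proof. by apply: prod_hausdorff => D; exact: discrete_hausdorff. Qed.

(** The orbit closure of the point [stable_base] below is the universal ambit,
    the space of ultrafilters on the algebra of stable sets. The whole product
    is a flow as well and is easier to handle. *)
Definition stable_flow : flow G := @Flow G P stable_act stable_act1
  stable_actM stable_act_continuous stable_compact stable_hausdorff.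

Local Notation S := (flow_gspace stable_flow).

Definition stable_base : S := fun D => `[< val D 1 >].

Definition stable_clopen (D : stable_set) : set S := [set p | p D].

Lemma stable_clopenP D : clopen (stable_clopen D).
Proof.
have c := @prod_eval_continuous stable_set (fun=> bool) D.
have -> : stable_clopen D = (fun p : P => p D) @^-1` [set true].
  by apply/seteqP; split=> p.
by apply: clopen_preimage c _; split; [exact: discrete_open|exact: discrete_closed].
Qed.

Lemma stable_clopen_base g D : stable_clopen D (gact S g stable_base) <-> val D g.
Proof.
rewrite /stable_clopen /= /stable_act /stable_base /= /translate /= mulg1.
by split=> [/asboolP|/asboolP].
Qed.

Definition clopens_over s : set (set S) :=
  [set stable_clopen D | D in [set D | stable s (val D)]].

Lemma stable_universal : universal_base stable_base (range stable_clopen).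
Proof.
move=> s D sD; exists (stable_clopen (mk_stable (ex_intro _ s sD))).
split; first by eexists.
by move=> g; rewrite stable_clopen_base.
Qed.

(** A colouring of [G] by sets stable under the stabilizer of [s] depends on [g]
    only through the tuple [g s], so it is a colouring of the copies of [s]. The
    degree of [s] bounds it whatever the number of sets. *)
Lemma ERdeg_few_colors s : sep_fin_ERdeg M ->
  exists k, few_colors (clopens_over s) k.
Proof.
move=> er; have [k kP] := er (size s) (tnth (in_tuple s)); exists k.
move=> n U y DU A.
pose D i := projT1 (cid2 (DU i)).
have sD i : stable s (val (D i)) by rewrite /D; case: cid2.
have UE i : stable_clopen (D i) = U i by rewrite /D; case: cid2.
pose a := tnth (in_tuple s).
pose c g := color U y (gact S g^-1).
have cE g h : g \o a = h \o a -> c g = c h.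
  move=> gh; have gh' : agree s (g^-1) (h^-1).
    move=> b /(nthP b)[i si <-]; have := congr1 (fun f => f (Ordinal si)) gh.
    by rewrite /= /a (tnth_nth b).
  apply/ffunP => i; rewrite !ffunE -UE /stable_clopen /= /stable_act.
  suff -> : stable_translate g^-1 (D i) = stable_translate h^-1 (D i) by [].
  by apply: val_inj; exact: translate_agree gh'.
pose F := {ffun 'I_n -> bool}.
pose C (x : 'I_(size s) -> M) : nat :=
  if pselect (exists g : G, x = g \o a) is left h then enum_rank (c (projT1 (cid h)))
  else 0%N.
have CE (g : G) : C (g \o a) = enum_rank (c g).
  rewrite /C; case: pselect => [h|]; last by case; exists g.
  by case: cid => h' /= /cE ->.
pose B := s ++ flatten [seq map g s | g <- A].
have [||Cs [Csfin BCs /(_ C)]] := kP [set` B] #|{: F}|.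
- exact: finite_seq.
- by move=> _ [i _ <-]; rewrite /= mem_cat /a mem_tnth.
case=> [x [_ [g ->]]|_ [_ [f ->]] /card_le_at_most fk].
  by rewrite CE ltn_ord.
exists f => w wA winj.
apply: (fk (fun i => enum_rank (w i) : nat)) => [i|i j /val_inj/enum_rank_inj/winj//].
have [g Ag <-] := wA i.
exists ((f * g) \o a); last by rewrite CE /c invgM.
split; last by exists (f * g).
move=> _ [j _ <-] /=; exists (g (a j)) => //=.
rewrite mem_cat; apply/orP; right; apply/flattenP; exists (map g s).
  by apply: map_f.
by apply: map_f; rewrite /a mem_tnth.
Qed.

Lemma ERdeg_distal_profinite : sep_fin_ERdeg M ->
  forall X : flow G, distal_flow X -> minimal_flow X -> profinite_flow X.
Proof.
move=> er; apply: (distal_profinite_few_colors _ stable_universal).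
  by move=> _ [D _ <-]; exact: stable_clopenP.
move=> _ [D _ <-]; have [s sD] := stable_setP D.
have [k few] := ERdeg_few_colors s er; exists k => n U y UD; apply: few => i.
by exists D => //; rewrite UD.
Qed.

End StableFlow.

(** * Finite supports of formulas *)

Section Support.
Context (C : sort -> Type).
Local Notation form := (form C).

(** A finite context on top of [V], innermost variable first, in the shape
    produced by iterated quantifiers. *)
Fixpoint ctx (V : sort -> Type) (ss : seq sort) : sort -> Type :=
  if ss is s :: ss' then extv (ctx V ss') s else V.

Fixpoint ctxval (N : sort -> Type) (V : sort -> Type) (v : forall s, V s -> N s)
    (ss : seq sort) : hprod N ss -> forall s, ctx V ss s -> N s :=
  if ss is s :: ss' return hprod N ss -> forall s, ctx V ss s -> N s
  then fun y => extval (ctxval v y.2) y.1 else fun _ => v.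

Fixpoint ctxvars (V : sort -> Type) (ss : seq sort) : hprod (ctx V ss) ss :=
  if ss is s :: ss' return hprod (ctx V ss) ss
  then (inr erefl, hmap (fun _ x => inl x) (ctxvars V ss')) else tt.

Lemma hmap_ctxvars (N V : sort -> Type) (v : forall s, V s -> N s) ss
    (y : hprod N ss) : hmap (ctxval v y) (ctxvars V ss) = y.
Proof.
elim: ss y => [|s ss IH] /= y; first by case: y.
by case: y => y0 y /=; rewrite hmap_comp /=; congr (_, _); exact: IH.
Qed.

Definition novar (s : sort) : Type := void.

Definition noval (N : sort -> Type) (s : sort) (x : novar s) : N s :=
  match x with end.

Fixpoint hcat (N : sort -> Type) ss1 ss2 :
    hprod N ss1 -> hprod N ss2 -> hprod N (ss1 ++ ss2) :=
  if ss1 is s :: ss1' return hprod N ss1 -> hprod N ss2 -> hprod N (ss1 ++ ss2)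
  then fun x y => (x.1, hcat x.2 y) else fun _ y => y.

Lemma hmap_hcat (N N' : sort -> Type) (f : forall s, N s -> N' s) ss1 ss2
    (x : hprod N ss1) (y : hprod N ss2) :
  hmap f (hcat x y) = hcat (hmap f x) (hmap f y).
Proof. by elim: ss1 x => //= s ss1 IH [x0 x] /=; rewrite IH. Qed.

Fixpoint ctxl V ss1 ss2 s : ctx V ss1 s -> ctx V (ss1 ++ ss2) s :=
  if ss1 is s1 :: ss1' return ctx V ss1 s -> ctx V (ss1 ++ ss2) s
  then fun x => match x with inl y => inl (@ctxl V ss1' ss2 s y) | inr e => inr e end
  else fun x => (fix up ss := if ss is _ :: ss' return ctx V ss s
                              then inl (up ss') else x) ss2.

Fixpoint ctxr V ss1 ss2 s : ctx V ss2 s -> ctx V (ss1 ++ ss2) s :=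
  if ss1 is s1 :: ss1' return ctx V ss2 s -> ctx V (ss1 ++ ss2) s
  then fun x => inl (@ctxr V ss1' ss2 s x) else id.

Lemma ctxval_l (N V : sort -> Type) (v : forall s, V s -> N s) ss1 ss2
    (x : hprod N ss1) (y : hprod N ss2) s (i : ctx V ss1 s) :
  ctxval v (hcat x y) (ctxl ss2 i) = ctxval v x i.
Proof.
elim: ss1 x i => [|s1 ss1 IH] /= x i; last by case: i => //= i; exact: IH.
by elim: ss2 y => //= s2 ss2 IH [y0 y]; exact: IH.
Qed.

Lemma ctxval_r (N V : sort -> Type) (v : forall s, V s -> N s) ss1 ss2
    (x : hprod N ss1) (y : hprod N ss2) s (i : ctx V ss2 s) :
  ctxval v (hcat x y) (ctxr ss1 i) = ctxval v y i.
Proof. by elim: ss1 x => //= s1 ss1 IH [x0 x]; exact: IH. Qed.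

(** Separates the occurrences of the last variable of [extv V s0] in a list of
    variables from those of the variables of [V]. *)
Lemma strip_var (V : sort -> Type) s0 ss (z : hprod (extv V s0) ss) :
  exists ss' (z' : hprod V ss')
      (i : forall s, ctx novar ss s -> extv (ctx novar ss') s0 s),
    forall (N : sort -> Type) (v : forall s, V s -> N s) (b : N s0) s
        (x : ctx novar ss s),
      ctxval (@noval N) (hmap (extval v b) z) x =
      extval (ctxval (@noval N) (hmap v z')) b (i s x).
Proof.
elim: ss z => [|s1 ss IH] /=; first by move=> _; exists [::], tt, (fun s x => inl x).
move=> [z0 z]; have [ss' [z' [i iP]]] := IH z.
case: z0 => [w|e].
  exists (s1 :: ss'), (w, z'), (fun s x => match x with
    | inl y => match i s y with inl j => inl (inl j) | inr e => inr e end
    | inr e => inl (inr e) end) => N v b s [y|e] /=.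
    by rewrite iP; case: (i s y).
  by case: s / e.
case: s1 / e; exists ss', z', (fun s x => match x with
  | inl y => i s y | inr e => inr e end) => N v b s [y|e] /=; first exact: iP.
by case: s / e.
Qed.

Lemma valuation_ext (N V : sort -> Type) (v w : forall s, V s -> N s) :
  (forall s x, v s x = w s x) -> v = w.
Proof.
by move=> vw; apply: functional_extensionality_dep => s; exact/funext.
Qed.

(** A formula in infinitely many variables is equivalent, uniformly in all
    structures, to one in a finite context evaluated at a list of variables. *)
Lemma finite_support (V : sort -> Type) (p : form V) :
  exists ss (z : hprod V ss) (q : form (ctx novar ss)),
    forall (N : fullstr C) (v : forall s, V s -> N s),
      sat p v <-> sat q (ctxval (@noval N) (hmap v z)).
Proof.
elim: p => {V} [V ss R x|V s x y|V|V p [ss1 [z1 [q1 h1]]] q [ss2 [z2 [q2 h2]]]|V s p].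
- exists ss, x, (Pred R (ctxvars novar ss)) => N v /=.
  by rewrite hmap_ctxvars.
- by exists [:: s; s], (x, (y, tt)), (Equal C (inr erefl) (inl (inr erefl))).
- by exists [::], tt, (Bot C (ctx novar [::])).
- exists (ss1 ++ ss2), (hcat z1 z2),
    (Imp (rename (@ctxl novar ss1 ss2) q1) (rename (@ctxr novar ss1 ss2) q2)) => N v /=.
  rewrite !sat_rename hmap_hcat h1 h2.
  suff [-> ->] : (fun s x => ctxval (@noval N) (hcat (hmap v z1) (hmap v z2)) (ctxl ss2 x))
      = ctxval (@noval N) (hmap v z1) /\
    (fun s x => ctxval (@noval N) (hcat (hmap v z1) (hmap v z2)) (ctxr ss1 x))
      = ctxval (@noval N) (hmap v z2) by [].
  by split; apply: valuation_ext => r i; [exact: ctxval_l|exact: ctxval_r].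
- move=> [ss [z [q h]]]; have [ss' [z' [i iP]]] := strip_var z.
  exists ss', z', (All (rename i q)) => N v /=.
  split=> k b; have := k b; rewrite sat_rename h.
    by congr sat; apply: valuation_ext => r x; rewrite iP.
  by congr sat; apply: valuation_ext => r x; rewrite iP.
Qed.

End Support.

(** * The type space of the enumeration of the structure *)

Section Evaluation.
Context (L : language) (M : structure L).
Local Notation C := (sorts M).
Local Notation form := (form C).
Local Notation mvar := (mvar M).
Local Notation V0 := (extv C SG).

Fixpoint ctxlift (V : sort -> Type) ss s (x : V s) : ctx V ss s :=
  if ss is _ :: ss' return ctx V ss s then inl (ctxlift ss' x) else x.

Fixpoint ctxmap (V W : sort -> Type) (f : forall s, V s -> W s) ss :
    forall s, ctx V ss s -> ctx W ss s :=
  if ss is s1 :: ss' return forall s, ctx V ss s -> ctx W ss s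
  then fun s x => match x with inl y => inl (ctxmap f y) | inr e => inr e end
  else f.

Lemma ctxval_lift (N V : sort -> Type) (v : forall s, V s -> N s) ss
    (y : hprod N ss) s (x : V s) : ctxval v y (ctxlift ss x) = v s x.
Proof. by elim: ss y => //= s1 ss IH [y0 y]; exact: IH. Qed.

Lemma ctxval_map (N V W : sort -> Type) (f : forall s, V s -> W s)
    (v : forall s, W s -> N s) ss (y : hprod N ss) s (x : ctx V ss s) :
  ctxval v y (ctxmap f x) = ctxval (fun s x => v s (f s x)) y x.
Proof. by elim: ss y x => //= s1 ss IH [y0 y] [x|e] //=; exact: IH. Qed.

(** The last variable of [V0] names an element of [G] and the others name the
    elements of the structure; the formula says that the innermost variable is
    the image of [x] under that element. *)
Definition eval_at ss s : mvar s -> form (extv (ctx V0 ss) s) :=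
  match s return mvar s -> form (extv (ctx V0 ss) s) with
  | SG => fun x => match x with end
  | SM => fun m => Pred (eval_graph (M := M))
      (inl (ctxlift ss (inr erefl : V0 SG)),
       (inl (ctxlift ss (inl (m : C SM) : V0 SM)), (inr erefl, tt)))
  end.

Fixpoint eval_close ss : hprod mvar ss -> form (ctx V0 ss) -> form V0 :=
  if ss is s :: ss' return hprod mvar ss -> form (ctx V0 ss) -> form V0
  then fun z q => eval_close z.2 (All (Imp (@eval_at ss' s z.1) q))
  else fun _ q => q.

Definition evaluates (N : fullstr C) (v : forall s, V0 s -> N s) s :
    mvar s -> N s -> Prop :=
  match s return mvar s -> N s -> Prop with
  | SG => fun x => match x with end
  | SM => fun m b => pint N (eval_graph (M := M))
      (v SG (inr erefl), (v SM (inl (m : C SM)), (b, tt)))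
  end.

Fixpoint evaluates_all (N : fullstr C) (v : forall s, V0 s -> N s) ss :
    hprod mvar ss -> hprod N ss -> Prop :=
  if ss is s :: ss' return hprod mvar ss -> hprod N ss -> Prop
  then fun z y => evaluates v z.1 y.1 /\ evaluates_all v z.2 y.2
  else fun _ _ => True.

Lemma sat_eval_at (N : fullstr C) (v : forall s, V0 s -> N s) ss
    (y : hprod N ss) s (x : mvar s) (b : N s) :
  sat (eval_at ss x) (extval (ctxval v y) b) <-> evaluates v x b.
Proof. by case: s x b => //= m b; rewrite !ctxval_lift. Qed.

Lemma sat_eval_close (N : fullstr C) (v : forall s, V0 s -> N s) ss
    (z : hprod mvar ss) (q : form (ctx V0 ss)) :
  sat (eval_close z q) v <->
  forall y, evaluates_all v z y -> sat q (ctxval v y).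
Proof.
elim: ss z q => [|s ss IH] /= z q; first by split=> [h [] _|]; [|apply].
rewrite IH; split=> h.
  by move=> [b y] /= [zb zy]; apply: (h y zy b); exact/sat_eval_at.
by move=> y zy b /= /sat_eval_at zb; exact: (h (b, y)).
Qed.

Context (N : monster_model C).

(** Available as a predicate because the language is full. *)
Definition truth_set (p : form mvar) : set (hprod C [:: SG]) :=
  [set x : hprod C [:: SG] | sat (N := base C) p (@mval _ M C (aut_fun x.1))].

Definition truth_pred (p : form mvar) : form V0 :=
  Pred (truth_set p) (inr erefl : V0 SG, tt).

Let elem (p : form C) : sat (N := base C) p (fun _ x => x) -> sat p (@emb _ N).
Proof. by move/(emb_elementary N). Qed.

Lemma eval_base (g : aut M) ss (z : hprod mvar ss) (y : hprod C ss) :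
  evaluates_all (N := base C) (extval (fun _ x => x) (g : C SG)) z y ->
  y = hmap (@mval _ M C (g : M -> M)) z.
Proof.
elim: ss z y => [|[] ss IH] /=; first by move=> [] [].
  by move=> [[]].
by move=> [m z] [b y] /= [<- /IH ->].
Qed.

Lemma eval_star (sigma : N SG) (f : M -> N SM) ss (z : hprod mvar ss) :
  star_image sigma f ->
  evaluates_all (extval (@emb _ N) sigma) z (hmap (mval f) z).
Proof.
move=> sf; elim: ss z => [//|[] ss IH] /= z; first by case: z => [[]].
by split; [exact: sf|exact: IH].
Qed.

Lemma ctxval_novar (K : sort -> Type) (v : forall s, V0 s -> K s) ss
    (y : hprod K ss) :
  (fun s x => ctxval v y (ctxmap (@noval V0) (ss := ss) (s := s) x)) =
  ctxval (@noval K) y.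
Proof.
apply: valuation_ext => s x; rewrite ctxval_map.
by have -> : (fun s x => v s (@noval V0 s x)) = @noval K by apply: valuation_ext => r [].
Qed.

(** The formula [p] has a finite support [z], so that the implication is one
    sentence: for all [g] in [truth_set p] and all [y] with [y = g z], the
    finite-context form of [p] holds at [y]. It is true in the base structure,
    hence in [N]. *)
Lemma star_sat1 (p : form mvar) (sigma : N SG) (f : M -> N SM) :
  star_image sigma f ->
  sat (truth_pred p) (extval (@emb _ N) sigma) -> sat p (mval f).
Proof.
move=> sf pN; have [ss [z [q h]]] := finite_support p.
pose th : form (ctx V0 ss) :=
  Imp (rename (@ctxlift V0 ss) (truth_pred p)) (rename (ctxmap (@noval V0) (ss := ss)) q).
have /elem /= /(_ sigma)/sat_eval_close : sat (N := base C)
    (All (eval_close z th)) (fun _ x => x).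
  move=> g; apply/sat_eval_close => y /eval_base -> /=.
  rewrite ctxval_lift sat_rename ctxval_novar; exact: (h (base C) _).1.
move=> /(_ _ (eval_star z sf)) /=.
by rewrite sat_rename ctxval_lift ctxval_novar => /(_ pN) /h.
Qed.

(** Hence the truth of a formula at the enumeration [sigma(m)] depends on
    [sigma] only through one unary predicate. *)
Lemma star_sat (p : form mvar) (sigma : N SG) (f : M -> N SM) :
  star_image sigma f ->
  sat (truth_pred p) (extval (@emb _ N) sigma) <-> sat p (mval f).
Proof.
move=> sf; split; first exact: star_sat1.
move=> fp; apply: contrapT => np.
suff /star_sat1/(_ fp) : sat (truth_pred (Imp p (Bot C mvar))) (extval (@emb _ N) sigma).
  by apply.
pose A : form V0 := truth_pred p; pose B : form V0 := truth_pred (Imp p (Bot C mvar)).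
have /elem /(_ sigma) : sat (N := base C)
    (All (Imp (Imp A (Bot C V0)) B)) (fun _ x => x).
  by move=> g nA pg; apply: nA.
by apply; exact: np.
Qed.

End Evaluation.

Section SigmaSpace.
Context (L : language) (M : structure L) (N : monster_model (sorts M)).
Local Notation C := (sorts M).
Local Notation form := (form C).
Local Notation mvar := (mvar M).
Local Notation V0 := (extv C SG).
Local Notation X := (Sigma N).
Implicit Types (p q : X) (phi : form mvar).

Definition form_not (V : sort -> Type) (phi : Defs.form C V) : Defs.form C V :=
  Imp phi (Bot C V).

Definition form_and (V : sort -> Type) (phi psi : Defs.form C V) : Defs.form C V :=
  form_not (Imp phi (form_not psi)).

Lemma sat_form_and (K : fullstr C) V (phi psi : Defs.form C V) (v : forall s, V s -> K s) :
  sat (form_and phi psi) v <-> sat phi v /\ sat psi v.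
Proof.
split=> [/= h|[? ?] h]; last exact: h.
by split; apply: contrapT => n; apply: h => // ? ?; apply: n.
Qed.

Lemma Sigma_ext p q : sigma_tp p = sigma_tp q -> p = q.
Proof.
case: p q => [p pP] [q qP] /= pq; move: pP qP; rewrite pq => pP qP.
by congr MkSigma; exact: Prop_irrelevance.
Qed.

Lemma SigmaP p : exists sigma f,
  star_image (N := N) sigma f /\ forall phi, sigma_tp p phi <-> sat phi (mval f).
Proof.
by have [sigma [f [sf pE]]] := sigma_tpP p; exists sigma, f; split => // phi; rewrite pE.
Qed.

Lemma Sigma_neg p phi : sigma_tp p (form_not phi) <-> ~ sigma_tp p phi.
Proof. by have [sigma [f [_ pE]]] := SigmaP p; rewrite !pE. Qed.

Lemma Sigma_conj p phi psi :
  sigma_tp p (form_and phi psi) <-> sigma_tp p phi /\ sigma_tp p psi.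
Proof. by have [sigma [f [_ pE]]] := SigmaP p; rewrite !pE sat_form_and. Qed.

Definition Sigma_basic phi : set X := [set p | sigma_tp p phi].

Lemma Sigma_basic_open phi : open (Sigma_basic phi).
Proof.
exists [set Sigma_basic phi]; last by rewrite bigcup_set1.
move=> _ ->; apply: (@finI_from1 _ _ _ id); by exists phi.
Qed.

Lemma Sigma_basic_clopen phi : clopen (Sigma_basic phi).
Proof.
split; first exact: Sigma_basic_open.
have -> : Sigma_basic phi = ~` Sigma_basic (form_not phi).
  apply/seteqP; split=> p /=; rewrite /Sigma_basic /= Sigma_neg.
    by move=> ? h; apply: h.
  exact: contrapT.
exact/open_closedC/Sigma_basic_open.
Qed.

(** The sets [phi] form a basis since formulas are closed under conjunction. *)
Lemma Sigma_nbhs p (A : set X) : nbhs p A ->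
  exists phi, sigma_tp p phi /\ Sigma_basic phi `<=` A.
Proof.
move=> [_ [[Q QfinP <-] [V QV Vp]] VA].
have [D DS VE] := QfinP _ QV.
pose l : seq (set X) := finmap.enum_fset D.
have lP W : W \in l -> W p /\ exists psi, W = Sigma_basic psi.
  move=> WD; split; first by move: Vp; rewrite -VE => /(_ W WD).
  by have /set_mem[psi _ <-] := DS _ WD; exists psi.
have lV q : (forall W, W \in l -> W q) -> V q by move=> lq; rewrite -VE => W /lq.
suff [phi [pphi phiD]] : exists phi, sigma_tp p phi /\
    forall W, W \in l -> Sigma_basic phi `<=` W.
  exists phi; split => // q qphi; apply: VA; exists V => //.
  by apply: lV => W /phiD; apply.
elim: l lP {lV} => [_|W l IH lP].
  by exists (form_not (Bot C mvar)); split => //; rewrite Sigma_neg;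
    have [sigma [f [_ pE]]] := SigmaP p; rewrite pE.
have [|phi [pphi phil]] := IH; first by move=> W' W'l; apply: lP; rewrite inE W'l orbT.
have [Wp [psi Wpsi]] : W p /\ exists psi, W = Sigma_basic psi.
  by apply: lP; rewrite inE eqxx.
exists (form_and psi phi); split; first by rewrite Sigma_conj; split => //; rewrite Wpsi in Wp.
move=> W'; rewrite inE => /predU1P[->|W'l] q /Sigma_conj[qpsi qphi]; first by rewrite Wpsi.
exact: phil W'l q qphi.
Qed.

Lemma Sigma_hausdorff : hausdorff_space X.
Proof.
move=> p q pq; apply: Sigma_ext.
have sub (p' q' : X) : cluster (nbhs p') q' -> sigma_tp p' `<=` sigma_tp q'.
  move=> cl phi pphi; apply: contrapT => /Sigma_neg qn.
  have [||r [/= r1 /Sigma_neg r2]] := cl (Sigma_basic phi) (Sigma_basic (form_not phi)).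
  - by apply: open_nbhs_nbhs; split=> //; exact: Sigma_basic_open.
  - by apply: open_nbhs_nbhs; split=> //; exact: Sigma_basic_open.
  exact: r2.
apply/seteqP; split; first exact: sub.
apply: sub => A B nA nB; have [r [Br Ar]] := pq _ _ nB nA.
by exists r.
Qed.

(** Each sort injects into the set of formulas by [x |-> (x = x)]. *)
Lemma smaller_sorts (K : Type) : ~ ([set: K] #<= [set: Defs.form C C]) ->
  smaller C K.
Proof.
move=> nK s Ks; apply: nK; apply: (card_le_trans Ks).
have c0 : Defs.form C C by exact: Bot.
pose Fp : pointedType := HB.pack_for pointedType {classic Defs.form C C}
  (isPointed.Build {classic Defs.form C C} c0).
apply/(@pcard_leP _ Fp [set: C s] [set: Fp])/injfunPex.
exists (fun x : C s => Equal C x x) => // x y _ _ E.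
pose arg (q : Defs.form C C) : C s :=
  if q is Equal r a _ then
    if pselect (r = s) is left e then eq_rect r C a s e else x
  else x.
have := congr1 arg E; rewrite /arg; case: pselect => // e.
by rewrite (Prop_irrelevance e erefl).
Qed.

(** Let [q] be the limit of an ultrafilter on the type space. By [star_sat] it
    is a set of conditions on [sigma], finitely satisfiable by elements of the
    type space. Saturation, with the elements of both base sorts as parameters,
    gives [sigma], whose values on [M] exist by elementarity. *)
Lemma Sigma_compact : compact [set: X].
Proof.
rewrite compact_ultra => F FU _.
have FP : ProperFilter F by exact: ultra_proper.
pose q : set (form mvar) := [set phi | F (Sigma_basic phi)].
have qneg phi : q phi \/ q (form_not phi).
  have [h|h] := in_ultra_setVsetC (Sigma_basic phi) FU; [by left|right].
  by apply: (@filterS _ F _ _ _ _ h) => p /=; rewrite /Sigma_basic /= Sigma_neg.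
have [K [Kbig Ksat _]] := monster_big N.
have [|sigma sP] := Ksat C (@emb _ N) SG [set truth_pred phi | phi in q]
    (smaller_sorts Kbig).
  move=> Q /(@finite_seqP {classic Defs.form C V0})[l ->] lq.
  have [p pl] : exists p : X, forall psi, psi \in l ->
      exists phi, psi = truth_pred phi /\ sigma_tp p phi.
    have /filter_ex[p pl] : F [set p | forall psi : {classic Defs.form C V0}, psi \in l ->
        exists phi, psi = truth_pred phi /\ sigma_tp p phi].
      elim: l lq => [_|psi l IH lq].
        by apply: (@filterS _ F _ setT) => //; exact: filterT.
      have [|phi qphi phiE] := lq psi; first by rewrite /= inE eqxx.
      have Fl := IH (fun psi' pl => lq psi' (mem_behead (s := psi :: l) pl)).
      apply: (@filterS _ F _ _ _ _ (filterI qphi Fl)) => p /= [pphi pl] psi'.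
      rewrite inE => /predU1P[->|/pl//].
      by exists phi.
    by exists p.
  have [sigma [f [sf pE]]] := SigmaP p; exists sigma => psi /pl[phi [-> /pE fphi]].
  exact/(star_sat phi sf).
have [f sf] : exists f, star_image (N := N) sigma f.
  suff /choice[f sf] : forall m : M, exists b, pint N (@eval_graph L M)
      (sigma, (emb N (s := SM) m, (b, tt))) by exists f.
  move=> m.
  pose r : Defs.form C C := @All C _ SG (form_not (@All C _ SM (form_not
    (Pred (@eval_graph L M) (inl (inr erefl), (inl (inl (m : C SM)), (inr erefl, tt))))))).
  have /(emb_elementary N) /= /(_ sigma) : sat (N := base C) r (fun _ x => x).
    by move=> g /= /(_ ((g : aut M) m)); apply.
  by move=> h; apply: contrapT => /forallNP nb; exact: h.
have fq phi : q phi -> sat phi (mval f).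
  move=> qphi; apply/(star_sat phi sf); apply: (sP (truth_pred phi)).
  by exists phi.
pose p : X := MkSigma (ex_intro _ sigma (ex_intro _ f (conj sf erefl))).
exists p; split => // A /Sigma_nbhs[phi [pphi phiA]].
apply: (@filterS _ F _ _ _ phiA).
by have [//|/fq nphi] := qneg phi; case: (nphi pphi).
Qed.

(** ** The action *)

Local Notation G := (aut M).
Local Notation act := (@sigma_act L M N).

Lemma sigma_actE (g : G) p (f : M -> N SM) :
  sigma_tp p = tp (mval f) -> sigma_tp (act g p) = tp (mval (f \o (g^-1)%g)).
Proof. exact: sigma_act_tpE. Qed.

Fact sigma_act1 p : act 1 p = p.
Proof.
have [sigma [f [sf pE]]] := sigma_tpP p.
by apply: Sigma_ext; rewrite (sigma_actE _ pE) pE.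
Qed.

Fact sigma_actM (g h : G) p : act (g * h) p = act g (act h p).
Proof.
have [sigma [f [sf pE]]] := sigma_tpP p.
by apply: Sigma_ext; rewrite (sigma_actE _ (sigma_actE _ pE)) (sigma_actE _ pE) invgM.
Qed.

Fact sigma_act_continuous (g : G) : continuous (act g).
Proof.
move=> p A /Sigma_nbhs[phi [pphi phiA]].
apply: (@filterS _ (nbhs p) _ _ _ (preimage_subset phiA)).
by apply: open_nbhs_nbhs; split;
  [exact: (Sigma_basic_open (rename (mperm g^-1) phi))|].
Qed.

Definition sigma_gspace : gspace G := @Gspace G X act sigma_act1 sigma_actM
  sigma_act_continuous Sigma_compact Sigma_hausdorff.

Lemma Sigma_separated p q :
  (forall U : set X, clopen U -> U p <-> U q) -> p = q.
Proof.
move=> pq; apply: Sigma_ext; apply/seteqP.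
by split=> phi h; [apply/(pq _ (Sigma_basic_clopen phi)).1
  |apply/(pq _ (Sigma_basic_clopen phi)).2].
Qed.

Fact sigma_base_proof : Sigma_set N (tp (mval (fun m : M => emb N (s := SM) m))).
Proof.
exists (emb N (s := SG) (1 : G)), (fun m : M => emb N (s := SM) m); split=> // m.
pose q : Defs.form C C :=
  Pred (@eval_graph L M) ((1 : G) : C SG, (m : C SM, (m : C SM, tt))).
by have /(emb_elementary N) : sat (N := base C) q (fun _ x => x) by [].
Qed.

(** The type of the enumeration of the structure itself, as the image under the
    identity. *)
Definition sigma_base : X := MkSigma sigma_base_proof.

Fixpoint mvars (s : seq M) : hprod mvar [seq SM | _ <- s] :=
  if s is m :: s' then (m, mvars s') else tt.

Lemma mvars_agree (s : seq M) (g h : M -> M) :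
  hmap (@mval _ M C g) (mvars s) = hmap (@mval _ M C h) (mvars s) ->
  forall a, a \in s -> g a = h a.
Proof.
elim: s => [//|m s IH] /= [gm /IH gh] a.
by rewrite inE => /predU1P[->|/gh].
Qed.

(** A set [D] stable under the stabilizer of [s] consists of the [g] for which
    the tuple [g^-1 s] belongs to a certain relation [R], and [R] is a predicate
    of the full language. *)
Lemma sigma_universal : universal_base (S := sigma_gspace) sigma_base clopen.
Proof.
move=> s D sD.
pose R : set (hprod C [seq SM | _ <- s]) :=
  [set x | exists2 g : G, D g & x = hmap (@mval _ M C (aut_inv g)) (mvars s)].
pose phi : form mvar := Pred R (mvars s).
exists (Sigma_basic phi); split; first exact: Sigma_basic_clopen.
move=> g; change (sigma_tp (act g sigma_base) phi <-> D g).
rewrite (@sigma_actE g sigma_base (fun m : M => emb N (s := SM) m) erefl).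
have -> : tp (mval ((fun m : M => emb N (s := SM) m) \o (g^-1)%g)) phi <->
    sat (N := base C) phi (@mval _ M C (aut_inv g)).
  rewrite (emb_elementary N) /tp /=.
  suff -> : mval ((fun m : M => emb N (s := SM) m) \o (g^-1)%g) =
    (fun s x => emb N (@mval _ M C (aut_inv g) s x)) by [].
  by apply: valuation_ext => -[].
split=> [[h Dh /mvars_agree gh]|Dg]; last by exists g.
by apply: sD Dh => a /gh /= ->.
Qed.

(** The case distinctions remove the empty set and the empty list of points,
    which the definition of the degree excludes. *)
Lemma EDRdeg_few_colors (U : set X) : sep_fin_EDRdeg act -> clopen U ->
  exists l, few_colors (Y := sigma_gspace) [set U] l.
Proof.
move=> edr Ucl; have [|_ ->//|l l0 lP] := edr [set U]; first exact: finite_set1.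
exists l => n V y VU A.
have [AE|A0] := eqVneq A [::].
  by exists 1 => f fA; have [a] := fA ord0; rewrite AE.
have [n0|n0] := posnP n.
  exists 1 => f _ finj; suff /finj/(congr1 val)/= : f ord0 = f ord_max.
    by move=> E; have E' : 0%N = l := E; rewrite -E' in l0.
  by apply/ffunP => i; have := ltn_ord i; rewrite {2}n0.
pose c (g : G) := color (Y := sigma_gspace) V y (act g^-1).
have cE : ext_definable_coloring act [set U] c.
  exists V, y; split=> // g i; rewrite ffunE; split.
    move=> /asboolP Uy; exists (act g^-1 (y i)) => //.
    by rewrite -sigma_actM mulgV sigma_act1.
  by move=> [x Vx <-]; apply/asboolP; rewrite -sigma_actM mulVg sigma_act1.
have /finite_setP[k Ak] : finite_set [set` A] by apply/finite_seqP; exists A.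
have k0 : (0 < k)%N.
  case: k Ak => //; rewrite II0 card_eq0 => /eqP AE.
  have [a aA] : exists a, a \in A by case: A A0 {AE} => // a A; exists a; rewrite inE eqxx.
  by have : [set` A] a by []; rewrite AE.
have [h] := lP n c n0 cE k [set` A] k0 Ak.
move=> /card_le_at_most hA; exists h; apply: at_mostS hA.
move=> _ [a aA <-]; exists (h * a); first by exists a.
by rewrite /c invgM.
Qed.

Theorem Sigma_profinite_ellis_group :
  sep_fin_EDRdeg act -> profinite_ellis_group act.
Proof.
move=> edr I u Imin Iu uu.
pose d : ellis_idempotent sigma_gspace :=
  @EllisIdempotent _ sigma_gspace I u Imin Iu uu.
apply: (@ellis_group_profinite _ sigma_gspace d clopen).
  move=> U Ucl; split => //; have [l few] := EDRdeg_few_colors edr Ucl.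
  apply: (@at_most_finite_colors _ _ _ l) => n y.
  by apply: (few_colors_ideal _ few) => [_ ->|].
exact: Sigma_separated.
Qed.

Theorem Sigma_distal_profinite : sep_fin_EDRdeg act ->
  forall Z : flow G, distal_flow Z -> minimal_flow Z -> profinite_flow Z.
Proof.
move=> edr; apply: (distal_profinite_few_colors _ sigma_universal) => //.
by move=> U Ucl; exact: EDRdeg_few_colors.
Qed.

End SigmaSpace.

(** * Subflows *)

Section Subflow.
Context (G : topologicalGroupType) (X : flow G) (Z : set X).
Hypothesis Zclosed : closed Z.
Hypothesis Zinv : forall g x, Z x -> Z (flow_act g x).

Local Notation TZ := (set_type Z).

Definition sub_act (g : G) (z : TZ) : TZ :=
  exist _ (flow_act g (val z)) (mem_set (Zinv g (set_valP z))).

Fact sub_act1 z : sub_act 1 z = z.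
Proof. by apply: val_inj; rewrite /= flow_act1. Qed.

Fact sub_actM g h z : sub_act (g * h) z = sub_act g (sub_act h z).
Proof. by apply: val_inj; rewrite /= flow_actM. Qed.

Lemma set_val_continuous : continuous (set_val : TZ -> X).
Proof. exact: initial_continuous. Qed.

Lemma sub_nbhs (z : TZ) (A : set TZ) : nbhs z A ->
  exists2 B : set X, open B /\ B (val z) & forall w : TZ, B (val w) -> A w.
Proof.
rewrite nbhsE => -[_ [[B oB <-] Bz] BA]; exists B => // w Bw; exact: BA.
Qed.

Fact sub_act_continuous : continuous (fun p : G * TZ => sub_act p.1 p.2).
Proof.
move=> [g z] A /sub_nbhs[B [oB Bgz] BA].
have c : continuous (fun p : G * TZ => flow_act p.1 (set_val p.2) : X).
  move=> p; apply: (@continuous_comp _ _ _ (fun p : G * TZ => (p.1, set_val p.2))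
    (fun p : G * X => flow_act p.1 p.2)).
    apply: cvg_pair; first exact: cvg_fst.
    apply: (@continuous_comp _ _ _ snd (set_val : TZ -> X)).
      exact: snd_continuous.
    exact: set_val_continuous.
  exact: flow_continuous.
have nB : nbhs (flow_act g (set_val z)) B by exact: open_nbhs_nbhs.
have nA := continuous_nbhs (x := (g, z)) c nB.
by apply: (@filterS _ (nbhs (g, z)) _ _ _ _ nA) => p Bp; apply: BA.
Qed.

Fact sub_compact : compact [set: TZ].
Proof.
move=> F PF _.
have Zc : compact Z by exact: (subclosed_compact Zclosed (@flow_compact _ X)).
have FZ : (set_val @ F) Z.
  by apply: (@filterS _ F _ setT) => [z _|]; [exact: set_valP|exact: filterT].
have [x [Zx clx]] := Zc _ (fmap_proper_filter set_val PF) FZ.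
exists (exist _ x (mem_set Zx)); split=> // A W FA /sub_nbhs[B [oB Bx] BW].
have [|y [[z Az <-] By]] := clx (set_val @` A) B _ (open_nbhs_nbhs (conj oB Bx)).
  by apply: (@filterS _ F _ A) => // z Az; exists z.
by exists z; split => //; exact: BW.
Qed.

Fact sub_hausdorff : hausdorff_space TZ.
Proof.
move=> z w zw; apply: val_inj; apply: (@flow_hausdorff _ X) => A B nA nB.
have [y [Ay By]] := zw _ _ (continuous_nbhs set_val_continuous nA)
  (continuous_nbhs set_val_continuous nB).
by exists (val y).
Qed.

Definition subflow : flow G := @Flow G TZ sub_act sub_act1 sub_actM
  sub_act_continuous sub_compact sub_hausdorff.

End Subflow.

(** The points [rho x] with [rho] in a minimal left ideal form a minimal
    subflow of the orbit closure of [x]. *)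
Section MinimalSubflow.
Context (G : topologicalGroupType) (X : flow G) (x : X).
Variable d : ellis_idempotent (flow_gspace X).
Local Notation S := (flow_gspace X).
Local Notation T := {ptws S -> S}.

Definition ideal_orbit : set X := (fun p : T => p x) @` ei_ideal d.

Lemma ideal_orbit_closed : closed ideal_orbit.
Proof.
apply: compact_closed; first exact: flow_hausdorff.
apply: (@continuous_compact _ _ (fun p : T => p x)).
  by apply: continuous_subspaceT; exact: prod_eval_continuous.
exact: ei_ideal_compact.
Qed.

Lemma ideal_orbit_act g z : ideal_orbit z -> ideal_orbit (flow_act g z).
Proof.
move=> [p Lp <-]; exists (gact S g \o p) => //.
by apply: ei_ideal_comp Lp; exact: ellis_act.
Qed.

Lemma ideal_orbit_closure : ideal_orbit `<=` closure (range (fun g => flow_act g x)).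
Proof.
move=> _ [p Lp <-]; apply: closureP => W nW.
have [_ [g _ <-] /nbhs_singleton Wg] := nbhs_closure (ei_ideal_sub Lp)
  (continuous_nbhs (@prod_eval_continuous _ _ x) nW).
by exists (flow_act g x) => //; exists g.
Qed.

Definition minimal_subflow : flow G :=
  subflow ideal_orbit_closed ideal_orbit_act.

Lemma minimal_subflow_minimal : minimal_flow minimal_subflow.
Proof.
split.
  have Zu : ideal_orbit (ei_fun d x) by exists (ei_fun d) => //; exact: ei_mem.
  by exists (exist _ (ei_fun d x) (mem_set Zu)).
move=> z O [w Ow] oO.
have [p Lp pz] := set_valP z; have [q Lq qw] := set_valP w.
move: Lq; rewrite (ei_idealE Lp) => -[r Er rpq].
have rz : r (val z) = val w by rewrite -qw -rpq -pz.
have [B [oB Bw] BO] := sub_nbhs (open_nbhs_nbhs (conj oO Ow)).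
have nB : nbhs (r (val z)) B by rewrite rz; exact: open_nbhs_nbhs.
have [_ [g _ <-] /nbhs_singleton Bg] := nbhs_closure Er
  (continuous_nbhs (@prod_eval_continuous _ _ (val z)) nB).
exists (sub_act ideal_orbit_act g z); split; last by exists g.
exact: BO.
Qed.

End MinimalSubflow.

(** * Metrizability of the universal minimal flow *)

(** Cantor's diagonal argument. *)
Lemma set_nat_not_countable (A : Type) (C : set A) (j : set nat -> A) :
  countable C -> (forall N, C (j N)) -> injective j -> False.
Proof.
move=> /pcard_leP/injfunPex[i _ iinj] jC jinj.
pose N := [set n | exists N', i (j N') = n /\ ~ N' n].
have [NN|nNN] := pselect (N (i (j N))).
  have [N' [ij nN']] := NN.
  have NN' : N' = N by apply: jinj; apply: iinj => //; exact/mem_set.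
  by apply: nN'; rewrite NN'.
by apply: (nNN); exists N.
Qed.

Lemma metrizable_clopen_countable (R : realType) (X : topologicalType) :
  [set: X] !=set0 -> compact [set: X] -> metrizable R X ->
  countable (@clopen X).
Proof.
move=> [x0 _] Xc [Y [f [g [fK gK fc gc]]]].
pose Yp : pseudoPMetricType R := HB.pack_for (pseudoPMetricType R) (Metric.sort Y)
  (isPointed.Build (Metric.sort Y) (f x0)).
have Yc : compact [set: Yp].
  have -> : [set: Yp] = f @` [set: X].
    by apply/seteqP; split=> // y _; exists (g y).
  by apply: continuous_compact => //; exact: continuous_subspaceT.
have := clopen_countable Yc (compact_second_countable Yc).
apply: card_le_trans; apply/pcard_leP; apply/injfunPex.
exists (fun U => g @^-1` U) => [U Ucl|U V _ _ E].
  exact: clopen_preimage.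
have E' x : U x = V x by rewrite -(fK x); exact: (congr1 (fun W => W (f x)) E).
by apply/funext.
Qed.

Lemma infinite_set2 (A : Type) (C : set A) : infinite_set C ->
  exists x y, [/\ C x, C y & x <> y].
Proof.
move=> Cinf; apply: contrapT => h; apply: Cinf.
have [->|/set0P[x Cx]] := eqVneq C set0; first exact: finite_set0.
apply: (sub_finite_set _ (finite_set1 x)) => y Cy.
by apply: contrapT => yx; apply: h; exists y, x.
Qed.

(** ** Ultrafilters of stable sets *)
Section StablePoints.
Context (L : language) (M : structure L).
Local Notation G := (aut M).
Local Notation P := (stable_flow M).
Implicit Types (g h : G) (s : seq M) (D E : set G) (z : P).

(** For [z] in the orbit closure of the base point, an ultrafilter on the
    algebra of stable sets. *)
Definition stable_at z : set (set G) :=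
  [set D | exists D' : stable_set M, val D' = D /\ z D'].

Lemma stable_atP z (D : stable_set M) : stable_at z (val D) <-> z D.
Proof.
split=> [[D' [/val_inj -> //]]|zD]; by exists D.
Qed.

Definition orbit_closure : set P :=
  closure (range (fun g => flow_act g (@stable_base L M : P))).

(** Every finite part of a limit of orbit points is realized by an orbit point,
    at which membership in the ultrafilter is membership of [g]. *)
Lemma stable_at_approx z (l : seq (set G)) : orbit_closure z ->
  (forall D, D \in l -> stable_sets D) ->
  exists g, forall D, D \in l -> stable_at z D <-> D g.
Proof.
move=> clz ls.
have nl : nbhs z [set w : P | forall D : set G, D \in l -> stable_at w D <-> stable_at z D].
  elim: l ls => [|D l IH] ls.
    by apply: (@filterS _ (nbhs z) _ setT) => //; exact: filterT.
  have DP : stable_sets D by apply: ls; rewrite inE eqxx.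
  have n1 : nbhs z [set w : P | stable_clopen (mk_stable DP) w <->
      stable_clopen (mk_stable DP) z].
    have c := @prod_eval_continuous (stable_set M) (fun=> bool) (mk_stable DP).
    have := continuous_nbhs (x := z) c (@discrete_set1 bool _).
    apply: (@filterS _ (nbhs z)) => w; by rewrite /stable_clopen /= => ->.
  have n2 : nbhs z [set w : P | forall D : set G, D \in l ->
      stable_at w D <-> stable_at z D].
    by apply: IH => E El; apply: ls; rewrite inE El orbT.
  apply: (@filterS _ (nbhs z) _ _ _ _ (filterI n1 n2)) => w /= [w1 w2] E.
  rewrite inE => /predU1P[->|/w2//].
  by rewrite -[D]/(val (mk_stable DP)) !stable_atP.
have [_ [g _ <-] /nbhs_singleton gl] := nbhs_closure clz nl.
exists g => D Dl; rewrite -(gl D Dl).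
have DP := ls D Dl; rewrite -[D]/(val (mk_stable DP)) stable_atP.
exact: (stable_clopen_base g (mk_stable DP)).
Qed.

Lemma stable_atD z D E : orbit_closure z -> stable_sets D -> stable_sets E ->
  stable_sets (D `\` E) ->
  stable_at z (D `\` E) <-> stable_at z D /\ ~ stable_at z E.
Proof.
move=> clz Ds Es DEs.
have [|g gl] := @stable_at_approx z [:: D `\` E; D; E] clz.
  by move=> F; rewrite !inE => /or3P[] /eqP ->.
rewrite !gl ?inE ?eqxx ?orbT//.
Qed.

Lemma stable_at_sub z D E : orbit_closure z -> stable_sets D -> stable_sets E ->
  D `<=` E -> stable_at z D -> stable_at z E.
Proof.
move=> clz Ds Es DE.
have [|g gl] := @stable_at_approx z [:: D; E] clz.
  by move=> F; rewrite !inE => /orP[] /eqP ->.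
by rewrite !gl ?inE ?eqxx ?orbT//; exact: DE.
Qed.

Lemma stable_setD s D E : stable s D -> stable s E -> stable s (D `\` E).
Proof.
move=> Ds Es g h gh [Dg nEg]; split; first exact: Ds gh Dg.
by move=> Eh; apply: nEg; apply: Es Eh; exact: agree_sym.
Qed.

Lemma stable_ex s D : stable s D -> stable_sets D.
Proof. by exists s. Qed.

(** The trace of the ultrafilter [z] on the algebra of [s]-stable sets. *)
Definition trace s z : set (set G) := [set D | stable s D /\ stable_at z D].

Section InfiniteTraces.
Variables (s : seq M) (Z : set P).
Hypothesis Zcl : Z `<=` orbit_closure.

Definition infinitely_traced D := stable s D /\
  infinite_set (trace s @` [set z | Z z /\ stable_at z D]).

(** Two different traces that contain [D] are separated by a stable set [E];
    one of [D] minus [E] and [D] meet [E] lies in infinitely many traces, and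
    the other lies in one. *)
Lemma infinitely_traced_split D : infinitely_traced D -> exists E, [/\ infinitely_traced E, E `<=` D &
  exists2 z, Z z & stable_at z (D `\` E)].
Proof.
move=> [Ds Dinf]; have [_ [_ [[z [Zz zD] <-] [w [Zw wD] <-] zw]]] := infinite_set2 Dinf.
have [z' [w' [Zz' zD' Zw' wD' [E [[Es zE] nwE]]]]] : exists z' w', [/\ Z z', stable_at z' D,
    Z w', stable_at w' D & exists E, trace s z' E /\ ~ trace s w' E].
  apply: contrapT => h; apply: zw; apply/seteqP; split=> E zE; apply: contrapT => wE.
    by apply: h; exists z, w; split => //; exists E.
  by apply: h; exists w, z; split => //; exists E.
have DEs := stable_setD Ds Es; have DDEs := stable_setD Ds DEs.
have [clz clw] := (Zcl Zz', Zcl Zw').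
have wDE : stable_at w' (D `\` E).
  apply/stable_atD => //; [exact: stable_ex Ds|exact: stable_ex Es|exact: stable_ex DEs|].
  by split => // wE; apply: nwE.
have zDDE : stable_at z' (D `\` (D `\` E)).
  apply/stable_atD => //; [exact: stable_ex Ds|exact: stable_ex DEs|exact: stable_ex DDEs|].
  split=> // /stable_atD [] //; [exact: stable_ex Ds|exact: stable_ex Es|exact: stable_ex DEs].
have DEsub : D `\` E `<=` D by move=> ? [].
have [DEf|DEi] := pselect (finite_set (trace s @` [set z | Z z /\ stable_at z (D `\` E)])).
  exists (D `\` (D `\` E)); split; [|by move=> ? []|]; last first.
    by exists w'; rewrite // setDD setIC setIidl.
  split => // DDEf; apply: Dinf.
  apply: (@sub_finite_set _ _ ((trace s @` [set z | Z z /\ stable_at z (D `\` E)])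
    `|` (trace s @` [set z | Z z /\ stable_at z (D `\` (D `\` E))]))); last first.
    by rewrite finite_setU.
  move=> _ [x [Zx xD] <-].
  have [xDE|xDE] := pselect (stable_at x (D `\` E)); [left|right]; exists x => //.
  split=> //; apply/stable_atD => //; [exact: Zcl|exact: stable_ex Ds|exact: stable_ex DEs|exact: stable_ex DDEs].
exists (D `\` E); split=> //.
by exists z'.
Qed.

(** Splitting off one piece after the other gives disjoint stable sets, each
    contained in one of the ultrafilters. *)
Lemma infinite_traces : infinite_set (trace s @` Z) ->
  exists D : nat -> set G, [/\ forall n, stable s (D n),
    forall m n x, D m x -> D n x -> m = n &
    forall n, exists2 z, Z z & stable_at z (D n)].
Proof.
move=> Zinf.
have iT : infinitely_traced setT.
  split=> //; suff -> : [set z | Z z /\ stable_at z setT] = Z by [].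
  apply/seteqP; split=> [z []//|z Zz]; split => //.
  have [|g gl] := @stable_at_approx z [:: setT] (Zcl Zz).
    by move=> F; rewrite inE => /eqP ->; exists [::].
  by apply/gl; rewrite ?inE.
pose step (B : {D | infinitely_traced D}) : {D | infinitely_traced D} :=
  exist _ _ (let: And3 h _ _ := projT2 (cid (infinitely_traced_split (projT2 B))) in h).
pose B n := iter n step (exist _ setT iT).
have BS n : projT1 (B n.+1) `<=` projT1 (B n).
  by rewrite /B /= /step /=; case: cid => E [].
have BZ n : exists2 z, Z z & stable_at z (projT1 (B n) `\` projT1 (B n.+1)).
  by rewrite /B /= /step /=; case: cid => E [].
have Bst n : stable s (projT1 (B n)) by case: (projT2 (B n)).
have Ble m n : (m <= n)%N -> projT1 (B n) `<=` projT1 (B m).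
  move=> /subnK <-; elim: (n - m)%N => [//|k IH]; rewrite addSn.
  exact: subset_trans (BS _) IH.
exists (fun n => projT1 (B n) `\` projT1 (B n.+1)); split => //.
- by move=> n; exact: stable_setD.
- move=> m n x [xm nxm] [xn nxn]; case: (ltngtP m n) => // mn.
    by case: nxm; apply: Ble mn _ xn.
  by case: nxn; apply: Ble mn _ xm.
Qed.

End InfiniteTraces.

(** Otherwise the unions of subfamilies of an infinite disjoint family of
    [s]-stable sets have pairwise different traces on [Z], because arbitrary
    unions of [s]-stable sets are [s]-stable. This gives continuum many clopen
    subsets of [X], but a compact metrizable space has countably many. *)
Lemma metrizable_finite_traces (R : realType) (X : flow G) (Z : set P)
    (f : X -> P) s :
  [set: X] !=set0 -> metrizable R X -> Z `<=` orbit_closure -> continuous f ->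
  f @` setT = Z -> finite_set (trace s @` Z).
Proof.
move=> X0 Xmet Zcl fc fZ; apply: contrapT => /(infinite_traces Zcl)[D [Ds Ddis DZ]].
pose E (N : set nat) := \bigcup_(n in N) D n.
have Es N : stable s (E N).
  by move=> g h gh [n Nn Dg]; exists n => //; apply: Ds gh Dg.
pose E' N := mk_stable (stable_ex (Es N)).
apply: (@set_nat_not_countable _ (@clopen X) (fun N => f @^-1` stable_clopen (E' N))).
- exact: metrizable_clopen_countable X0 (@flow_compact _ X) Xmet.
- by move=> N; apply: clopen_preimage fc _; exact: stable_clopenP.
have sub N N' : f @^-1` stable_clopen (E' N) = f @^-1` stable_clopen (E' N') -> N `<=` N'.
  move=> NN n Nn; have [z Zz zD] := DZ n.
  have [x _ fx] : (f @` setT) z by rewrite fZ.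
  have zE : stable_at z (E N).
    apply: stable_at_sub zD; [exact: Zcl|exact: stable_ex (Ds n)|exact: stable_ex (Es N)|].
    by move=> g Dg; exists n.
  have zE' : stable_at z (E N').
    apply/(stable_atP z (E' N')); rewrite -fx.
    change ((f @^-1` stable_clopen (E' N')) x); rewrite -NN.
    by rewrite /stable_clopen /= fx; apply/(stable_atP z (E' N)).
  have [|g gl] := @stable_at_approx z [:: D n; E N'] (Zcl _ Zz).
    by move=> F; rewrite !inE => /orP[] /eqP ->; [exact: stable_ex (Ds n)|exact: stable_ex (Es N')].
  have [Dg [m Nm Dm]] : D n g /\ E N' g.
    by split; [apply/gl => //|apply/gl => //]; rewrite !inE eqxx ?orbT.
  by rewrite (Ddis n m g).
by move=> N N' NN; apply/seteqP; split; exact: sub.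
Qed.

End StablePoints.

(** ** From finitely many traces to embedding Ramsey degrees *)
Section FiniteTraces.
Context (L : language) (M : structure L).
Local Notation G := (aut M).
Local Notation P := (stable_flow M).
Implicit Types (g h : G).

Lemma finite_tuples (A : choiceType) (n : nat) (B : set A) : finite_set B ->
  finite_set [set x : 'I_n -> A | range x `<=` B].
Proof.
move=> /finite_seqP[t ->].
have fin : finite_set (range (fun (w : {ffun 'I_n -> 'I_(size t)}) (i : 'I_n) =>
    tnth (in_tuple t) (w i))).
  by apply: (@finite_range_factor _ _ {ffun 'I_n -> 'I_(size t)} _ id) => x y ->.
apply: sub_finite_set fin => x xt.
have lt i : (index (x i) t < size t)%N by rewrite index_mem; apply: xt; exists i.
exists [ffun i => Ordinal (lt i)] => //; apply/funext => i.
by rewrite ffunE (tnth_nth (x i)) /= nth_index //; apply: xt; exists i.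
Qed.

Lemma finite_copies (B : set M) n (a : 'I_n -> M) : finite_set B ->
  finite_set (tuple_copies B a).
Proof. by move=> Bfin; apply: sub_finite_set (finite_tuples n Bfin) => x []. Qed.

(** The limit [c] is a cluster point of the colourings [bc l] along the finite
    lists [l], in a product of finite discrete spaces. *)
Lemma limit_coloring (A B : choiceType) (r : nat) (bc : seq A -> B -> 'I_r.+1) :
  exists c : B -> 'I_r.+1, forall (l : seq A) (xs : seq B),
    exists l', {subset l <= l'} /\ forall x, x \in xs -> c x = bc l' x.
Proof.
pose V : topologicalType := discrete_topology 'I_r.+1.
pose Q := {ptws B -> V}.
pose S (l : seq A) : set Q :=
  (fun l' => bc l' : Q) @` [set l' | {subset l <= l'}].
have PF : ProperFilter (filter_from setT S).
  apply: filter_from_proper; first apply: filter_from_filter.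
  - by exists [::].
  - move=> l k _ _; exists (l ++ k) => // _ [l' ll' <-].
    by split; exists l' => // x xl; apply: ll'; rewrite mem_cat xl ?orbT.
  - by move=> l _; exists (bc l), l.
have Qc : compact [set: Q].
  by apply: ptws_compact; apply: finite_compact; exact: finite_finset.
have [c [_ clc]] := Qc _ PF (@filterT _ _ _).
exists c => l xs.
have nx : nbhs c [set q : Q | forall x, x \in xs -> c x = q x].
  elim: xs => [|x xs IH]; first by apply: (@filterS _ (nbhs c) _ setT) => //; exact: filterT.
  have n1 := continuous_nbhs (x := c) (@prod_eval_continuous B (fun=> V) x)
    (@discrete_set1 (discrete_topology 'I_r.+1) _).
  apply: (@filterS _ (nbhs c) _ _ _ _ (filterI n1 IH)) => q /= [qx qxs] y.
  by rewrite inE => /predU1P[->|/qxs].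
have [|_ [[l' ll' <-] cl']] := clc (S l) _ _ nx; first by exists l.
by exists l'.
Qed.

(** Suppose that the degree of [a] is not bounded by the number [k] of traces
    over [a], as witnessed by [B]. A limit of bad colourings of the copies in
    larger and larger finite sets is a colouring [c] of all copies of [a] for
    which every copy of [B] is bad. The colour classes of [c] are stable sets
    [D j] that partition [G]; at most [k] of them are met by [Z], because
    different colours give different traces. All translates of a point [z0] of
    [Z] are in [Z], so approximating [z0] by an orbit point gives one copy of
    [B] on which [c] takes only these [k] colours. *)
Lemma finite_traces_ERdeg (Z : set P) : Z !=set0 -> Z `<=` @orbit_closure L M ->
  (forall g z, Z z -> Z (flow_act g z)) ->
  (forall s, finite_set (trace s @` Z)) -> sep_fin_ERdeg M.
Proof.
move=> [z0 Zz0] Zcl Zinv Zfin n a.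
pose s := [seq a i | i : 'I_n].
have /finite_setP[k /card_eqPle[Zk _]] := Zfin s.
exists k => B r Bfin aB; apply: contrapT => nC.
have Cfin (l : seq M) : finite_set (B `|` [set` l]).
  by rewrite finite_setU; split => //; apply/finite_seqP; exists l.
have bad (l : seq M) : exists c : ('I_n -> M) -> nat,
    (forall x, tuple_copies (B `|` [set` l]) a x -> (c x < r)%N) /\
    forall B', set_copies (B `|` [set` l]) B B' ->
      ~ (c @` tuple_copies B' a #<= `I_k).
  apply: contrapT => nc; apply: nC; exists (B `|` [set` l]); split => //.
  move=> c cr; apply: contrapT => nB'; apply: nc; exists c; split=> // B' B'c ck.
  by apply: nB'; exists B'.
pose bc l := projT1 (cid (bad l)).
have bcr l x : tuple_copies (B `|` [set` l]) a x -> (bc l x < r)%N.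
  exact: (projT2 (cid (bad l))).1.
have bcB l B' : set_copies (B `|` [set` l]) B B' ->
    ~ (bc l @` tuple_copies B' a #<= `I_k).
  exact: (projT2 (cid (bad l))).2.
(* There are [r.+1] colours rather than [r], so that the type is inhabited. *)
have [c cP] := limit_coloring (fun l x => inord (bc l x) : 'I_r.+1).
pose D j : set G := [set g | c (aut_inv g \o a) = j].
have Ds j : stable s (D j).
  move=> g h gh; rewrite /D /= => <-; congr c; apply/funext => i /=.
  by apply/esym/gh; apply: map_f; rewrite mem_enum.
have Ds' j : stable_sets (D j) by exists s.
pose J := [set j | exists2 z, Z z & stable_at z (D j)].
have Jk : at_most k J.
  move=> f fJ finj.
  pose z i := projT1 (cid2 (fJ i)).
  have Zz i : Z (z i) by rewrite /z; case: cid2.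
  have zD i : stable_at (z i) (D (f i)) by rewrite /z; case: cid2.
  apply: (card_le_at_most Zk (f := fun i => trace s (z i))) => [i|i j zij].
    by exists (z i).
  have [_ zjD] : trace s (z j) (D (f i)) by rewrite -zij; split.
  have [|g gl] := @stable_at_approx _ _ (z j) [:: D (f i); D (f j)] (Zcl _ (Zz j)).
    by move=> F; rewrite !inE => /orP[] /eqP ->.
  apply: finj.
  have Di : D (f i) g by apply/gl => //; rewrite inE eqxx.
  have Dj : D (f j) g by apply/gl => //; rewrite !inE eqxx orbT.
  by rewrite -Di -Dj.
have Zj z : Z z -> exists j, stable_at z (D j).
  move=> Zz; have [|g gl] := @stable_at_approx _ _ z [seq D j | j : 'I_r.+1] (Zcl _ Zz).
    by move=> F /mapP[j _ ->].
  exists (c (aut_inv g \o a)); apply/gl => //.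
  by apply: map_f; rewrite mem_enum.
have /finite_seqP[xs xsE] := finite_copies a Bfin.
(* A copy [x = f a] of [a] in [B] gives the point [f^-1 z0] of [Z], in which
   exactly one of the colour classes occurs. *)
have xsP x : x \in xs -> exists (f : G) j,
    [/\ x = f \o a, J j & stable_at z0 (translate f^-1 (D j))].
  move=> xs_; have [_ [f xf]] : tuple_copies B a x by rewrite xsE.
  have [j zj] := Zj _ (Zinv f^-1 z0 Zz0).
  exists f, j; split => //; first by exists (flow_act f^-1 z0) => //; exact: Zinv.
  move: zj; rewrite -[D j]/(val (mk_stable (Ds' j))) stable_atP => zj.
  by exists (stable_translate f^-1 (mk_stable (Ds' j))).
have [E EP] : exists E : ('I_n -> M) -> set G, forall x, x \in xs ->
    [/\ stable_sets (E x), stable_at z0 (E x) & forall g, E x g -> J (c (aut_inv g \o x))].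
  have /choice[E EP] : forall x, exists Ex : set G, x \in xs ->
      [/\ stable_sets Ex, stable_at z0 Ex & forall g, Ex g -> J (c (aut_inv g \o x))].
    move=> x; have [xs_|nx] := boolP (x \in xs); last by exists set0.
    have [f [j [-> Jj zj]]] := xsP x xs_.
    exists (translate f^-1 (D j)) => _; split => //; first exact: translate_stable.
    by move=> g Eg; move: Jj; rewrite -Eg.
  by exists E.
have [|g gE] := @stable_at_approx _ _ z0 [seq E x | x <- xs] (Zcl _ Zz0).
  by move=> F /mapP[x /EP[Es _ _] ->].
(* The copy [h B] of [B] has only colours in [J]. *)
pose h : G := g^-1.
have hJ y : tuple_copies ((h : M -> M) @` B) a y -> J (c y).
  move=> [yB [f yf]]; pose x := (g : M -> M) \o y.
  have xs_ : x \in xs.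
    suff : [set` xs] x by [].
    rewrite -xsE; split; last by exists (g * f); rewrite /x yf.
    move=> _ [i _ <-]; have [|b Bb hb] := yB (y i); first by exists i.
    by rewrite /x /= -hb /= aut_invK.
  have [Es Ez EJ] := EP x xs_.
  have -> : y = aut_inv g \o x by apply/funext => i; rewrite /x /= aut_funK.
  by apply: EJ; apply/gE => //; exact: map_f.
have /finite_seqP[hB hBE] : finite_set ((h : M -> M) @` B) by exact: finite_image.
have /finite_seqP[ys ysE] : finite_set (tuple_copies ((h : M -> M) @` B) a).
  by apply: finite_copies; exact: finite_image.
have [l' [hBl' cl']] := cP hB ys.
have hBsub : (h : M -> M) @` B `<=` B `|` [set` l'].
  by rewrite hBE => x /hBl'; right.
apply: (bcB l' ((h : M -> M) @` B)); first by split => //; exists h.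
apply: at_most_card_le => w wP winj.
have wE i : exists2 j, J j & val j = w i.
  have [y yc <-] := wP i; exists (c y); first exact: hJ.
  have -> : c y = inord (bc l' y).
    by apply: cl'; suff : [set` ys] y by []; rewrite -ysE.
  rewrite /= inordK // ltnS; apply/ltnW/bcr.
  by case: yc => yB yf; split => // ? /yB /hBsub.
pose v i := projT1 (cid2 (wE i)).
have vE i : val (v i) = w i by rewrite /v; case: cid2.
apply: (Jk v) => [i|i j vij]; first by rewrite /v; case: cid2.
by apply: winj; rewrite -!vE vij.
Qed.

(** A minimal subflow of the flow of 0-1 functions is an image of [X]. *)
Lemma metrizable_ERdeg (R : realType) (X : flow G) :
  universal_minimal_flow X -> metrizable R X -> sep_fin_ERdeg M.
Proof.
move=> [[X0 _] Xuniv] Xmet.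
have [d] := ellis_idempotent_exists (flow_gspace P).
pose Z := minimal_subflow (@stable_base L M : P) d.
have [f [[fc fG] fsurj]] := Xuniv Z (minimal_subflow_minimal _ _).
pose Zs := ideal_orbit (@stable_base L M : P) d.
have Zscl : Zs `<=` @orbit_closure L M by exact: ideal_orbit_closure.
have vfc : continuous (fun x => set_val (f x) : P).
  move=> x; apply: (@continuous_comp _ _ _ f (set_val : Z -> P)); first exact: fc.
  exact: set_val_continuous.
have vfZ : (fun x => set_val (f x) : P) @` setT = Zs.
  apply/seteqP; split=> [_ [x _ <-]|z Zz]; first exact: set_valP.
  have [x _ fx] := fsurj (exist _ z (mem_set Zz)) Logic.I.
  by exists x => //; rewrite fx.
apply: (@finite_traces_ERdeg Zs) => //.
- by have [[z _] _] := minimal_subflow_minimal (@stable_base L M : P) d;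
    exists (set_val z); exact: set_valP.
- by move=> g z; exact: ideal_orbit_act.
- by move=> s; exact: metrizable_finite_traces X0 Xmet Zscl vfc vfZ.
Qed.

End FiniteTraces.

(** ** Metrization of compact spaces with a countable base *)

Section Metrization.
Import Order.TTheory GRing.Theory Num.Theory.
Import numFieldNormedType.Exports.
Context (R : realType) (X : topologicalType).
Hypotheses (Xc : compact [set: X]) (Xh : hausdorff_space X).

Local Open Scope ring_scope.

Lemma urysohn_pair (A B : set X) : exists f : X -> R,
  [/\ continuous f, forall x, 0 <= f x <= 1 &
    closure A `<=` B -> open B -> (forall x, A x -> f x = 0) /\ (forall x, ~ B x -> f x = 1)].
Proof.
have [AB|nAB] := pselect (closure A `<=` B /\ open B); last first.
  exists (fun=> 0); split=> [x|x|AB Bo]; [exact: cvg_cst|by rewrite lexx ler01|].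
  by case: nAB.
have [clAB Bo] := AB.
have [|f [fc f01 f0 f1]] := (@uniform_separatorP X R (closure A) (~` B)).1.
- apply: (@normal_separatorP R X).1 => //.
  + exact: compact_normal.
  + exact: closed_closure.
  + exact: open_closedC.
  + by apply/disjoints_subset; rewrite setCK.
exists f; split => //.
  by move=> x; have := f01 _ (imageT f x); rewrite /= in_itv.
move=> _ _; split=> x h; first by apply: f0; exists x => //; exact: subset_closure.
by apply: f1; exists x.
Qed.

(** Urysohn functions for the pairs of base sets with the closure of the first
    contained in the second. *)
Lemma countable_functions (F : set (set X)) : countable F ->
  (forall B, F B -> open B) ->
  (forall x A, nbhs x A -> exists B, [/\ F B, B x & B `<=` A]) ->
  exists f : nat -> X -> R, [/\ forall n, continuous (f n),
    forall n x, 0 <= f n x <= 1 &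
    forall x y, (forall n, f n x = f n y) -> x = y].
Proof.
move=> /pcard_leP/injfunPex[i _ iinj] Fo Fbase.
pose e n := xget set0 [set B | F B /\ i B = n].
have eE B : F B -> e (i B) = B.
  move=> FB; have [Fe ie] : F (e (i B)) /\ i (e (i B)) = i B.
    exact: (xgetPex set0 (P := [set B' | F B' /\ i B' = i B]) (ex_intro _ B (conj FB erefl))).
  by apply: iinj => //; exact/mem_set.
pose g m n := projT1 (cid (urysohn_pair (e m) (e n))).
have gP m n := projT2 (cid (urysohn_pair (e m) (e n))).
have gc m n : continuous (g m n) by have [h _ _] := gP m n; exact: h.
have g01 m n x : 0 <= g m n x <= 1 by have [_ h _] := gP m n; exact: h.
pose f k := if unpickle k is Some mn then g mn.1 mn.2 else g 0%N 0%N.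
exists f; split.
- by move=> k; rewrite /f; case: unpickle => [mn|]; exact: gc.
- by move=> k x; rewrite /f; case: unpickle => [mn|]; exact: g01.
- move=> x y fxy; apply: contrapT => xy.
  have yo : open (~` [set y]).
    by apply: closed_openC; apply: accessible_closed_set1; exact: hausdorff_accessible.
  have nxy : nbhs x (~` [set y]) by exact: open_nbhs_nbhs.
  have [B [FB Bx By]] := Fbase _ _ nxy.
  have [W nW WB] : exists2 W, nbhs x W & closure W `<=` B.
    have nB : nbhs x B by apply: open_nbhs_nbhs; split=> //; exact: Fo.
    have nT : nbhs x [set: X] by exact: filterT.
    by have [W nW WB] := @compact_regular X x setT Xh Xc nT B nB; exists W.
  have [A [FA Ax AW]] := Fbase _ _ nW.
  have [_ _ gAB] := gP (i A) (i B).
  have [||gA gB] := gAB.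
  + by rewrite !eE//; exact: subset_trans (closureS AW) WB.
  + by rewrite eE//; exact: Fo.
  have := fxy (pickle (i A, i B)); rewrite /f pickleK /=.
  have -> : g (i A) (i B) x = 0 by apply: gA; rewrite eE.
  have -> : g (i A) (i B) y = 1 by apply: gB; rewrite eE// => /By; apply.
  by move/eqP; rewrite eq_sym oner_eq0.
Qed.

(** A copy of the type that does not carry the given topology. *)
Definition metric_alias (Z : Type) : Type := Z.

(** The distance is the supremum of [2^-n |f n x - f n y|] for a separating
    sequence of functions with values in [0, 1]. The identity to this metric
    space is continuous, hence a homeomorphism by compactness. *)
Lemma countable_base_metrizable (F : set (set X)) : countable F ->
  (forall B, F B -> open B) ->
  (forall x A, nbhs x A -> exists B, [/\ F B, B x & B `<=` A]) ->
  metrizable R X.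
Proof.
move=> Fc Fo Fbase; have [f [fc f01 finj]] := countable_functions Fc Fo Fbase.
pose D x y := [set (2^-1) ^+ n * `|f n x - f n y| | n in [set: nat]] : set R.
pose dist x y := sup (D x y).
have w0 n : 0 <= (2^-1 : R) ^+ n by apply: exprn_ge0; rewrite invr_ge0.
have w1 n : (2^-1 : R) ^+ n <= 1 by apply: exprn_ile1; rewrite ?invr_ge0// invf_le1// ler1n.
have f_le1 n x y : `|f n x - f n y| <= 1.
  have /andP[a b] := f01 n x; have /andP[a' b'] := f01 n y.
  by rewrite ler_norml; apply/andP; split; lra.
have Dub x y : ubound (D x y) 1.
  by move=> _ [n _ <-]; apply: mulr_ile1 => //; exact: w0.
have D0 x y : D x y !=set0 by exists ((2^-1) ^+ 0 * `|f 0%N x - f 0%N y|), 0%N.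
have dge x y n : (2^-1) ^+ n * `|f n x - f n y| <= dist x y.
  by apply: ub_le_sup; [exists 1|exists n].
have dle x y e : (forall n, (2^-1) ^+ n * `|f n x - f n y| <= e) -> dist x y <= e.
  by move=> h; apply: ge_sup => // _ [n _ <-].
have dxx x : dist x x = 0.
  apply/eqP; rewrite eq_le; apply/andP; split.
    by apply: dle => n; rewrite subrr normr0 mulr0.
  by apply: le_trans (dge x x 0%N); exact: mulr_ge0.
have dpos x y : dist x y = 0 -> x = y.
  move=> d0; apply: finj => n; apply/eqP; rewrite -subr_eq0 -normr_le0.
  have w_gt0 : 0 < (2^-1 : R) ^+ n by apply: exprn_gt0; rewrite invr_gt0.
  by have := dge x y n; rewrite d0 pmulr_rle0.
have dsym x y : dist x y = dist y x.
  by rewrite /dist /D; congr sup; congr image; apply/funext => n; rewrite distrC.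
have dtri y x z : dist x z <= dist x y + dist y z.
  apply: dle => n; apply: le_trans (lerD (dge x y n) (dge y z n)).
  rewrite -mulrDr; apply: ler_wpM2l => //.
  by rewrite -[f n x - f n z](subrKA (f n y)) ler_normD.
pose Xm := metric_alias X.
pose Y : metricType R := HB.pack_for (metricType R) Xm
  (Choice.copy Xm X) (isMetric.Build R Xm dxx dpos dsym dtri).
have ballE (x : Y) e : ball x e = [set y : Y | dist x y < e] by rewrite ballEmdist.
have idc : continuous (id : X -> Y).
  move=> x A /nbhs_ballP[e /= e0]; rewrite ballE => eA.
  have e20 : 0 < e / 2 by rewrite divr_gt0.
  have [N Ne] : exists N, forall n, (N <= n)%N -> (2^-1 : R) ^+ n <= e / 2.
    have /cvgrPdist_lt /(_ _ e20) : (fun n => (2^-1 : R) ^+ n) @ \oo --> 0.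
      by apply: cvg_expr; rewrite ger0_norm ?invr_ge0// invf_lt1// ltr1n.
    move=> [N _ hN]; exists N => n /hN /=; rewrite sub0r normrN ger0_norm//.
    exact: ltW.
  have nx : nbhs x [set y | forall n, (n < N)%N -> `|f n x - f n y| < e / 2].
    elim: N {Ne} => [|N IH]; first by apply: (@filterS _ (nbhs x) _ setT) => //; exact: filterT.
    have n1 : nbhs x [set y | `|f N x - f N y| < e / 2].
      by have /cvgrPdist_lt/(_ _ e20) := fc N x.
    apply: (@filterS _ (nbhs x) _ _ _ _ (filterI n1 IH)) => y /= [y1 y2] n.
    by rewrite ltnS leq_eqVlt => /predU1P[->//|/y2].
  apply: (@filterS _ (nbhs x) _ _ _ _ nx) => y /= yN; apply: eA => /=.
  apply: (@le_lt_trans _ _ (e / 2)); last by rewrite ltr_pdivrMr// ltr_pMr// ltr1n.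
  apply: dle => n; have [Nn|nN] := leqP N n.
    apply: le_trans (Ne n Nn); rewrite -[leRHS]mulr1; exact: ler_wpM2l.
  by apply: le_trans (ltW (yN n nN)); rewrite -[leRHS]mul1r; exact: ler_wpM2r.
exists Y, id, id; split => //.
apply/continuous_closedP => C Ccl.
have -> : (id : Y -> X) @^-1` C = (id : X -> Y) @` C.
  by apply/seteqP; split=> [x Cx|_ [x Cx <-]//]; exists x.
apply: compact_closed; first exact: metric_hausdorff.
apply: continuous_compact; first exact: continuous_subspaceT.
exact: (subclosed_compact Ccl Xc).
Qed.

End Metrization.

(** ** From embedding Ramsey degrees to metrizability *)
Section CountableBase.
Context (L : language) (M : structure L) (X : flow (aut M)).
Local Notation G := (aut M).
Local Notation P := (stable_flow M).
Local Notation Y := (prod_gspace (flow_gspace P) (flow_gspace X)).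
Local Notation T := {ptws Y -> Y}.
Hypotheses (Mcount : countable [set: M]) (Mer : sep_fin_ERdeg M).
Hypothesis Xmin : minimal_flow X.
Variable d : ellis_idempotent Y.
Local Notation Lid := (ei_ideal d).
Variable x0 : X.

Local Notation s0 := (@stable_base L M).

Definition first_point (p : T) : P := (p (s0, x0)).1.

Lemma first_point_closure p : Lid p -> @orbit_closure L M (first_point p).
Proof.
move=> Lp; apply: closureP => W nW.
have [_ [g _ <-] /nbhs_singleton Wg] := nbhs_closure (ei_ideal_sub Lp)
  (continuous_nbhs (@prod_fst_continuous _ (flow_gspace P) (flow_gspace X)
    (s0, x0 : flow_gspace X)) nW).
by exists (flow_act g (s0 : P)) => //; exists g.
Qed.

Definition traces s : set (set (set G)) := (fun p => trace s (first_point p)) @` Lid.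

(** The embedding Ramsey degree of [s] bounds the number of colours whatever the
    number of [s]-stable sets in the colouring, hence the number of traces. *)
Lemma traces_finite s : finite_set (traces s).
Proof.
have [k few] := ERdeg_few_colors s Mer.
have : at_most k (traces s); last first.
  by move/at_most_card_le => /card_le_finite; apply; exact: finite_II.
have few' := few_colors_fst (X := flow_gspace X) few.
apply: at_most_separate => n D.
have s00 : stable s (set0 : set G) by [].
pose D' i : stable_set M :=
  if pselect (stable s (D i)) is left h then mk_stable (stable_ex h)
  else mk_stable (stable_ex s00).
pose U i : set Y := fst @^-1` stable_clopen (D' i).
have DU i : [set (fst @^-1` V : set Y) | V in clopens_over s] (U i).
  exists (stable_clopen (D' i)) => //; exists (D' i) => //=.
  by rewrite /D'; case: pselect.
have Dcl : [set (fst @^-1` V : set Y) | V in clopens_over s] `<=` clopen.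
  move=> _ [_ [E _ <-] <-]; apply: clopen_preimage; first exact: fst_continuous.
  exact: stable_clopenP.
have := few_colors_ideal (d := d) Dcl few' (y := fun=> (s0, x0) : Y) DU.
apply: at_mostS.
move=> _ [_ [p Lp <-] <-]; exists p => //.
apply/ffunP => i; rewrite !ffunE; apply/asboolP/asboolP.
  rewrite /U /= /D'; case: pselect => [Ds|Ds] pD.
    by split=> //; exact/(stable_atP _ (mk_stable (stable_ex Ds))).
  have : stable_at (first_point p) set0.
    exact/(stable_atP _ (mk_stable (stable_ex s00))).
  have [|g gl] := @stable_at_approx _ _ (first_point p) [:: set0]
      (first_point_closure Lp).
    by move=> F; rewrite inE => /eqP ->; exact: stable_ex s00.
  by move/gl; rewrite inE eqxx => /(_ isT).
move=> [Ds pD]; rewrite /U /= /D'; case: pselect => [Ds'|//].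
by apply/(stable_atP _ (mk_stable (stable_ex Ds'))).
Qed.

(** For each [s], the pieces are finitely many closed sets covering [X], one for
    each trace over [s]. *)
Definition piece s (q : T) : set X := (fun p : T => snd_act s0 p x0) @`
  [set p | Lid p /\ trace s (first_point p) = trace s (first_point q)].

Lemma piece_closed s q : closed (piece s q).
Proof.
apply: compact_closed; first exact: flow_hausdorff.
apply: (@continuous_compact _ _ (fun p : T => snd_act s0 p x0)).
  by apply: continuous_subspaceT; exact: snd_act_continuous.
apply: (subclosed_compact _ (@ei_ideal_compact _ _ d)); last by move=> p [].
have -> : [set p | Lid p /\ trace s (first_point p) = trace s (first_point q)] =
    Lid `&` \bigcap_(D in [set D : stable_set M | stable s (val D)])
      (first_point @^-1` [set z | stable_clopen D z <-> stable_clopen D (first_point q)]).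
  apply/seteqP; split=> p [Lp pc]; split=> //.
    move=> D Ds /=; rewrite /stable_clopen /= -!stable_atP.
    by split=> h; [have [] : trace s (first_point q) (val D) by rewrite -pc
      |have [] : trace s (first_point p) (val D) by rewrite pc].
  apply/seteqP; split=> D [Ds]; have := pc (mk_stable (stable_ex Ds)) Ds;
    rewrite /stable_clopen /= -!stable_atP => pqD pD; split => //; exact/pqD.
apply: closedI; first exact: ei_ideal_closed.
apply: closed_bigI => D _.
have fpc : continuous first_point.
  exact: (@prod_fst_continuous _ (flow_gspace P) (flow_gspace X)).
apply: (continuous_closedP first_point).1 fpc _ _.
have [Do Dc] := stable_clopenP D.
have [qD|nqD] := pselect (stable_clopen D (first_point q)).
  suff -> : [set z | stable_clopen D z <-> stable_clopen D (first_point q)] =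
    stable_clopen D by [].
  by apply/seteqP; split=> z /= h; [exact/h|split].
suff -> : [set z | stable_clopen D z <-> stable_clopen D (first_point q)] =
    ~` stable_clopen D by exact: open_closedC.
by apply/seteqP; split=> z /= h; [move=> /h|split].
Qed.

Lemma pieces_finite s : finite_set (piece s @` Lid).
Proof.
have -> : piece s @` Lid = (fun c => (fun p : T => snd_act s0 p x0) @`
    [set p | Lid p /\ trace s (first_point p) = c]) @` traces s.
  by rewrite /traces image_comp.
exact/finite_image/traces_finite.
Qed.

Definition base_sets s : set (set X) :=
  [set ~` \bigcup_(Q in J) Q | J in [set J | J `<=` piece s @` Lid]].

Lemma base_sets_finite s : finite_set (base_sets s).
Proof.
have /finite_seqP[t tE] := pieces_finite s.
pose B (m : {ffun 'I_(size t) -> bool}) : set X :=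
  ~` \bigcup_(i in [set i | m i]) nth set0 t i.
have fB : finite_set (range B).
  by apply: (@finite_range_factor _ _ {ffun 'I_(size t) -> bool} _ id) => m m' ->.
apply: sub_finite_set fB => _ [J Jt <-].
exists [ffun i : 'I_(size t) => `[< J (nth set0 t i) >]] => //.
rewrite /B; congr (~` _); apply/seteqP; split=> x.
  by move=> [i /=]; rewrite ffunE => /asboolP Ji xi; exists (nth set0 t i).
move=> [Q JQ Qx]; have Qt : Q \in t by have : [set` t] Q by rewrite -tE; exact: Jt.
have it : (index Q t < size t)%N by rewrite index_mem.
exists (Ordinal it) => /=; last by rewrite nth_index.
by rewrite ffunE /= nth_index //; exact/asboolP.
Qed.

Lemma base_sets_open s B : base_sets s B -> open B.
Proof.
move=> [J Jp <-]; apply: closed_openC; apply: closed_bigcup.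
  exact: sub_finite_set Jp (pieces_finite s).
by move=> Q /Jp[q _ <-]; exact: piece_closed.
Qed.

(** Remove from [X] the finitely many pieces that do not contain [x]. For a
    suitable [s], two elements of the ideal with the same trace over [s], one of
    which maps [x0] to [x], both map [x0] into the closure of a small
    neighbourhood of [x]; so what is left is contained in [A]. *)
Lemma base_sets_nbhs x (A : set X) : nbhs x A ->
  exists s B, [/\ base_sets s B, B x & B `<=` A].
Proof.
move=> nA; have nT : nbhs x [set: X] by exact: filterT.
have [V nV VA] := @compact_regular X x setT (@flow_hausdorff _ X)
  (@flow_compact _ X) nT A nA.
have [s [W [nW sW]]] := flow_stab_nbhs nV.
pose bad := [set piece s q | q in
  [set q | Lid q /\ ~ piece s q x]].
exists s, (~` \bigcup_(Q in bad) Q); split.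
- by exists bad => // _ [q [Lq _] <-]; exists q.
- by move=> [_ [q [_ nq] <-]].
move=> y ny; apply: VA.
have [p' Lp' p'y] := @ideal_transitive _ X (flow_gspace P) s0 d x0 y Xmin.
have yp' : piece s p' y by exists p'.
have [p [Lp pp'] px] : piece s p' x.
  by apply: contrapT => nx; apply: ny; exists (piece s p') => //; exists p'.
pose D : set G := [set h | exists2 g, agree s g h & W (flow_act g x0)].
have Ds : stable s D.
  by move=> g h gh [k kg Wk]; exists k => // a sa; rewrite kg//; exact: gh.
pose D' := mk_stable (stable_ex Ds).
have Dcl : clopen (fst @^-1` stable_clopen D' : set Y).
  by apply: clopen_preimage (stable_clopenP D'); exact: fst_continuous.
have c2 := @snd_act_continuous _ X (flow_gspace P) s0 x0.
have pD : stable_at (first_point p) D.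
  apply/(stable_atP _ D').
  have n1 : nbhs p ((fun p : T => snd_act s0 p x0) @^-1` W).
    by apply: (continuous_nbhs c2); rewrite px.
  have n2 := clopen_nbhs_eval p (s0, x0) Dcl.
  have [_ [g _ <-] /nbhs_singleton[/= Wg]] :=
    nbhs_closure (ei_ideal_sub Lp) (filterI n1 n2).
  move=> gD; apply/gD; rewrite -/(stable_clopen _ _).
  by apply/(stable_clopen_base g D'); exists g.
have p'D : stable_at (first_point p') D.
  by have [] : trace s (first_point p') D by rewrite -pp'.
apply: closureP => V' nV'.
have n1 : nbhs p' ((fun p : T => snd_act s0 p x0) @^-1` V').
  by apply: (continuous_nbhs c2); rewrite p'y.
have n2 := clopen_nbhs_eval p' (s0, x0) Dcl.
have [_ [g _ <-] /nbhs_singleton[/= V'g gD]] :=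
  nbhs_closure (ei_ideal_sub Lp') (filterI n1 n2).
exists (flow_act g x0) => //.
have /(stable_clopen_base g D')[h hg Wh] : stable_clopen D' (gact (flow_gspace P) g s0).
  by apply/gD; exact/(stable_atP _ D').
exact: sW Wh.
Qed.

End CountableBase.

Lemma ERdeg_metrizable (R : realType) (L : language) (M : structure L)
    (X : flow (aut M)) :
  countable [set: M] -> sep_fin_ERdeg M -> minimal_flow X -> metrizable R X.
Proof.
move=> Mc Mer Xmin; have [[x0 _] _] := Xmin.
have [d] := ellis_idempotent_exists
  (prod_gspace (flow_gspace (stable_flow M)) (flow_gspace X)).
apply: (@countable_base_metrizable R X (@flow_compact _ X) (@flow_hausdorff _ X)
  (\bigcup_(s in [set: seq M]) base_sets d x0 s)).
- apply: bigcup_countable => [|s _]; last first.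
    exact/finite_set_countable/base_sets_finite.
  have /pcard_leP/injfunPex[i _ iinj] := Mc.
  apply/pcard_leP/injfunPex; exists (fun s => pickle (map i s)) => //.
  move=> s t _ _ /(pcan_inj pickleK); apply: inj_map => a b; apply: iinj; exact: in_setT.
- by move=> B [s _]; exact: base_sets_open.
- by move=> x A /(base_sets_nbhs Xmin d x0)[s [B [sB Bx BA]]]; exists B; split=> //; exists s.
Qed.

(** * Ellis groups, distal flows and Ramsey degrees *)

Theorem corollary4p26 (R : realType) (L : language) (M : structure L) :
  (forall N : monster_model (sorts M),
     sep_fin_EDRdeg (@sigma_act L M N) ->
     profinite_ellis_group (@sigma_act L M N) /\
     (forall X : flow (aut M),
        distal_flow X -> minimal_flow X -> profinite_flow X)) /\
  (sep_fin_ERdeg M ->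
     forall X : flow (aut M),
       distal_flow X -> minimal_flow X -> profinite_flow X) /\
  (countable [set: M] ->
     forall X : flow (aut M), universal_minimal_flow X ->
       (sep_fin_ERdeg M <-> metrizable R X)).
Proof.
split=> [N edr|].
  split; first exact: Sigma_profinite_ellis_group.
  exact: Sigma_distal_profinite edr.
split=> [er X|Mcount X Xuniv]; first exact: ERdeg_distal_profinite.
split=> [er|]; last exact: metrizable_ERdeg Xuniv.
by apply: ERdeg_metrizable => //; case: Xuniv.
Qed.
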